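(* Let $q\in\mathbb C$ with $q\neq0$ and $|q|\neq1$, let $x=\frac12(z+z^{-1})\in\mathbb C$, and let $\alpha,\beta,t\in\mathbb C\setminus\{0\}$ be such that $|q^{\alpha+\frac12}t|<1$. Then $$\sum_{n=0}^\infty\frac{(q^{\alpha+\beta+1},q^{\frac12(\alpha+\beta+3)};q)_n}{(q^{\beta+1},q^{\frac12(\alpha+\beta+1)};q)_n}\,t^n\,P_n^{(\alpha,\beta)}(x|q)$$ $$=\frac{(-q^{\frac12(3\alpha+\beta+5)}t,\;q^{2\alpha+1}t^2,\;-q^{\frac12(\alpha+\beta+2)}t,\;q^{\alpha+\frac\beta2+\frac74}tz,\;q^{\alpha+\frac\beta2+\frac74}tz^{-1};q)_\infty}{(q^{2\alpha+2}t^2,\;-q^{\alpha+\beta+\frac52}t,\;-q^{\alpha+1}t,\;q^{\frac\alpha2+\frac14}tz,\;q^{\frac\alpha2+\frac14}tz^{-1};q)_\infty}$$ $$\quad\times{}_8W_7\left(-q^{\alpha+\beta+\frac32}t;\;-q^{\alpha+\frac32}t,\;q^{\frac12(\beta-\alpha)},\;q^{\frac12(\alpha+\beta+3)},\;-q^{\frac\beta2+\frac34}z,\;-q^{\frac\beta2+\frac34}z^{-1};\;q,\;-q^{\alpha+\frac12}t\right).$$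
   Context: Complex powers of $q$: fix a logarithm $\log q$ and set $q^s:=\exp(s\log q)$. Notation: $(a;q)_n:=\prod_{k=0}^{n-1}(1-aq^k)$, $(a;q)_\infty:=\prod_{k\ge0}(1-aq^k)$, and $(a_1,\dots,a_r;q)_n:=\prod_i (a_i;q)_n$ (also for $n=\infty$). Very-well-poised series: ${}_{8}W_7(a;a_1,\dots,a_5;q,u):=\sum_{k=0}^\infty\frac{1-aq^{2k}}{1-a}\frac{(a,a_1,\dots,a_5;q)_k}{(q,qa/a_1,\dots,qa/a_5;q)_k}u^k$. Askey--Wilson polynomials: for $x=\frac12(z+z^{-1})$, $$p_n(x;a,b,c,d|q):=a^{-n}(ab,ac,ad;q)_n\sum_{k=0}^n\frac{(q^{-n},q^{n-1}abcd,az,az^{-1};q)_k}{(q,ab,ac,ad;q)_k}q^k.$$ Continuous $q$-Jacobi polynomials: $$P_n^{(\alpha,\beta)}(x|q):=\frac{q^{(\frac{\alpha}{2}+\frac14)n}}{(q,-q^{\frac{\alpha+\beta+1}{2}},-q^{\frac{\alpha+\beta+2}{2}};q)_n}\,p_n\left(x;q^{\frac{\alpha}{2}+\frac14},q^{\frac{\alpha}{2}+\frac34},-q^{\frac{\beta}{2}+\frac14},-q^{\frac{\beta}{2}+\frac34}\big|q\right).$$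
   Formalization: The identity is proved whenever the left series converges (e.g. |q^{α/2+1/4}tz^{±1}|<1), since |q^{α+1/2}t|<1 alone does not ensure this; all denominators are assumed nonzero, and |q|>1 is excluded because the infinite products then diverge. *)

(* Defs.v *)
From Stdlib Require Export Reals Lra List.
From Stdlib Require Import ClassicalEpsilon.
From Coquelicot Require Export Coquelicot.
Export ListNotations.
Open Scope C_scope.

Definition Cexp (s : C) : C :=
  ((exp (Re s) * cos (Im s))%R, (exp (Re s) * sin (Im s))%R).

(* [q^s], where [logq] is the fixed logarithm of [q]. *)
Definition qpow (logq s : C) : C := Cexp (s * logq).

(* Limit of a complex sequence, computed componentwise; it is only meaningful
   when the sequence converges, see [Clim_correct]. *)
Definition Clim (u : nat -> C) : C :=
  (real (Lim_seq (fun n => Re (u n))), real (Lim_seq (fun n => Im (u n)))).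

Definition Csum (u : nat -> C) (n : nat) : C := sum_n (G := C_AbelianMonoid) u n.

Definition Ccvg_to (u : nat -> C) (l : C) : Prop :=
  filterlim u eventually (locally (T := C_NormedModule) l).

Definition ex_Cseries (u : nat -> C) : Prop :=
  ex_series (K := C_AbsRing) (V := C_NormedModule) u.

Definition CSeries (u : nat -> C) : C := Clim (Csum u).

Fixpoint qpoch (a q : C) (n : nat) : C :=
  match n with
  | O => 1
  | S k => qpoch a q k * (1 - a * q ^ k)
  end.

Definition qpochs (l : list C) (q : C) (n : nat) : C :=
  fold_right (fun a p => qpoch a q n * p) 1 l.

Definition qpoch_inf (a q : C) : C := Clim (qpoch a q).

Definition qpochs_inf (l : list C) (q : C) : C :=
  fold_right (fun a p => qpoch_inf a q * p) 1 l.

(* [(a;q)_oo] converges and may be used as a denominator.  When [1 < Cmod q]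
   and [a <> 0] the partial products are unbounded or eventually 0, so this
   fails. *)
Definition qpoch_inf_invertible (a q : C) : Prop :=
  exists l : C, l <> 0 /\ Ccvg_to (qpoch a q) l.

Definition W87_term (a a1 a2 a3 a4 a5 q u : C) (k : nat) : C :=
  (1 - a * q ^ (2 * k)) / (1 - a)
  * (qpochs [a; a1; a2; a3; a4; a5] q k
     / qpochs [q; q * a / a1; q * a / a2; q * a / a3; q * a / a4; q * a / a5] q k)
  * u ^ k.

Definition W87 (a a1 a2 a3 a4 a5 q u : C) : C :=
  CSeries (W87_term a a1 a2 a3 a4 a5 q u).

(* No denominator of the series [W87] vanishes. *)
Definition W87_wd (a a1 a2 a3 a4 a5 q : C) : Prop :=
  1 - a <> 0 /\
  forall k : nat,
    qpochs [q; q * a / a1; q * a / a2; q * a / a3; q * a / a4; q * a / a5] q k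
    <> 0.

(* Value of the Askey--Wilson polynomial at [(z + 1/z) / 2]; the factor
   [q^(n-1)] is written [q^n / q] so that it is right for [n = 0] too. *)
Definition askey_wilson_z (n : nat) (z a b c d q : C) : C :=
  / a ^ n * qpochs [a * b; a * c; a * d] q n
  * Csum (fun k =>
      qpochs [/ q ^ n; q ^ n / q * (a * b * c * d); a * z; a * / z] q k
      / qpochs [q; a * b; a * c; a * d] q k * q ^ k) n.

(* Some [z] with [x = (z + 1/z) / 2].  The other choice is [1/z], which gives
   the same polynomial: see [askey_wilson_at]. *)
Definition uniformizer (x : C) : C :=
  epsilon (inhabits (1 : C)) (fun z => z <> 0 /\ x = (z + / z) / 2).

Definition askey_wilson (n : nat) (x a b c d q : C) : C :=
  askey_wilson_z n (uniformizer x) a b c d q.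

(* [logq] is the fixed logarithm of [q]. *)
Definition cont_q_jacobi (q logq : C) (n : nat) (alpha beta x : C) : C :=
  qpow logq ((alpha / 2 + 1 / 4) * INR n)
  / qpochs [q; - qpow logq ((alpha + beta + 1) / 2);
               - qpow logq ((alpha + beta + 2) / 2)] q n
  * askey_wilson n x
      (qpow logq (alpha / 2 + 1 / 4)) (qpow logq (alpha / 2 + 3 / 4))
      (- qpow logq (beta / 2 + 1 / 4)) (- qpow logq (beta / 2 + 3 / 4)) q.

Lemma Clim_correct (u : nat -> C) (l : C) : Ccvg_to u l -> Clim u = l.
Proof.
intros H.
assert (H' := proj1 (filterlim_locally_ball_norm (K := C_AbsRing)
  (U := C_NormedModule) (F := eventually) u l) H).
assert (Hd : forall w : C,
  (Rabs (Re w) <= Cmod w)%R /\ (Rabs (Im w) <= Cmod w)%R).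
{ intros w; unfold Re, Im; generalize (Rmax_Cmod w); intros Hm; split;
    (eapply Rle_trans; [|exact Hm]); [apply Rmax_l | apply Rmax_r]. }
assert (HR : is_lim_seq (fun n => Re (u n)) (Re l)).
{ apply is_lim_seq_spec; intros eps.
  destruct (H' eps) as [N HN]; exists N; intros n Hn.
  specialize (HN n Hn). unfold ball_norm in HN.
  eapply Rle_lt_trans; [|exact HN].
  exact (proj1 (Hd (u n - l))). }
assert (HI : is_lim_seq (fun n => Im (u n)) (Im l)).
{ apply is_lim_seq_spec; intros eps.
  destruct (H' eps) as [N HN]; exists N; intros n Hn.
  specialize (HN n Hn). unfold ball_norm in HN.
  eapply Rle_lt_trans; [|exact HN].
  exact (proj2 (Hd (u n - l))). }
unfold Clim.
rewrite (is_lim_seq_unique _ _ HR), (is_lim_seq_unique _ _ HI).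
destruct l; reflexivity.
Qed.

Lemma CSeries_correct (u : nat -> C) (l : C) :
  is_series (K := C_AbsRing) (V := C_NormedModule) u l -> CSeries u = l.
Proof. exact (Clim_correct (Csum u) l). Qed.

Lemma askey_wilson_at (n : nat) (x z a b c d q : C) :
  z <> 0 -> x = (z + / z) / 2 ->
  askey_wilson n x a b c d q = askey_wilson_z n z a b c d q.
Proof.
intros Hz Hx; unfold askey_wilson.
destruct (epsilon_spec (inhabits (1 : C))
  (fun w => w <> 0 /\ x = (w + / w) / 2) (ex_intro _ z (conj Hz Hx)))
  as [Hw Hwx].
change (epsilon _ _) with (uniformizer x) in Hw, Hwx.
set (w := uniformizer x) in *; clearbody w.
assert (H2 : (2 : C) <> 0) by (intros H; apply RtoC_inj in H; lra).
assert (E : z + / z = w + / w).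
{ transitivity ((z + / z) / 2 * 2); [field; auto|].
  rewrite <- Hx, Hwx; field; auto. }
assert (F : (w - z) * (w - / z) = 0).
{ transitivity (w * (w + / w - (z + / z))); [field; auto|].
  rewrite E; ring. }
destruct (Ceq_dec w z) as [-> | Hn]; [reflexivity|].
assert (Ew : w = / z).
{ destruct (Ceq_dec w (/ z)) as [|Hn']; auto.
  exfalso; revert F; apply Cmult_neq_0; apply Cminus_eq_contra; auto. }
assert (Ez : / w = z) by (rewrite Ew; field; auto).
unfold askey_wilson_z; f_equal; unfold Csum; apply sum_n_ext; intros k.
f_equal; f_equal; simpl; rewrite Ez, Ew; ring.
Qed.

(* Main.v *)
Require Import Defs.
From Stdlib Require Import Lia.

(** Write [A = q^(alpha/2+1/4)], [B = q^(beta/2+1/4)], [p = q^(1/2)] and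
    [d = - B p].  After clearing the poles in [t], the identity reads
    [D(t) L(t) = N(t)], where [L] is the generating series, [D] an entire product
    and [N] a power series converging for [|A^2 t| < 1].  The coefficients of
    [D L] and [N] are Laurent polynomials in [z], so it is enough to compare them
    at [z = q^-N / d].  In the expansion of the Askey-Wilson polynomial on
    [(d z, d / z; q)_k] only [k <= N] then survive; the weights of [L] are
    very-well-poised, so for small [t] the sum over [n] is done by the q-binomial
    theorem, and the remaining balanced 4phi3 is the terminating 8W7 of [N] by
    Watson's transformation.  Once [D L = N] holds coefficientwise, Mertens'
    theorem gives the identity wherever [L] converges, so neither analytic
    continuation nor Abel's theorem is needed.  Watson's transformation also
    yields the basis change and the convolution formula that bounds the
    polynomials.  For [|q| > 1] the hypothesis [hden] is contradictory. *)

(** * Finite q-series *)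

Lemma Csum_0 (u : nat -> C) : Csum u 0 = u 0%nat.
Proof. unfold Csum. rewrite sum_O. reflexivity. Qed.

Lemma Csum_S (u : nat -> C) n : Csum u (S n) = Csum u n + u (S n).
Proof. unfold Csum. rewrite sum_Sn. reflexivity. Qed.

Lemma Csum_ext (u v : nat -> C) n :
  (forall k, (k <= n)%nat -> u k = v k) -> Csum u n = Csum v n.
Proof. intros H. apply sum_n_ext_loc. exact H. Qed.

Lemma Csum_plus (u v : nat -> C) n :
  Csum (fun k => u k + v k) n = Csum u n + Csum v n.
Proof. induction n; rewrite ?Csum_0, ?Csum_S, ?IHn; [reflexivity | ring]. Qed.

Lemma Csum_scal (c : C) (u : nat -> C) n :
  Csum (fun k => c * u k) n = c * Csum u n.
Proof. induction n; rewrite ?Csum_0, ?Csum_S, ?IHn; [reflexivity | ring]. Qed.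

Lemma Csum_zero (u : nat -> C) n :
  (forall k, (k <= n)%nat -> u k = 0) -> Csum u n = 0.
Proof.
intros H; induction n; rewrite ?Csum_0, ?Csum_S; [apply H; lia|].
rewrite IHn by (intros; apply H; lia); rewrite H by lia; ring.
Qed.

Lemma Csum_S_l (u : nat -> C) n :
  Csum u (S n) = u 0%nat + Csum (fun k => u (S k)) n.
Proof. induction n; [rewrite Csum_S, !Csum_0; reflexivity|].
rewrite Csum_S, IHn, Csum_S; ring. Qed.

Lemma Csum_rev (u : nat -> C) n : Csum (fun k => u (n - k)%nat) n = Csum u n.
Proof.
revert u; induction n as [|n IH]; intros u; [reflexivity|].
rewrite Csum_S_l, Csum_S, <- (IH u), Cplus_comm, Nat.sub_0_r; reflexivity.
Qed.

Lemma Csum_swap (f : nat -> nat -> C) n m :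
  Csum (fun i => Csum (fun j => f i j) m) n = Csum (fun j => Csum (fun i => f i j) n) m.
Proof.
induction n as [|n IH].
- rewrite Csum_0; apply Csum_ext; intros; rewrite Csum_0; reflexivity.
- rewrite Csum_S, IH, <- Csum_plus; apply Csum_ext; intros; rewrite Csum_S; reflexivity.
Qed.

Lemma qpoch_S_l (x q : C) n : qpoch x q (S n) = (1 - x) * qpoch (x * q) q n.
Proof.
induction n as [|n IH]; [simpl; ring|].
change (qpoch x q (S (S n))) with (qpoch x q (S n) * (1 - x * q ^ S n)).
rewrite IH; simpl; ring.
Qed.

Lemma qpoch_S (x q : C) n : qpoch x q (S n) = qpoch x q n * (1 - x * q ^ n).
Proof. reflexivity. Qed.

Lemma qpoch_add (x q : C) m n :
  qpoch x q (m + n) = qpoch x q m * qpoch (x * q ^ m) q n.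
Proof.
induction n as [|n IH]; [rewrite Nat.add_0_r; simpl; ring|].
rewrite Nat.add_succ_r; simpl; rewrite IH, Cpow_add_r; ring.
Qed.

Lemma Cmult_neq_0_iff (x y : C) : x * y <> 0 <-> x <> 0 /\ y <> 0.
Proof.
split; [|intros [H1 H2]; apply Cmult_neq_0; auto].
intros H; split; intros E; apply H; rewrite E; ring.
Qed.

Lemma qpoch_nz_le (x q : C) n k :
  qpoch x q n <> 0 -> (k <= n)%nat -> qpoch x q k <> 0.
Proof.
intros H L; replace n with (k + (n - k))%nat in H by lia.
rewrite qpoch_add in H; apply Cmult_neq_0_iff in H; tauto.
Qed.

Lemma qpoch_nz_factor (x q : C) n k :
  qpoch x q n <> 0 -> (k < n)%nat -> 1 - x * q ^ k <> 0.
Proof.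
intros H L; assert (H' := qpoch_nz_le x q n (S k) H L).
apply Cmult_neq_0_iff in H'; tauto.
Qed.

Lemma qpoch_nz (x q : C) n :
  (forall k, (k < n)%nat -> 1 - x * q ^ k <> 0) -> qpoch x q n <> 0.
Proof.
induction n as [|n IH]; intros H; [exact C1_nz|].
simpl; apply Cmult_neq_0; [apply IH; intros; apply H|apply H]; lia.
Qed.

Lemma qpoch_eq_0 (x q : C) k n : x * q ^ k = 1 -> (k < n)%nat -> qpoch x q n = 0.
Proof.
intros E L. destruct (Ceq_dec (qpoch x q n) 0) as [|H]; [assumption|].
exfalso; apply (qpoch_nz_factor x q n k H L); rewrite E; ring.
Qed.

Lemma Cmult_cancel_l (x y w : C) : x <> 0 -> x * y = x * w -> y = w.
Proof.
intros Hx E; transitivity (/ x * (x * y)); [field; exact Hx|].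
rewrite E; field; exact Hx.
Qed.

Lemma qpoch_shift (x q : C) n :
  qpoch x q n * (1 - x * q ^ n) = (1 - x) * qpoch (x * q) q n.
Proof. exact (qpoch_S_l x q n). Qed.

Section Finite.
Variable q : C.
Hypothesis q_nz : q <> 0.
Hypothesis qq_nz : forall n, qpoch q q n <> 0.

Lemma qS_nz n : 1 - q * q ^ n <> 0.
Proof. exact (qpoch_nz_factor q q (S n) n (qq_nz (S n)) (Nat.lt_succ_diag_r n)). Qed.

Lemma qVn_poch_eq_0 n k : (n < k)%nat -> qpoch (/ q ^ n) q k = 0.
Proof.
intros L; apply (qpoch_eq_0 _ _ n); [|exact L].
apply Cinv_l, Cpow_nz, q_nz.
Qed.

(* The summands for [k] and [k+1], weighted by the ratio of the right-hand
   sides, telescope in [j]. *)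
Lemma saalschutz_telescope (a b c f : C) (k J : nat) :
  a * q = b * c * f ->
  qpoch (f * b) q J <> 0 -> qpoch (f * c) q J <> 0 ->
  let T k j := qpoch (/ q ^ k) q j * qpoch (a * q ^ k) q j * qpoch f q j
       / (qpoch q q j * qpoch (f * b) q j * qpoch (f * c) q j) * q ^ j in
  Csum (fun j => (1 - f * b * q ^ k) * (1 - f * c * q ^ k) * T (S k) j
                 - f * (1 - b * q ^ k) * (1 - c * q ^ k) * T k j) J
  = (1 - a * q * (q ^ k * q ^ k)) * qpoch (/ q ^ k) q J
    * qpoch (a * q ^ S k) q J * qpoch f q (S J)
    / (qpoch q q J * qpoch (f * b) q J * qpoch (f * c) q J).
Proof.
intros Ha Hb Hc T.
assert (Ea : a = b * c * f / q) by (rewrite <- Ha; field; exact q_nz).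
assert (Hk := Cpow_nz q k q_nz).
induction J as [|J IH].
- rewrite Csum_0; unfold T; cbn [qpoch Cpow]; rewrite Ea; field; exact q_nz.
- rewrite Csum_S, IH
    by (eapply qpoch_nz_le; [eassumption|lia]).
  clear IH; unfold T.
  assert (E1 : qpoch (/ q ^ S k) q (S J) = (1 - / q ^ S k) * qpoch (/ q ^ k) q J).
  { rewrite qpoch_S_l; f_equal; f_equal; simpl; field; auto. }
  assert (E2 : qpoch (a * q ^ k) q (S J) = (1 - a * q ^ k) * qpoch (a * q ^ S k) q J).
  { rewrite qpoch_S_l; f_equal; f_equal; simpl; ring. }
  rewrite E1, E2; clear E1 E2.
  rewrite qpoch_S in Hb, Hc; apply Cmult_neq_0_iff in Hb, Hc.
  destruct Hb as [Hb1 Hb2], Hc as [Hc1 Hc2].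
  assert (Hq1 := qq_nz J); assert (Hq2 := qS_nz J).
  rewrite !(qpoch_S _ _ J), !(qpoch_S _ _ (S J)), !(qpoch_S _ _ J), !Cpow_S.
  generalize dependent (qpoch (f * b) q J); intros X1 H1.
  generalize dependent (qpoch (f * c) q J); intros X2 H2.
  generalize dependent (qpoch q q J); intros X3 H3.
  generalize (qpoch f q J), (qpoch (/ q ^ k) q J); intros X4 X5.
  generalize (qpoch (a * (q * q ^ k)) q J); intros X6.
  generalize dependent (q ^ J); intros J' H4 H5 H6.
  generalize dependent (q ^ k); intros K HK.
  subst a.
  field; repeat split; auto.
Qed.

Lemma saalschutz (a b c f : C) (k : nat) :
  a * q = b * c * f ->
  qpoch (f * b) q k <> 0 -> qpoch (f * c) q k <> 0 ->
  Csum (fun j => qpoch (/ q ^ k) q j * qpoch (a * q ^ k) q j * qpoch f q j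
       / (qpoch q q j * qpoch (f * b) q j * qpoch (f * c) q j) * q ^ j) k
  = qpoch b q k * qpoch c q k * f ^ k / (qpoch (f * b) q k * qpoch (f * c) q k).
Proof.
intros Ha; induction k as [|k IH]; intros Hb Hc.
- rewrite Csum_0; cbn [qpoch Cpow]; field.
- assert (HT := saalschutz_telescope a b c f k (S k) Ha Hb Hc); cbv zeta in HT.
  rewrite (qVn_poch_eq_0 k (S k)) in HT by lia.
  assert (Hb' := qpoch_nz_le _ _ _ k Hb ltac:(lia)).
  assert (Hc' := qpoch_nz_le _ _ _ k Hc ltac:(lia)).
  specialize (IH Hb' Hc').
  unfold Cminus in HT at 1.
  rewrite Csum_plus, Csum_scal in HT.
  rewrite (Csum_ext (fun j => - _) (fun j => (- (f * (1 - b * q ^ k) * (1 - c * q ^ k))) *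
     (qpoch (/ q ^ k) q j * qpoch (a * q ^ k) q j * qpoch f q j
       / (qpoch q q j * qpoch (f * b) q j * qpoch (f * c) q j) * q ^ j))) in HT
    by (intros; ring).
  match goal with |- ?S = _ => set (S0 := S) in * end.
  clearbody S0.
  rewrite Csum_scal, Csum_S, IH, (qVn_poch_eq_0 k (S k)) in HT by lia.
  rewrite qpoch_S in Hb, Hc; rewrite !(qpoch_S _ _ k).
  apply Cmult_neq_0_iff in Hb, Hc; destruct Hb as [_ Hb], Hc as [_ Hc].
  apply Cmult_cancel_l with ((1 - f * b * q ^ k) * (1 - f * c * q ^ k));
    [apply Cmult_neq_0; assumption|].
  match type of HT with ?l + ?m = ?r => transitivity (r - m); [rewrite <- HT; ring|] end.
  unfold Cdiv; rewrite (Cpow_S f), ?Cmult_0_l, ?Cmult_0_r, ?Cmult_0_l, ?Cmult_0_r, ?Cmult_0_l.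
  rewrite ?Cmult_0_r, ?Cmult_0_l.
  field; repeat split; auto.
Qed.

Definition vwp (a d e f : C) (j k : nat) : C :=
  qpoch a q k * qpoch d q k * qpoch e q k * qpoch f q k
  * (qpoch (/ q ^ k) q j * qpoch (a * q ^ k) q j)
  / (qpoch q q k * qpoch (q * a / d) q k * qpoch (q * a / e) q k
     * qpoch (q * a / f) q k) * (q * a / (d * e * f)) ^ k.

(* [vwp a d e f j k] times a polynomial of degree one in [q^-k + a q^k]
   is a difference in [k]. *)
Lemma vwp_telescope (a d e f : C) (j K : nat) :
  a <> 0 -> d <> 0 -> e <> 0 -> f <> 0 ->
  qpoch (q * a / d) q K <> 0 -> qpoch (q * a / e) q K <> 0 ->
  qpoch (q * a / f) q K <> 0 ->
  let g := a / (d * e * f * q ^ j) in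
  Csum (fun k => vwp a d e f j k * (1 - a * (q ^ k * q ^ k))
     * ((g - 1) * (/ q ^ k + a * q ^ k)
        + (/ q ^ j + a / d + a / e + a / f - g * (a * q ^ j + d + e + f)))) K
  = (1 - a * q ^ j * q ^ K) * (1 - d * q ^ K) * (1 - e * q ^ K) * (1 - f * q ^ K)
    * (g / q ^ K) * vwp a d e f j K.
Proof.
intros Ha Hd He Hf H1 H2 H3 g.
assert (Hj := Cpow_nz q j q_nz).
induction K as [|K IH].
- rewrite Csum_0; unfold vwp, g; simpl.
  destruct j as [|j].
  + simpl; field; repeat split; auto.
  + replace (qpoch (/ 1) q (S j)) with (0 : C)
      by (symmetry; apply (qpoch_eq_0 _ _ 0); [simpl; field|lia]).
    field; repeat split; auto; exact C1_nz.
- rewrite Csum_S, IH by (eapply qpoch_nz_le; [eassumption|lia]); clear IH.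
  unfold vwp, g.
  assert (HK := Cpow_nz q K q_nz).
  assert (E1 := qpoch_shift (/ q ^ S K) q j).
  replace (/ q ^ S K * q) with (/ q ^ K) in E1 by (simpl; field; auto).
  assert (E2 := qpoch_shift (a * q ^ K) q j).
  replace (a * q ^ K * q) with (a * q ^ S K) in E2 by (simpl; ring).
  assert (HS := qS_nz K).
  assert (HS' : 1 - / q ^ S K <> 0).
  { intros E; apply HS; simpl in E.
    transitivity (- (q * q ^ K) * (1 - / (q * q ^ K))); [field; auto|].
    rewrite E; ring. }
  assert (E3 : qpoch (/ q ^ K) q j
     = qpoch (/ q ^ S K) q j * (1 - / q ^ S K * q ^ j) / (1 - / q ^ S K)).
  { rewrite E1; generalize (qpoch (/ q ^ S K) q j); revert HS'; generalize (/ q ^ S K).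
    intros; field; assumption. }
  rewrite E3; clear E1 E3.
  rewrite qpoch_S in H1, H2, H3; apply Cmult_neq_0_iff in H1, H2, H3.
  destruct H1 as [H1 H1'], H2 as [H2 H2'], H3 as [H3 H3'].
  assert (Hq := qq_nz K).
  rewrite !(qpoch_S _ _ K), !(Cpow_S _ K).
  rewrite !(Cpow_S _ K) in E2, HS'.
  generalize dependent (qpoch (q * a / d) q K); intros X1 H1.
  generalize dependent (qpoch (q * a / e) q K); intros X2 H2.
  generalize dependent (qpoch (q * a / f) q K); intros X3 H3.
  generalize dependent (qpoch q q K); intros X4 H4.
  generalize (qpoch a q K), (qpoch d q K), (qpoch e q K), (qpoch f q K).
  intros Y1 Y2 Y3 Y4.
  generalize ((q * a / (d * e * f)) ^ K); intros Y5.
  generalize dependent (qpoch (a * q ^ K) q j); intros R'.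
  generalize dependent (qpoch (a * (q * q ^ K)) q j); intros R.
  generalize dependent (qpoch (/ (q * q ^ K)) q j); intros P.
  generalize dependent (q ^ j); intros J.
  generalize dependent (q ^ K); intros Q.
  intros.
  assert (HS2 : q * Q - 1 <> 0).
  { intros E; apply HS; replace (q * Q) with (q * Q - 1 + 1) by ring; rewrite E; ring. }
  match goal with |- ?l + ?m = ?r =>
    replace l with (R' * (1 - a * Q * J) * ((1 - d * Q) * (1 - e * Q) *
      (1 - f * Q) * (a / (d * e * f * J) / Q) *
     (Y1 * Y2 * Y3 * Y4 *
      (P * (1 - / (q * Q) * J) / (1 - / (q * Q)))  /
      (X4 * X1 * X2 * X3) * Y5))) end.
  + rewrite E2.
    assert (G : forall x : C, x <> 0 -> 1 - q * a / x * Q <> 0 -> x - q * a * Q <> 0).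
    { intros x Hx Hn E; apply Hn.
      transitivity ((x - q * a * Q) / x); [field; exact Hx | rewrite E; unfold Cdiv; ring]. }
    apply G in H1', H2', H3'; auto.
    field; repeat split; auto.
  + field; repeat split; auto.
Qed.

Lemma Vq_nz n : 1 - / q ^ S n <> 0.
Proof.
intros E; apply (qS_nz n).
assert (H := Cpow_nz q (S n) q_nz).
transitivity (- q ^ S n * (1 - / q ^ S n)); [change (q * q ^ n) with (q ^ S n); field; exact H|].
rewrite E; ring.
Qed.

Lemma qpoch_nz_tail (x : C) m n :
  qpoch x q (m + n) <> 0 -> qpoch (x * q ^ m) q n <> 0.
Proof. rewrite qpoch_add; intros H; apply Cmult_neq_0_iff in H; tauto. Qed.

Lemma vwp_contiguous (a d e : C) (n k : nat) :
  a <> 0 -> d <> 0 -> e <> 0 -> (k <= S n)%nat ->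
  qpoch (q * a / d) q k <> 0 -> qpoch (q * a / e) q k <> 0 ->
  qpoch (q * a) q (2 * S n) <> 0 ->
  (1 - / q ^ S n) * (1 - a * q ^ S n) * vwp a d e (/ q ^ n) 0 k
  = vwp a d e (/ q ^ S n) 0 k * (/ q ^ k + a * q ^ k - / q ^ S n - a * q ^ S n).
Proof.
intros Ha Hd He L H1 H2 H3.
assert (E1 := qpoch_shift (/ q ^ S n) q k).
assert (E2 := qpoch_shift (a * q ^ S n) q k).
unfold vwp.
assert (HV := Vq_nz n).
assert (Hx : qpoch (a * q ^ S n) q (S k) <> 0).
{ replace (a * q ^ S n) with (q * a * q ^ n) by (simpl; ring).
  apply qpoch_nz_tail; eapply qpoch_nz_le; [exact H3|lia]. }
assert (Hx1 := qpoch_nz_le _ _ _ k Hx ltac:(lia)).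
assert (Hxq := Hx); rewrite qpoch_S_l in Hxq; apply Cmult_neq_0_iff in Hxq.
destruct Hxq as [Hx2 Hx3].
apply qpoch_nz_factor with (k := k) in Hx; [|lia].
assert (Hn := Cpow_nz q n q_nz). assert (Hk := Cpow_nz q k q_nz).
replace (/ q ^ S n * q) with (/ q ^ n) in E1 by (simpl; field; auto).
replace (q * a / (/ q ^ n)) with (a * q ^ S n) by (simpl; field; auto).
replace (q * a / (/ q ^ S n)) with (a * q ^ S n * q) by (simpl; field; auto).
assert (E3 : qpoch (/ q ^ n) q k
   = qpoch (/ q ^ S n) q k * (1 - / q ^ S n * q ^ k) / (1 - / q ^ S n)).
{ rewrite E1; revert HV; generalize (/ q ^ S n); intros; field; assumption. }
assert (E4 : qpoch (a * q ^ S n * q) q k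
   = qpoch (a * q ^ S n) q k * (1 - a * q ^ S n * q ^ k) / (1 - a * q ^ S n)).
{ rewrite E2; field; assumption. }
replace ((q * a / (d * e * / q ^ n)) ^ k)
  with ((q * a / (d * e * / q ^ S n)) ^ k / q ^ k).
2:{ replace (q * a / (d * e * / q ^ S n)) with (q * a / (d * e * / q ^ n) * q)
      by (simpl; field; auto).
    rewrite Cpow_mult_l; field; exact Hk. }
rewrite E3, E4; clear E1 E2 E3 E4 Hx3.
cbn [qpoch].
assert (Hq := qq_nz k).
assert (HS := qS_nz n).
simpl Cpow in *.
generalize dependent (qpoch (a * (q * q ^ n)) q k); intros.
generalize dependent (qpoch (q * a / d) q k); intros.
generalize dependent (qpoch (q * a / e) q k); intros.
generalize dependent (qpoch q q k); intros.
generalize ((q * a / (d * e * / (q * q ^ n))) ^ k); intros.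
assert (HS2 : q * q ^ n - 1 <> 0).
{ intros E; apply HS; replace (q * q ^ n) with (q * q ^ n - 1 + 1) by ring; rewrite E; ring. }
field; repeat split; auto.
Qed.

Lemma vwp_sum (a d e : C) (n : nat) :
  a <> 0 -> d <> 0 -> e <> 0 ->
  qpoch (q * a / d) q n <> 0 -> qpoch (q * a / e) q n <> 0 ->
  qpoch (q * a) q (2 * n) <> 0 ->
  Csum (fun k => vwp a d e (/ q ^ n) 0 k * (1 - a * (q ^ k * q ^ k))) n
  = (1 - a) * qpoch (q * a) q n * qpoch (q * a / (d * e)) q n
    / (qpoch (q * a / d) q n * qpoch (q * a / e) q n).
Proof.
intros Ha Hd He; induction n as [|n IH]; intros H1 H2 H3.
- rewrite Csum_0; unfold vwp; simpl; field; apply C1_nz.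
- assert (Hn := Cpow_nz q n q_nz).
  assert (HT := vwp_telescope a d e (/ q ^ S n) 0 (S n) Ha Hd He).
  assert (HV0 : / q ^ S n <> 0).
  { intros E. apply (C1_nz). transitivity (q ^ S n * / q ^ S n).
    field. apply Cpow_nz, q_nz. rewrite E; ring. }
  assert (H3' : qpoch (q * a / / q ^ S n) q (S n) <> 0).
  { replace (q * a / / q ^ S n) with (q * a * q ^ S n) by (simpl; field; auto).
    apply qpoch_nz_tail; eapply qpoch_nz_le; [exact H3|lia]. }
  specialize (HT HV0 H1 H2 H3'); cbv zeta in HT.
  replace (1 - / q ^ S n * q ^ S n) with (0 : C) in HT by (simpl; field; auto).
  rewrite Cmult_0_r, !Cmult_0_l in HT.
  specialize (IH (qpoch_nz_le _ _ _ n H1 ltac:(lia))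
    (qpoch_nz_le _ _ _ n H2 ltac:(lia)) (qpoch_nz_le _ _ _ (2 * n) H3 ltac:(lia))).
  set (g := a / (d * e * / q ^ S n * q ^ 0)) in HT.
  set (x := a * q ^ S n).
  assert (HS : (g - 1) * ((1 - / q ^ S n) * (1 - x)) *
      Csum (fun k => vwp a d e (/ q ^ n) 0 k * (1 - a * (q ^ k * q ^ k))) (S n)
     = (- ((1 - / q ^ S n) * (1 - x / d) * (1 - x / e))) *
      Csum (fun k => vwp a d e (/ q ^ S n) 0 k * (1 - a * (q ^ k * q ^ k))) (S n)).
  { rewrite <- !Csum_scal.
    match goal with |- _ = ?r => replace r with (0 + r) by ring end.
    rewrite <- HT, <- Csum_plus; apply Csum_ext; intros k Hk.
    assert (E := vwp_contiguous a d e n k Ha Hd He Hk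
       (qpoch_nz_le _ _ _ k H1 Hk) (qpoch_nz_le _ _ _ k H2 Hk) H3).
    fold x in E; cbv beta.
    match goal with |- ?h * ?y * (?v * ?w) = _ =>
      transitivity (h * w * (y * v)); [ring|] end.
    rewrite E; unfold g, x.
    assert (Hk' := Cpow_nz q k q_nz).
    generalize (vwp a d e (/ q ^ S n) 0 k); intros v.
    simpl; field; repeat split; auto; exact C1_nz. }
  rewrite (Csum_S _ n) in HS at 1; rewrite IH in HS.
  replace (vwp a d e (/ q ^ n) 0 (S n)) with (0 : C) in HS
    by (unfold vwp; rewrite (qVn_poch_eq_0 n (S n)) by lia; unfold Cdiv; ring).
  match goal with |- ?S = _ => set (S0 := S) in * end; clearbody S0.
  rewrite qpoch_S in H1, H2; apply Cmult_neq_0_iff in H1, H2.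
  destruct H1 as [H1 H1'], H2 as [H2 H2'].
  assert (HV := Vq_nz n).
  apply Cmult_cancel_l with (- ((1 - / q ^ S n) * (1 - x / d) * (1 - x / e))).
  + assert (forall w : C, w <> 0 -> - w <> 0).
    { intros w Hw E; apply Hw; replace w with (- - w) by ring; rewrite E; ring. }
    apply H; repeat apply Cmult_neq_0; auto.
    * replace (x / d) with (q * a / d * q ^ n) by (unfold x; simpl; field; auto); auto.
    * replace (x / e) with (q * a / e * q ^ n) by (unfold x; simpl; field; auto); auto.
  + rewrite <- HS; rewrite !(qpoch_S _ _ n); unfold g, x.
    assert (G : forall w : C, w <> 0 -> 1 - q * a / w * q ^ n <> 0 -> w - q * a * q ^ n <> 0).
    { intros w Hx Hw E; apply Hw.
      transitivity ((w - q * a * q ^ n) / w); [field; exact Hx | rewrite E; unfold Cdiv; ring]. }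
    apply G in H1', H2'; auto.
    generalize dependent (qpoch (q * a / d) q n); intros.
    generalize dependent (qpoch (q * a / e) q n); intros.
    simpl; field; repeat split; auto; exact C1_nz.
Qed.

Lemma vwp_inner (a d e : C) (n j : nat) :
  a <> 0 -> d <> 0 -> e <> 0 ->
  qpoch (q * a / d) q n <> 0 -> qpoch (q * a / e) q n <> 0 ->
  qpoch (q * a) q (2 * n) <> 0 -> qpoch (d * e / q ^ n / a) q j <> 0 ->
  Csum (fun k => vwp a d e (/ q ^ n) j k * (1 - a * (q ^ k * q ^ k))) n
  = (1 - a) * qpoch (q * a) q n * qpoch (q * a / (d * e)) q n
    / (qpoch (q * a / d) q n * qpoch (q * a / e) q n)
    * (qpoch d q j * qpoch e q j * qpoch (/ q ^ n) q j
       / qpoch (d * e / q ^ n / a) q j).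
Proof.
intros Ha Hd He H1 H2 H3; induction j as [|j IH]; intros H4.
- rewrite vwp_sum by assumption; simpl; field; repeat split; auto.
- assert (Hn := Cpow_nz q n q_nz). assert (Hj := Cpow_nz q j q_nz).
  assert (HV0 : / q ^ n <> 0).
  { intros E. apply (C1_nz). transitivity (q ^ n * / q ^ n).
    field. exact Hn. rewrite E; ring. }
  assert (H3' : qpoch (q * a / / q ^ n) q n <> 0).
  { replace (q * a / / q ^ n) with (q * a * q ^ n) by (simpl; field; auto).
    apply qpoch_nz_tail; eapply qpoch_nz_le; [exact H3|lia]. }
  assert (HT := vwp_telescope a d e (/ q ^ n) j n Ha Hd He HV0 H1 H2 H3'); cbv zeta in HT.
  replace (1 - / q ^ n * q ^ n) with (0 : C) in HT by (simpl; field; auto).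
  rewrite Cmult_0_r, !Cmult_0_l in HT.
  rewrite qpoch_S in H4; apply Cmult_neq_0_iff in H4; destruct H4 as [H4 H4'].
  specialize (IH H4).
  set (g := a / (d * e * / q ^ n * q ^ j)) in HT.
  assert (Hg : g - 1 <> 0).
  { intros E; apply H4'.
    replace (1 - d * e / q ^ n / a * q ^ j) with ((g - 1) / g)
      by (unfold g; field; repeat split; auto).
    rewrite E; unfold Cdiv; ring. }
  apply Cmult_cancel_l with (g - 1); [exact Hg|].
  rewrite <- Csum_scal.
  rewrite (Csum_ext _ (fun k =>
    (- q ^ j) * (vwp a d e (/ q ^ n) j k * (1 - a * (q ^ k * q ^ k)) *
      ((g - 1) * (/ q ^ k + a * q ^ k) +
       (/ q ^ j + a / d + a / e + a / / q ^ n -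
        g * (a * q ^ j + d + e + / q ^ n))))
    + ((g - 1) * (1 + a * (q ^ j * q ^ j)) + q ^ j *
       (/ q ^ j + a / d + a / e + a / / q ^ n -
        g * (a * q ^ j + d + e + / q ^ n)))
      * (vwp a d e (/ q ^ n) j k * (1 - a * (q ^ k * q ^ k))))).
  + rewrite Csum_plus, !Csum_scal, HT, IH, !(qpoch_S _ _ j).
    assert (G : d * e * q ^ j - q ^ n * a <> 0).
    { intros E; apply Hg; unfold g.
      replace (d * e * / q ^ n * q ^ j) with ((d * e * q ^ j - q ^ n * a) / q ^ n + a)
        by (field; auto).
      rewrite E; field; auto. }
    generalize dependent (qpoch (d * e / q ^ n / a) q j); intros.
    generalize dependent (qpoch (q * a / d) q n); intros.
    generalize dependent (qpoch (q * a / e) q n); intros.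
    unfold g; field; repeat split; auto.
    intros E; apply G; match type of E with ?l = _ => transitivity (- l); [ring | rewrite E; ring] end.
  + intros k Hk.
    assert (Hk' := Cpow_nz q k q_nz).
    replace (vwp a d e (/ q ^ n) (S j) k) with (vwp a d e (/ q ^ n) j k
      * ((1 - / q ^ k * q ^ j) * (1 - a * q ^ k * q ^ j)))
      by (unfold vwp, Cdiv; cbn [qpoch]; ring).
    unfold g; field; repeat split; auto.
Qed.

Lemma Csum_extend (u : nat -> C) k n :
  (k <= n)%nat -> (forall j, (k < j)%nat -> u j = 0) -> Csum u n = Csum u k.
Proof.
intros L H; induction L as [|n L IH]; [reflexivity|].
rewrite Csum_S, IH, H by lia; ring.
Qed.

Lemma watson (a b c d e : C) (n : nat) :
  a <> 0 -> b <> 0 -> c <> 0 -> d <> 0 -> e <> 0 -> 1 - a <> 0 ->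
  qpoch (q * a / b) q n <> 0 -> qpoch (q * a / c) q n <> 0 ->
  qpoch (q * a / d) q n <> 0 -> qpoch (q * a / e) q n <> 0 ->
  qpoch (q * a) q (2 * n) <> 0 -> qpoch (d * e / q ^ n / a) q n <> 0 ->
  Csum (W87_term a b c d e (/ q ^ n) q
          (q * a / (b * c) * (q * a / (d * e * / q ^ n)))) n
  = qpoch (q * a) q n * qpoch (q * a / (d * e)) q n
    / (qpoch (q * a / d) q n * qpoch (q * a / e) q n)
    * Csum (fun j => qpoch (/ q ^ n) q j * qpoch d q j * qpoch e q j
         * qpoch (q * a / (b * c)) q j
         / (qpoch q q j * qpoch (q * a / b) q j * qpoch (q * a / c) q j
            * qpoch (d * e / q ^ n / a) q j) * q ^ j) n.
Proof.
intros Ha Hb Hc Hd He H1a H1 H2 H3 H4 H5 H6.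
set (f := q * a / (b * c)).
assert (Efb : f * b = q * a / c) by (unfold f; field; auto).
assert (Efc : f * c = q * a / b) by (unfold f; field; auto).
assert (Ef : a * q = b * c * f) by (unfold f; field; auto).
rewrite (Csum_ext _ (fun k => Csum (fun j =>
   qpoch f q j / (qpoch q q j * qpoch (q * a / c) q j * qpoch (q * a / b) q j) * q ^ j
   * / (1 - a) * (vwp a d e (/ q ^ n) j k * (1 - a * (q ^ k * q ^ k)))) n)).
- rewrite Csum_swap, <- Csum_scal; apply Csum_ext; intros j Hj; cbv beta.
  rewrite Csum_scal, vwp_inner; auto;
    [|eapply qpoch_nz_le; eassumption].
  assert (H1' := qpoch_nz_le _ _ _ _ H1 Hj). assert (H2' := qpoch_nz_le _ _ _ _ H2 Hj).
  assert (H6' := qpoch_nz_le _ _ _ _ H6 Hj). assert (Hq := qq_nz j).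
  generalize dependent (qpoch (q * a / d) q n); intros.
  generalize dependent (qpoch (q * a / e) q n); intros.
  generalize dependent (qpoch (q * a / b) q j); intros.
  generalize dependent (qpoch (q * a / c) q j); intros.
  generalize dependent (qpoch (d * e / q ^ n / a) q j); intros.
  generalize dependent (qpoch q q j); intros.
  field; repeat split; auto.
- intros k Hk.
  assert (HS := saalschutz a b c f k Ef).
  rewrite Efb, Efc in HS.
  specialize (HS (qpoch_nz_le _ _ _ _ H2 Hk) (qpoch_nz_le _ _ _ _ H1 Hk)).
  rewrite (Csum_extend _ k n Hk).
  2:{ intros j Hj; unfold vwp; rewrite (qVn_poch_eq_0 k j) by exact Hj. unfold Cdiv; ring. }
  rewrite (Csum_ext _ (fun j =>
    (qpoch a q k * qpoch d q k * qpoch e q k * qpoch (/ q ^ n) q k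
     / (qpoch q q k * qpoch (q * a / d) q k * qpoch (q * a / e) q k
       * qpoch (q * a / (/ q ^ n)) q k) * (q * a / (d * e * (/ q ^ n))) ^ k
     * / (1 - a) * (1 - a * (q ^ k * q ^ k)))
    * (qpoch (/ q ^ k) q j * qpoch (a * q ^ k) q j * qpoch f q j
       / (qpoch q q j * qpoch (q * a / c) q j * qpoch (q * a / b) q j) * q ^ j)))
    by (intros; unfold vwp, Cdiv; ring).
  rewrite Csum_scal, HS; unfold W87_term, qpochs; cbn [fold_right].
  replace (2 * k)%nat with (k + k)%nat by lia.
  rewrite Cpow_add_r, (Cpow_mult_l f).
  assert (H5' : qpoch (q * a / / q ^ n) q k <> 0).
  { apply (qpoch_nz_le _ _ n); [|exact Hk].
    replace (q * a / / q ^ n) with (q * a * q ^ n) by (simpl; field; apply Cpow_nz, q_nz).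
    apply qpoch_nz_tail; eapply qpoch_nz_le; [exact H5|lia]. }
  assert (H1' := qpoch_nz_le _ _ _ _ H1 Hk). assert (H2' := qpoch_nz_le _ _ _ _ H2 Hk).
  assert (H3' := qpoch_nz_le _ _ _ _ H3 Hk). assert (H4' := qpoch_nz_le _ _ _ _ H4 Hk).
  assert (Hq := qq_nz k).
  generalize dependent (qpoch (q * a / d) q k); intros.
  generalize dependent (qpoch (q * a / e) q k); intros.
  generalize dependent (qpoch (q * a / b) q k); intros.
  generalize dependent (qpoch (q * a / c) q k); intros.
  generalize dependent (qpoch (q * a / / q ^ n) q k); intros.
  generalize dependent (qpoch q q k); intros.
  generalize ((q * a / (d * e * / q ^ n)) ^ k), (qpoch (/ q ^ n) q k); intros.
  field; repeat split; auto.
Qed.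

(* Multiplying numerator and denominator of a ratio by matching factors
   eliminates [E], so its value is never needed. *)
Lemma qpoch_reverse (n k : nat) :
  (k <= n)%nat ->
  exists E : C, E <> 0 /\ forall x : C, x <> 0 ->
    qpoch x q n = qpoch x q (n - k) * qpoch (q / (q ^ n * x)) q k * (- x) ^ k * E.
Proof.
induction k as [|k IH]; intros L.
- exists 1; split; [exact C1_nz|]; intros x Hx; rewrite Nat.sub_0_r; simpl; ring.
- destruct (IH ltac:(lia)) as [E [HE H]].
  exists (E * q ^ (n - S k)); split.
  + apply Cmult_neq_0; [exact HE | apply Cpow_nz, q_nz].
  + intros x Hx; rewrite H by exact Hx.
    replace (n - k)%nat with (S (n - S k)) by lia.
    replace (q ^ n) with (q ^ (n - S k) * q ^ k * q)
      by (rewrite <- !Cpow_add_r, Cmult_comm, <- Cpow_S; f_equal; lia).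
    cbn [qpoch Cpow].
    assert (H1 := Cpow_nz q (n - S k) q_nz). assert (H2 := Cpow_nz q k q_nz).
    field; auto.
Qed.

Lemma Cpow_opp (x : C) n : (- x) ^ n = (- (1)) ^ n * x ^ n.
Proof. rewrite <- Cpow_mult_l; f_equal; ring. Qed.

Lemma Cpow_div (x y : C) n : y <> 0 -> (x / y) ^ n = x ^ n / y ^ n.
Proof. intros Hy; unfold Cdiv; rewrite Cpow_mult_l, Cpow_inv by exact Hy; reflexivity. Qed.

Lemma W87_term_perm (a b c d e f u : C) k :
  W87_term a b c d e f q u k = W87_term a c e d b f q u k.
Proof.
unfold W87_term, qpochs; cbn [fold_right]; f_equal; f_equal; f_equal; ring.
Qed.

Lemma askey_wilson_conv_generic (n : nat) (z a b c d : C) :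
  z <> 0 -> a <> 0 -> b <> 0 -> c <> 0 -> d <> 0 ->
  qpoch (a * b) q n <> 0 -> qpoch (a * c) q n <> 0 -> qpoch (a * d) q n <> 0 ->
  qpoch (b * c) q n <> 0 -> qpoch (c * d) q n <> 0 ->
  1 - a * b * c * z / q <> 0 -> qpoch (a * b * c * z) q (2 * n) <> 0 ->
  qpoch (c / z) q n <> 0 -> qpoch (d / z) q n <> 0 ->
  askey_wilson_z n z a b c d q
  = qpochs [q; a * b; c * d] q n
    * Csum (fun k =>
        qpoch (a * z) q k * qpoch (b * z) q k / (qpoch q q k * qpoch (a * b) q k) * (/ z) ^ k
        * (qpoch (c * / z) q (n - k) * qpoch (d * / z) q (n - k)
           / (qpoch q q (n - k) * qpoch (c * d) q (n - k)) * z ^ (n - k))) n.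
Proof.
intros Hz Ha Hb Hc Hd Hab Hac Had Hbc Hcd G1 G2 G3 G4.
assert (Hn := Cpow_nz q n q_nz).
set (al := a * b * c * z / q) in *.
set (e := a * b * c * d * q ^ n / q).
assert (Hal : al <> 0).
{ unfold al; repeat apply Cmult_neq_0; auto.
  intros E; apply C1_nz; transitivity (q * / q); [field; auto | rewrite E; ring]. }
assert (He : e <> 0).
{ unfold e; repeat apply Cmult_neq_0; auto.
  intros E; apply C1_nz; transitivity (q * / q); [field; auto | rewrite E; ring]. }
assert (Haz : a * z <> 0) by (apply Cmult_neq_0; auto).
assert (Hbz : b * z <> 0) by (apply Cmult_neq_0; auto).
assert (Hcz : c * z <> 0) by (apply Cmult_neq_0; auto).
assert (Vz : forall x : C, x <> 0 -> x / z <> 0).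
{ intros x Hx E; apply Hx; transitivity (x / z * z); [field; auto | rewrite E; ring]. }
destruct (qpoch_reverse n n ltac:(lia)) as [En [HEn Hrev]].
assert (Hr : forall x : C, x <> 0 -> qpoch x q n <> 0 -> qpoch (q / (q ^ n * x)) q n <> 0).
{ intros x Hx Hx'; rewrite Hrev in Hx' by exact Hx.
  apply Cmult_neq_0_iff in Hx'; destruct Hx' as [Hx' _].
  apply Cmult_neq_0_iff in Hx'; destruct Hx' as [Hx' _].
  apply Cmult_neq_0_iff in Hx'; tauto. }
assert (W1 := watson al (b * z) (c * z) (a * z) e n Hal Hbz Hcz Haz He G1).
assert (W2 := watson al (c * z) e (a * z) (b * z) n Hal Hcz He Haz Hbz G1).
replace (q * al / (b * z)) with (a * c) in * by (unfold al; field; auto).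
replace (q * al / (c * z)) with (a * b) in * by (unfold al; field; auto).
replace (q * al / (a * z)) with (b * c) in * by (unfold al; field; auto).
replace (q * al / e) with (q / (q ^ n * (d / z))) in * by (unfold al, e; field; repeat split; auto).
replace (q * al) with (a * b * c * z) in * by (unfold al; field; auto).
replace (a * z * e / q ^ n / al) with (a * d) in * by (unfold al, e; field; repeat split; auto).
replace (a * z * (b * z) / q ^ n / al) with (q / (q ^ n * (c / z))) in *
  by (unfold al; field; repeat split; auto).
specialize (W1 Hac Hab Hbc (Hr _ (Vz d Hd) G4) G2 Had).
specialize (W2 Hab (Hr _ (Vz d Hd) G4) Hbc Hac G2 (Hr _ (Vz c Hc) G3)).
replace (a * b * c * z / (c * z * e) * (a * b * c * z / (a * z * (b * z) * / q ^ n)))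
  with (a * b * c * z / (b * z * (c * z)) * (a * b * c * z / (a * z * e * / q ^ n))) in W2
  by (field; repeat split; auto).
rewrite (Csum_ext _ _ n (fun k _ => W87_term_perm al (b * z) (c * z) (a * z) e _ _ k)) in W1.
rewrite (Csum_ext _ (W87_term al (c * z) e (a * z) (b * z) (/ q ^ n) q
   (a * b * c * z / (b * z * (c * z)) * (a * b * c * z / (a * z * e * / q ^ n))))) in W1 by reflexivity.
rewrite W2 in W1; clear W2.
replace (a * b * c * z / (a * z * (b * z))) with (c / z) in W1 by (field; auto).
replace (a * b * c * z / (a * z * e)) with (q / (q ^ n * (a * d))) in W1
  by (unfold e; field; repeat split; auto).
replace (a * b * c * z / (b * z * (c * z))) with (a * / z) in W1 by (field; auto).
replace (a * b * c * z / (c * z * e)) with (q / (q ^ n * (c * d))) in W1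
  by (unfold e; field; repeat split; auto).

rewrite (Csum_ext _ (fun k => qpoch q q n * qpoch (c * d) q n
    / (qpoch (c / z) q n * qpoch (d / z) q n * z ^ n) *
   (qpoch (a * z) q k * qpoch (b * z) q k / (qpoch q q k * qpoch (a * b) q k) * (/ z) ^ k
        * (qpoch (c * / z) q (n - k) * qpoch (d * / z) q (n - k)
           / (qpoch q q (n - k) * qpoch (c * d) q (n - k)) * z ^ (n - k))))) in W1.
2:{ intros k Hk; destruct (qpoch_reverse n k Hk) as [E [HE HR]].
    assert (Hk' := Cpow_nz q k q_nz). assert (Hzk := Cpow_nz z k Hz).
    assert (Hcd0 : c * d <> 0) by (apply Cmult_neq_0; auto).
    assert (F1 := HR q q_nz). assert (F2 := HR (c * d) Hcd0).
    assert (F3 := HR (c / z) (Vz c Hc)). assert (F4 := HR (d / z) (Vz d Hd)).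
    replace (q / (q ^ n * q)) with (/ q ^ n) in F1 by (field; auto).
    assert (Hqn := qq_nz n).
    assert (Habk := qpoch_nz_le _ _ _ _ Hab Hk). assert (Hqk := qq_nz k).
    replace (c * / z) with (c / z) by reflexivity. replace (d * / z) with (d / z) by reflexivity.
    replace (z ^ n) with (z ^ (n - k) * z ^ k) by (rewrite <- Cpow_add_r; f_equal; lia).
    assert (Hznk := Cpow_nz z (n - k) Hz).
    rewrite Cpow_inv by exact Hz.
    rewrite Cpow_opp in F1, F2, F3, F4.
    rewrite Cpow_mult_l in F2; rewrite Cpow_div in F3, F4 by exact Hz.
    assert (Hm1 : (- (1)) ^ k <> 0).
    { apply Cpow_nz; intros X; apply C1_nz; replace (1:C) with (- - (1)) by ring; rewrite X; ring. }
    assert (Hck := Cpow_nz c k Hc). assert (Hdk := Cpow_nz d k Hd).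
    rewrite F1, F2, F3, F4; rewrite F1 in Hqn; rewrite F2 in Hcd; rewrite F3 in G3; rewrite F4 in G4.
    rewrite !Cmult_neq_0_iff in Hcd, G3, G4.
    destruct Hcd as [[[? ?] _] _], G3 as [[[? ?] _] _], G4 as [[[? ?] _] _].
    field; repeat split; auto. }
rewrite Csum_scal in W1.
unfold askey_wilson_z.
rewrite (Csum_ext (fun k => _ / _ * q ^ k) (fun j => qpoch (/ q ^ n) q j * qpoch (a * z) q j * qpoch e q j *
           qpoch (a * / z) q j /
           (qpoch q q j * qpoch (a * c) q j * qpoch (a * b) q j *
            qpoch (a * d) q j) * q ^ j)).
2:{ intros k Hk; unfold qpochs; cbn [fold_right].
    replace (q ^ n / q * (a * b * c * d)) with e by (unfold e; field; auto).
    f_equal; f_equal; ring. }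
match type of W1 with _ * (_ * ?x) = _ * ?y => set (X := x) in *; set (Y := y) in *; clearbody X Y end.
assert (Had0 : a * d <> 0) by (apply Cmult_neq_0; auto).
assert (F1 := Hrev (a * d) Had0). assert (F2 := Hrev (d / z) (Vz d Hd)).
rewrite Nat.sub_diag in F1, F2.
rewrite Cpow_opp in F1, F2.
rewrite Cpow_mult_l in F1; rewrite Cpow_div in F2 by exact Hz.
change (qpoch (a * d) q 0) with (1 : C) in F1; change (qpoch (d / z) q 0) with (1 : C) in F2.
unfold qpochs; cbn [fold_right].
assert (Han := Cpow_nz a n Ha). assert (Hdn := Cpow_nz d n Hd). assert (Hzn := Cpow_nz z n Hz).
assert (Hm1 : (- (1)) ^ n <> 0).
{ apply Cpow_nz; intros E; apply C1_nz; replace (1:C) with (- - (1)) by ring; rewrite E; ring. }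
assert (Hqn := qq_nz n).
assert (G2' := qpoch_nz_le _ _ _ n G2 ltac:(lia)).
rewrite F2 in G4, W1; rewrite F1 in Had |- *.
rewrite !Cmult_neq_0_iff in Had, G4; destruct Had as [[[_ Had] _] _], G4 as [[[_ G4] _] _].
generalize dependent (qpoch (q / (q ^ n * (a * d))) q n); intros u Hu.
generalize dependent (qpoch (q / (q ^ n * (d / z))) q n); intros v; intros.
assert (EY : Y = qpoch (a * b * c * z) q n * qpoch (c / z) q n /
     (qpoch (b * c) q n * qpoch (a * c) q n) *
     (qpoch q q n * qpoch (c * d) q n /
      (qpoch (c / z) q n *
       (1 * v * ((- (1)) ^ n * (d ^ n / z ^ n)) * En) * z ^ n) * X)
  / (qpoch (a * b * c * z) q n * u / (qpoch (b * c) q n * v))).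
{ rewrite W1; field; repeat split; auto. }
rewrite EY; field; repeat split; auto.
Qed.
End Finite.

(** * Laurent polynomials in [z] *)

Lemma Ccvg_to_eps (u : nat -> C) (l : C) :
  Ccvg_to u l <->
  forall eps : R, (0 < eps)%R -> eventually (fun n => (Cmod (u n - l) < eps)%R).
Proof.
split.
- intros H eps He.
  assert (H' := proj1 (filterlim_locally_ball_norm (K := C_AbsRing)
    (U := C_NormedModule) (F := eventually) u l) H).
  exact (H' (mkposreal eps He)).
- intros H; apply (proj2 (filterlim_locally_ball_norm (K := C_AbsRing)
    (U := C_NormedModule) (F := eventually) u l)).
  intros eps; exact (H eps (cond_pos eps)).
Qed.

Lemma eventually_and (P Q : nat -> Prop) :
  eventually P -> eventually Q -> eventually (fun n => P n /\ Q n).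
Proof. apply filter_and. Qed.

Fixpoint peval (l : list C) (y : C) : C :=
  match l with
  | nil => 0
  | c :: l' => c + y * peval l' y
  end.

Lemma peval_bound (l : list C) :
  exists K : R, (0 < K)%R /\ forall y : C, (Cmod y <= 1)%R -> (Cmod (peval l y) <= K)%R.
Proof.
induction l as [|c l [K [HK H]]].
- exists 1%R; split; [lra|]; intros y _; simpl; rewrite Cmod_0; lra.
- exists (Cmod c + K)%R; split; [assert (H0 := Cmod_ge_0 c); lra|].
  intros y Hy; simpl.
  eapply Rle_trans; [apply Cmod_triangle|]; rewrite Cmod_mult.
  specialize (H y Hy); assert (H0 := Cmod_ge_0 y); assert (H1 := Cmod_ge_0 (peval l y)); nra.
Qed.

Lemma peval_eventually_0 (l : list C) (y : nat -> C) :
  (forall m, y m <> 0) ->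
  (forall eps : R, (0 < eps)%R -> eventually (fun m => (Cmod (y m) < eps)%R)) ->
  eventually (fun m => peval l (y m) = 0) -> forall w : C, peval l w = 0.
Proof.
intros Hnz Hlim; induction l as [|c l IH]; intros H w; [reflexivity|].
assert (Hc : c = 0).
{ destruct (Ceq_dec c 0) as [|Hc]; [assumption|exfalso].
  apply Cmod_gt_0 in Hc.
  destruct (peval_bound l) as [K [HK Hb]].
  assert (HcK : (0 < Cmod c / K)%R) by (apply Rdiv_lt_0_compat; assumption).
  assert (F := eventually_and _ _ H (eventually_and _ _ (Hlim _ HcK) (Hlim 1%R Rlt_0_1))).
  destruct F as [N HN]; destruct (HN N (Nat.le_refl N)) as [E [L1 L2]].
  simpl in E.
  assert (E' : c = - (y N * peval l (y N))).
  { transitivity (c + y N * peval l (y N) - y N * peval l (y N)); [ring|]; rewrite E; ring. }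
  assert (Hm : Cmod c = (Cmod (y N) * Cmod (peval l (y N)))%R)
    by (rewrite E' at 1; rewrite Cmod_opp; apply Cmod_mult).
  specialize (Hb (y N) (Rlt_le _ _ L2)).
  apply (Rmult_lt_compat_r K) in L1; [|exact HK].
  replace (Cmod c / K * K)%R with (Cmod c) in L1 by (field; lra).
  assert (H0 := Cmod_ge_0 (y N)); nra. }
subst c; simpl; rewrite IH; [ring|].
revert H; apply filter_imp; intros m E; simpl in E.
apply Cmult_cancel_l with (y m); [apply Hnz|].
rewrite Cmult_0_r, <- E; ring.
Qed.

Lemma peval_plus (l1 l2 : list C) :
  exists l, forall y : C, peval l y = peval l1 y + peval l2 y.
Proof.
revert l2; induction l1 as [|c1 l1 IH]; intros l2.
- exists l2; intros; simpl; ring.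
- destruct l2 as [|c2 l2]; [exists (c1 :: l1); intros; simpl; ring|].
  destruct (IH l2) as [l H]; exists (c1 + c2 :: l); intros; simpl; rewrite H; ring.
Qed.

Lemma peval_scal (c : C) (l1 : list C) : exists l, forall y : C, peval l y = c * peval l1 y.
Proof.
exists (map (Cmult c) l1); intros y; induction l1 as [|c1 l1 IH]; simpl; [|rewrite IH]; ring.
Qed.

Lemma peval_mult (l1 l2 : list C) :
  exists l, forall y : C, peval l y = peval l1 y * peval l2 y.
Proof.
induction l1 as [|c1 l1 [l H]]; [exists nil; intros; simpl; ring|].
destruct (peval_scal c1 l2) as [l3 H3]; destruct (peval_plus l3 (RtoC 0 :: l)) as [l4 H4].
exists l4; intros; rewrite H4, H3; simpl; rewrite H; ring.
Qed.

Definition laurent (f : C -> C) : Prop :=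
  exists (M : nat) (l : list C), forall z : C, z <> 0 -> f z = z ^ M * peval l (/ z).

Lemma laurent_ext (f g : C -> C) :
  (forall z : C, z <> 0 -> f z = g z) -> laurent g -> laurent f.
Proof. intros H [M [l Hl]]; exists M, l; intros z Hz; rewrite H; auto. Qed.

Lemma laurent_const (c : C) : laurent (fun _ => c).
Proof. exists 0%nat, [c]; intros; simpl; ring. Qed.

Lemma laurent_id : laurent (fun z => z).
Proof. exists 1%nat, [1 : C]; intros; simpl; ring. Qed.

Lemma laurent_inv : laurent (fun z => / z).
Proof. exists 0%nat, [0 : C; 1 : C]; intros; simpl; ring. Qed.

Lemma peval_lift (M : nat) (l : list C) :
  exists l', forall z : C, z <> 0 -> peval l (/ z) = z ^ M * peval l' (/ z).
Proof.
exists (Nat.iter M (cons (RtoC 0)) l); intros z Hz; induction M as [|M IH]; simpl; [ring|].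
rewrite IH; field; exact Hz.
Qed.

Lemma laurent_plus (f g : C -> C) :
  laurent f -> laurent g -> laurent (fun z => f z + g z).
Proof.
intros [M [l H]] [N [m H']].
destruct (peval_lift N l) as [l1 H1]; destruct (peval_lift M m) as [l2 H2].
destruct (peval_plus l1 l2) as [l3 H3].
exists (M + N)%nat, l3; intros z Hz.
rewrite H, H', H1, H2, H3, Cpow_add_r by exact Hz; ring.
Qed.

Lemma laurent_mult (f g : C -> C) :
  laurent f -> laurent g -> laurent (fun z => f z * g z).
Proof.
intros [M [l H]] [N [m H']]; destruct (peval_mult l m) as [l3 H3].
exists (M + N)%nat, l3; intros z Hz; rewrite H, H', H3, Cpow_add_r by exact Hz; ring.
Qed.

Lemma laurent_pow (f : C -> C) n : laurent f -> laurent (fun z => f z ^ n).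
Proof.
intros H; induction n as [|n IH]; simpl; [apply laurent_const | apply laurent_mult; assumption].
Qed.

Lemma laurent_Csum (f : nat -> C -> C) n :
  (forall k, laurent (f k)) -> laurent (fun z => Csum (fun k => f k z) n).
Proof.
intros H; induction n as [|n IH].
- apply (laurent_ext _ (f 0%nat)); [intros; apply Csum_0 | apply H].
- apply (laurent_ext _ (fun z => Csum (fun k => f k z) n + f (S n) z));
    [intros; apply Csum_S | apply laurent_plus; auto].
Qed.

Lemma laurent_minus (f g : C -> C) :
  laurent f -> laurent g -> laurent (fun z => f z - g z).
Proof.
intros Hf Hg; apply (laurent_ext _ (fun z => f z + (- (1)) * g z)); [intros; ring|].
apply laurent_plus; [exact Hf | apply laurent_mult; [apply laurent_const | exact Hg]].
Qed.

Lemma laurent_qpoch (f : C -> C) (q : C) n : laurent f -> laurent (fun z => qpoch (f z) q n).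
Proof.
intros H; induction n as [|n IH]; simpl; [apply laurent_const|].
apply laurent_mult; [exact IH|]; apply laurent_minus; [apply laurent_const|].
apply laurent_mult; [exact H | apply laurent_const].
Qed.

Ltac laurent_tac := cbv beta; lazymatch goal with
  | |- laurent (fun _ => ?c) => apply laurent_const
  | |- laurent (fun z => z) => apply laurent_id
  | |- laurent (fun z => / z) => apply laurent_inv
  | |- laurent (fun z => @?f z + @?g z) => apply (laurent_plus f g); laurent_tac
  | |- laurent (fun z => @?f z - @?g z) => apply (laurent_minus f g); laurent_tac
  | |- laurent (fun z => @?f z * @?g z) => apply (laurent_mult f g); laurent_tac
  | |- laurent (fun z => @?f z / ?c) => apply (laurent_mult f (fun _ => / c)); laurent_tac
  | |- laurent (fun z => qpoch (@?f z) _ _) => apply (laurent_qpoch f); laurent_tac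
  | |- laurent (fun z => @?f z ^ _) => apply (laurent_pow f); laurent_tac
  | |- laurent (fun z => Csum (fun k => @?f k z) ?n) =>
      apply (laurent_Csum f n); intros ?; laurent_tac

  end.

Section Base.
Variable q : C.
Hypothesis q_nz : q <> 0.
Hypothesis q_lt : (Cmod q < 1)%R.

Lemma pow_q_small (eps : R) :
  (0 < eps)%R -> eventually (fun m => (Cmod (q ^ m) < eps)%R).
Proof.
intros He.
assert (H : is_lim_seq (fun n => (Cmod q ^ n)%R) 0).
{ apply is_lim_seq_geom; rewrite Rabs_pos_eq; [exact q_lt | apply Cmod_ge_0]. }
apply is_lim_seq_spec in H; specialize (H (mkposreal eps He)).
revert H; apply filter_imp; intros m Hm; simpl in Hm.
rewrite Cmod_pow, <- (Rabs_pos_eq (Cmod q ^ m)%R) by (apply pow_le, Cmod_ge_0).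
replace (Cmod q ^ m)%R with (Cmod q ^ m - 0)%R by ring; exact Hm.
Qed.

Lemma Cmod_qq_lt n : (Cmod (q ^ S n) < 1)%R.
Proof.
rewrite Cmod_pow; simpl.
assert (H := Cmod_ge_0 q).
assert (H1 : (Cmod q ^ n <= 1)%R) by (rewrite <- (pow1 n); apply pow_incr; lra).
assert (H2 : (0 <= Cmod q ^ n)%R) by (apply pow_le; lra); nra.
Qed.

Lemma one_minus_nz (x : C) : (Cmod x < 1)%R -> 1 - x <> 0.
Proof.
intros H E; replace x with (1 : C) in H.
- rewrite Cmod_1 in H; lra.
- transitivity (1 - x + x); [ring | rewrite E; ring].
Qed.

Lemma qq_nz n : qpoch q q n <> 0.
Proof. apply qpoch_nz; intros k _; apply one_minus_nz; exact (Cmod_qq_lt k). Qed.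

Lemma eventually_pow_ne (x : C) : eventually (fun m => 1 - x * q ^ m <> 0).
Proof.
assert (Hx := Cmod_ge_0 x).
assert (H := pow_q_small (/ (Cmod x + 1)) ltac:(apply Rinv_0_lt_compat; lra)).
revert H; apply filter_imp; intros m Hm; apply one_minus_nz.
rewrite Cmod_mult.
apply (Rmult_lt_compat_l (Cmod x + 1)) in Hm; [|lra].
rewrite Rinv_r in Hm by lra; assert (H := Cmod_ge_0 (q ^ m)); nra.
Qed.

Lemma eventually_inv_pow_ne (x : C) : eventually (fun m => 1 - x * / q ^ m <> 0).
Proof.
destruct (Ceq_dec x 0) as [-> | Hx].
- exists 0%nat; intros m _ E; apply C1_nz; rewrite <- E; ring.
- assert (H := pow_q_small (Cmod x) (proj1 (Cmod_gt_0 x) Hx)).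
  revert H; apply filter_imp; intros m Hm E.
  assert (Hq := Cpow_nz q m q_nz).
  assert (Ex : x = q ^ m).
  { transitivity (q ^ m - q ^ m * (1 - x * / q ^ m)); [field; exact Hq | rewrite E; ring]. }
  rewrite Ex in Hm; lra.
Qed.

Lemma eventually_qpoch_nz (x : nat -> C) n :
  (forall k, (k < n)%nat -> eventually (fun m => 1 - x m * q ^ k <> 0)) ->
  eventually (fun m => qpoch (x m) q n <> 0).
Proof.
induction n as [|n IH]; intros H; [exists 0%nat; intros; exact C1_nz|].
assert (F := eventually_and _ _ (IH ltac:(intros; apply H; lia)) (H n ltac:(lia))).
revert F; apply filter_imp; intros m [H1 H2]; simpl; apply Cmult_neq_0; assumption.
Qed.

(* The points [w / q^m] accumulate at infinity. *)
Lemma laurent_unique (f g : C -> C) (w : C) :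
  w <> 0 -> laurent f -> laurent g ->
  eventually (fun m => f (w / q ^ m) = g (w / q ^ m)) ->
  forall z : C, z <> 0 -> f z = g z.
Proof.
intros Hw Hf Hg H z Hz.
destruct (laurent_minus f g Hf Hg) as [M [l Hl]].
assert (Hq := fun m => Cpow_nz q m q_nz).
assert (Hwq : forall m, w / q ^ m <> 0).
{ intros m E; apply Hw; transitivity (w / q ^ m * q ^ m); [field; apply Hq | rewrite E; ring]. }
assert (E0 : forall y : C, peval l y = 0).
{ apply (peval_eventually_0 l (fun m => / (w / q ^ m))).
  - intros m E; apply (C1_nz); transitivity (w / q ^ m * / (w / q ^ m)).
    + symmetry; apply Cinv_r, Hwq.
    + rewrite E; ring.
  - intros eps He.
    assert (Hw' := proj1 (Cmod_gt_0 w) Hw).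
    assert (F := pow_q_small (eps * Cmod w) ltac:(apply Rmult_lt_0_compat; assumption)).
    revert F; apply filter_imp; intros m Hm.
    replace (/ (w / q ^ m)) with (q ^ m / w) by (field; auto).
    rewrite Cmod_div by exact Hw; apply Rlt_div_l; [exact Hw'|exact Hm].
  - revert H; apply filter_imp; intros m E.
    apply Cmult_cancel_l with ((w / q ^ m) ^ M); [apply Cpow_nz, Hwq|].
    rewrite <- Hl by apply Hwq; rewrite E; ring. }
specialize (Hl z Hz); rewrite E0 in Hl.
transitivity (f z - g z + g z); [ring | rewrite Hl; ring].
Qed.

Lemma askey_wilson_conv (n : nat) (z a b c d : C) :
  z <> 0 -> a <> 0 -> b <> 0 -> c <> 0 -> d <> 0 ->
  qpoch (a * b) q n <> 0 -> qpoch (a * c) q n <> 0 -> qpoch (a * d) q n <> 0 ->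
  qpoch (b * c) q n <> 0 -> qpoch (c * d) q n <> 0 ->
  askey_wilson_z n z a b c d q
  = qpochs [q; a * b; c * d] q n
    * Csum (fun k =>
        qpoch (a * z) q k * qpoch (b * z) q k / (qpoch q q k * qpoch (a * b) q k) * (/ z) ^ k
        * (qpoch (c * / z) q (n - k) * qpoch (d * / z) q (n - k)
           / (qpoch q q (n - k) * qpoch (c * d) q (n - k)) * z ^ (n - k))) n.
Proof.
intros Hz Ha Hb Hc Hd Hab Hac Had Hbc Hcd.
apply (laurent_unique (fun z => askey_wilson_z n z a b c d q) (fun z => qpochs [q; a * b; c * d] q n
    * Csum (fun k =>
        qpoch (a * z) q k * qpoch (b * z) q k / (qpoch q q k * qpoch (a * b) q k) * (/ z) ^ k
        * (qpoch (c * / z) q (n - k) * qpoch (d * / z) q (n - k)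
           / (qpoch q q (n - k) * qpoch (c * d) q (n - k)) * z ^ (n - k))) n) 1 C1_nz);
  [unfold askey_wilson_z, qpochs; cbn [fold_right]; laurent_tac
  |laurent_tac| |exact Hz].
assert (F1 := eventually_inv_pow_ne (a * b * c / q)).
assert (F2 : eventually (fun m => qpoch (a * b * c * (1 / q ^ m)) q (2 * n) <> 0)).
{ apply eventually_qpoch_nz; intros k _.
  assert (F := eventually_inv_pow_ne (a * b * c * q ^ k)); revert F; apply filter_imp.
  intros m Hm E; apply Hm; rewrite <- E; unfold Cdiv; ring. }
assert (F3 : forall x : C, eventually (fun m => qpoch (x / (1 / q ^ m)) q n <> 0)).
{ intros x; apply eventually_qpoch_nz; intros k _.
  assert (F := eventually_pow_ne (x * q ^ k)); revert F; apply filter_imp.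
  intros m Hm E; apply Hm; rewrite <- E; field; apply Cpow_nz, q_nz. }
assert (F := eventually_and _ _ (eventually_and _ _ F1 F2) (eventually_and _ _ (F3 c) (F3 d))).
revert F; apply filter_imp; intros m [[H1 H2] [H3 H4]].
apply askey_wilson_conv_generic; auto using qq_nz.
- intros E; apply C1_nz; transitivity (1 / q ^ m * q ^ m); [field; apply Cpow_nz, q_nz|].
  rewrite E; ring.
- intros E; apply H1; rewrite <- E; unfold Cdiv; ring.
Qed.

Lemma askey_wilson_reverse (n : nat) (z a b c d : C) :
  z <> 0 -> a <> 0 -> b <> 0 -> c <> 0 -> d <> 0 ->
  qpoch (a * b) q n <> 0 -> qpoch (a * c) q n <> 0 -> qpoch (a * d) q n <> 0 ->
  qpoch (b * c) q n <> 0 -> qpoch (b * d) q n <> 0 -> qpoch (c * d) q n <> 0 ->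
  askey_wilson_z n z a b c d q = askey_wilson_z n z d c b a q.
Proof.
intros Hz Ha Hb Hc Hd Hab Hac Had Hbc Hbd Hcd.
assert (Hz' : / z <> 0).
{ intros E; apply C1_nz; transitivity (z * / z); [field; exact Hz | rewrite E; ring]. }
transitivity (askey_wilson_z n (/ z) d c b a q).
- rewrite !askey_wilson_conv; auto; try (rewrite Cmult_comm; assumption).
  rewrite <- (Csum_rev (fun k => _ * (_ / _ * (/ z) ^ (n - k)))).
  f_equal.
  + unfold qpochs; cbn [fold_right]; rewrite (Cmult_comm d c), (Cmult_comm b a); ring.
  + apply Csum_ext; intros k Hk.
    replace (n - (n - k))%nat with k by lia.
    replace (/ / z) with z by (field; auto).
    rewrite (Cmult_comm d c), (Cmult_comm b a); unfold Cdiv.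
    rewrite (Cmult_comm (qpoch (b * z) q k)), (Cmult_comm (qpoch (d * / z) q (n - k))); ring.
- unfold askey_wilson_z; f_equal; apply Csum_ext; intros k Hk.
  f_equal; f_equal; unfold qpochs; cbn [fold_right].
  replace (/ / z) with z by (field; auto); ring.
Qed.
End Base.

(** * Series and infinite products *)

Notation is_Cseries u l := (Ccvg_to (Csum u) l).

Lemma Ccvg_unique (u : nat -> C) (l l' : C) : Ccvg_to u l -> Ccvg_to u l' -> l = l'.
Proof. intros H H'; rewrite <- (Clim_correct u l H); exact (Clim_correct u l' H'). Qed.

Lemma Ccvg_ext_eventually (u v : nat -> C) (l : C) :
  eventually (fun n => u n = v n) -> Ccvg_to u l -> Ccvg_to v l.
Proof.
rewrite !Ccvg_to_eps; intros E H eps He.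
assert (F := eventually_and _ _ E (H eps He)); revert F; apply filter_imp.
intros n [En Hn]; rewrite <- En; exact Hn.
Qed.

Lemma Ccvg_ext (u v : nat -> C) (l : C) : (forall n, u n = v n) -> Ccvg_to u l -> Ccvg_to v l.
Proof. intros E; apply Ccvg_ext_eventually; exists 0%nat; intros n _; apply E. Qed.

Lemma Ccvg_const (c : C) : Ccvg_to (fun _ => c) c.
Proof.
apply Ccvg_to_eps; intros eps He; exists 0%nat; intros n _.
replace (c - c) with (0 : C) by ring; rewrite Cmod_0; exact He.
Qed.

Lemma Ccvg_plus (u v : nat -> C) (a b : C) :
  Ccvg_to u a -> Ccvg_to v b -> Ccvg_to (fun n => u n + v n) (a + b).
Proof.
rewrite !Ccvg_to_eps; intros Hu Hv eps He.
assert (F := eventually_and _ _ (Hu (eps / 2)%R ltac:(lra)) (Hv (eps / 2)%R ltac:(lra))).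
revert F; apply filter_imp; intros n [H1 H2].
replace (u n + v n - (a + b)) with (u n - a + (v n - b)) by ring.
eapply Rle_lt_trans; [apply Cmod_triangle | lra].
Qed.

Lemma Ccvg_bounded (u : nat -> C) (a : C) :
  Ccvg_to u a -> exists B : R, (0 < B)%R /\ forall n, (Cmod (u n) <= B)%R.
Proof.
rewrite Ccvg_to_eps; intros H; destruct (H 1%R Rlt_0_1) as [N HN].
assert (HB : exists B : R, (0 < B)%R /\ forall n, (n < N)%nat -> (Cmod (u n) <= B)%R).
{ clear HN; induction N as [|N [B [HB IH]]]; [exists 1%R; split; [lra|lia]|].
  exists (Rmax B (Cmod (u N))); split.
  - eapply Rlt_le_trans; [exact HB | apply Rmax_l].
  - intros n Hn; destruct (Nat.eq_dec n N) as [->|]; [apply Rmax_r|].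
    eapply Rle_trans; [apply IH; lia | apply Rmax_l]. }
destruct HB as [B [HB HB']]; exists (B + (Cmod a + 1))%R.
assert (Ha := Cmod_ge_0 a); split; [lra|]; intros n.
destruct (Nat.lt_ge_cases n N) as [L|L]; [specialize (HB' n L); lra|].
specialize (HN n L); replace (u n) with (u n - a + a) by ring.
eapply Rle_trans; [apply Cmod_triangle|lra].
Qed.

Lemma Ccvg_scal (c : C) (u : nat -> C) (a : C) :
  Ccvg_to u a -> Ccvg_to (fun n => c * u n) (c * a).
Proof.
rewrite !Ccvg_to_eps; intros H eps He; assert (Hc := Cmod_ge_0 c).
assert (F := H (eps / (Cmod c + 1))%R ltac:(apply Rdiv_lt_0_compat; lra)).
revert F; apply filter_imp; intros n Hn.
replace (c * u n - c * a) with (c * (u n - a)) by ring; rewrite Cmod_mult.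
apply (Rmult_lt_compat_r (Cmod c + 1)) in Hn; [|lra].
replace (eps / (Cmod c + 1) * (Cmod c + 1))%R with eps in Hn by (field; lra).
assert (H0 := Cmod_ge_0 (u n - a)); nra.
Qed.

Lemma Ccvg_mult_0 (u v : nat -> C) (a : C) :
  Ccvg_to u a -> Ccvg_to v 0 -> Ccvg_to (fun n => u n * v n) 0.
Proof.
intros Hu; destruct (Ccvg_bounded u a Hu) as [B [HB Hb]]; rewrite !Ccvg_to_eps.
intros Hv eps He; assert (F := Hv (eps / B)%R ltac:(apply Rdiv_lt_0_compat; lra)).
revert F; apply filter_imp; intros n Hn.
replace (u n * v n - 0) with (u n * (v n - 0)) by ring; rewrite Cmod_mult.
apply (Rmult_lt_compat_r B) in Hn; [|lra].
replace (eps / B * B)%R with eps in Hn by (field; lra).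
specialize (Hb n); assert (H0 := Cmod_ge_0 (v n - 0)); nra.
Qed.

Lemma Ccvg_minus_0 (u : nat -> C) (a : C) :
  Ccvg_to u a <-> Ccvg_to (fun n => u n - a) 0.
Proof.
split; intros H.
- replace (0 : C) with (a + - a) by ring; apply Ccvg_plus; [exact H | apply Ccvg_const].
- assert (H' := Ccvg_plus _ _ _ _ H (Ccvg_const a)).
  rewrite Cplus_0_l in H'; revert H'; apply Ccvg_ext; intros; ring.
Qed.

Lemma Ccvg_mult (u v : nat -> C) (a b : C) :
  Ccvg_to u a -> Ccvg_to v b -> Ccvg_to (fun n => u n * v n) (a * b).
Proof.
intros Hu Hv; apply (Ccvg_ext (fun n => u n * (v n - b) + b * u n)); [intros; ring|].
replace (a * b) with (0 + b * a) by ring.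
apply Ccvg_plus; [|apply Ccvg_scal; exact Hu].
apply (Ccvg_mult_0 u _ a Hu), (proj1 (Ccvg_minus_0 v b)), Hv.
Qed.

Lemma Ccvg_shift (u : nat -> C) (l : C) k : Ccvg_to u l -> Ccvg_to (fun n => u (n + k)%nat) l.
Proof.
rewrite !Ccvg_to_eps; intros H eps He; destruct (H eps He) as [N HN].
exists N; intros n Hn; apply HN; lia.
Qed.

Lemma Ccvg_unshift (u : nat -> C) (l : C) k : Ccvg_to (fun n => u (n + k)%nat) l -> Ccvg_to u l.
Proof.
rewrite !Ccvg_to_eps; intros H eps He; destruct (H eps He) as [N HN].
exists (N + k)%nat; intros n Hn; replace n with ((n - k) + k)%nat by lia; apply HN; lia.
Qed.

Lemma Ccvg_minus_sub (u : nat -> C) (l : C) k :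
  Ccvg_to u l -> Ccvg_to (fun n => u (n - k)%nat) l.
Proof.
intros H; apply (Ccvg_unshift _ _ k).
apply (Ccvg_ext u); [intros; f_equal; lia | exact H].
Qed.

Lemma Ccvg_le (u : nat -> C) (l : C) (B : R) :
  Ccvg_to u l -> eventually (fun n => (Cmod (u n) <= B)%R) -> (Cmod l <= B)%R.
Proof.
rewrite Ccvg_to_eps; intros H Hb; apply Rnot_lt_le; intros L.
destruct (eventually_and _ _ (H (Cmod l - B)%R ltac:(lra)) Hb) as [N HN].
destruct (HN N (Nat.le_refl N)) as [H1 H2].
assert (T := Cmod_triangle (- (u N - l)) (u N)); rewrite Cmod_opp in T.
replace (- (u N - l) + u N) with l in T by ring; lra.
Qed.

Lemma Ccvg_squeeze (u : nat -> C) (l : C) (g : nat -> R) :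
  (forall n, (Cmod (u n - l) <= g n)%R) -> is_lim_seq g 0 -> Ccvg_to u l.
Proof.
intros H Hg; apply Ccvg_to_eps; intros eps He.
apply is_lim_seq_spec in Hg; specialize (Hg (mkposreal eps He)); revert Hg.
apply filter_imp; intros n Hn; simpl in Hn.
eapply Rle_lt_trans; [apply H|].
replace (g n - 0)%R with (g n) in Hn by ring.
eapply Rle_lt_trans; [apply Rle_abs | exact Hn].
Qed.

Lemma Cmod_Csum (u : nat -> C) n : (Cmod (Csum u n) <= sum_f_R0 (fun k => Cmod (u k)) n)%R.
Proof.
induction n as [|n IH]; [rewrite Csum_0; simpl; lra|].
rewrite Csum_S; simpl; eapply Rle_trans; [apply Cmod_triangle | lra].
Qed.

Lemma Cmod_Csum_diff (u : nat -> C) (g : nat -> R) m n :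
  (forall k, (Cmod (u k) <= g k)%R) -> (m <= n)%nat ->
  (Cmod (Csum u n - Csum u m) <= sum_f_R0 g n - sum_f_R0 g m)%R.
Proof.
intros H L; induction L as [|n L IH].
- replace (Csum u m - Csum u m) with (0 : C) by ring; rewrite Cmod_0; lra.
- rewrite Csum_S; simpl.
  replace (Csum u n + u (S n) - Csum u m) with (Csum u n - Csum u m + u (S n)) by ring.
  eapply Rle_trans; [apply Cmod_triangle|]; specialize (H (S n)); lra.
Qed.

Definition bsum (g : nat -> R) (M : R) : Prop :=
  (forall n, (0 <= g n)%R) /\ forall n, (sum_f_R0 g n <= M)%R.

Lemma bsum_tail (g : nat -> R) (M : R) :
  bsum g M -> forall eps : R, (0 < eps)%R ->
  exists N, forall n, (N <= n)%nat -> (sum_f_R0 g n - sum_f_R0 g N < eps)%R.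
Proof.
intros [Hg HM] eps He.
assert (Hinc : forall n, (sum_f_R0 g n <= sum_f_R0 g (S n))%R)
  by (intros n; simpl; specialize (Hg (S n)); lra).
destruct (ex_finite_lim_seq_incr (sum_f_R0 g) M Hinc HM) as [l Hl].
assert (Hle := is_lim_seq_incr_compare _ _ Hl Hinc).
apply is_lim_seq_spec in Hl; destruct (Hl (mkposreal eps He)) as [N HN].
exists N; intros n Hn; specialize (HN N (Nat.le_refl N)); simpl in HN.
apply Rabs_lt_between in HN; specialize (Hle n); lra.
Qed.

Lemma bsum_cv (u : nat -> C) (g : nat -> R) (M : R) :
  (forall n, (Cmod (u n) <= g n)%R) -> bsum g M ->
  exists s, is_Cseries u s /\ (Cmod s <= M)%R.
Proof.
intros Hu [Hg HM].
assert (Hex : ex_series g).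
{ assert (Hinc : forall n, (sum_f_R0 g n <= sum_f_R0 g (S n))%R)
    by (intros n; simpl; specialize (Hg (S n)); lra).
  destruct (ex_finite_lim_seq_incr (sum_f_R0 g) M Hinc HM) as [l Hl].
  exists l; change (is_lim_seq (sum_n g) l).
  apply (is_lim_seq_ext (sum_f_R0 g)); [|exact Hl].
  intros n; symmetry; apply sum_n_Reals. }
destruct (ex_series_le (K := C_AbsRing) (V := C_CompleteNormedModule) u g Hu Hex) as [s Hs].
exists s; split; [exact Hs|].
apply (Ccvg_le (Csum u) s); [exact Hs|].
exists 0%nat; intros n _; eapply Rle_trans; [apply Cmod_Csum|].
eapply Rle_trans; [apply sum_Rle; intros; apply Hu | apply HM].
Qed.

Lemma bsum_le (f g : nat -> R) (M : R) :
  (forall n, (0 <= f n <= g n)%R) -> bsum g M -> bsum f M.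
Proof.
intros H [_ HM]; split; [intros; apply H|].
intros n; eapply Rle_trans; [apply sum_Rle; intros; apply H | apply HM].
Qed.

Lemma bsum_scal (g : nat -> R) (c M : R) :
  (0 <= c)%R -> bsum g M -> bsum (fun n => (c * g n)%R) (c * M).
Proof.
intros Hc [Hg HM]; split; [intros; apply Rmult_le_pos; auto|].
intros n; replace (sum_f_R0 (fun k => (c * g k)%R) n) with (c * sum_f_R0 g n)%R.
- apply Rmult_le_compat_l; auto.
- induction n as [|n IH]; simpl; [ring | rewrite <- IH; ring].
Qed.

Lemma bsum_geom (rho : R) : (0 <= rho < 1)%R -> bsum (fun n => (rho ^ n)%R) (/ (1 - rho)).
Proof.
intros H; split; [intros; apply pow_le; lra|].
intros n; rewrite tech3 by lra.
assert (Hp : (0 <= rho ^ S n)%R) by (apply pow_le; lra).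
unfold Rdiv; rewrite <- (Rmult_1_l (/ (1 - rho))) at 2.
apply Rmult_le_compat_r; [left; apply Rinv_0_lt_compat; lra | lra].
Qed.

Lemma bsum_ratio (a : nat -> R) (rho : R) :
  (forall n, (0 <= a n)%R) -> (0 <= rho < 1)%R ->
  eventually (fun n => (a (S n) <= rho * a n)%R) -> exists M, bsum a M.
Proof.
intros Ha Hr [N HN]; set (c := (rho / (1 - rho))%R).
assert (Hc : (0 <= c)%R) by (apply Rdiv_le_0_compat; lra).
assert (Hcr : ((1 + c) * rho = c)%R) by (unfold c; field; lra).
assert (Hinc : forall n m, (n <= m)%nat -> (sum_f_R0 a n <= sum_f_R0 a m)%R).
{ intros n m L; induction L as [|m L IH]; simpl; [lra|]; specialize (Ha (S m)); lra. }
assert (H : forall n, (N <= n)%nat ->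
  (sum_f_R0 a n + c * a n <= sum_f_R0 a N + c * a N)%R).
{ intros n L; induction L as [|n L IH]; [lra|]; simpl.
  specialize (HN n L).
  assert ((1 + c) * a (S n) <= (1 + c) * (rho * a n))%R by (apply Rmult_le_compat_l; lra).
  replace ((1 + c) * (rho * a n))%R with (c * a n)%R in H by (rewrite <- Hcr at 1; ring); lra. }
exists (sum_f_R0 a N + c * a N)%R; split; [exact Ha|]; intros n.
assert (Hn : (0 <= c * a N)%R) by (apply Rmult_le_pos; auto).
destruct (Nat.le_ge_cases N n) as [L|L].
- specialize (H n L); assert (0 <= c * a n)%R by (apply Rmult_le_pos; auto); lra.
- specialize (Hinc n N L); lra.
Qed.

Lemma Ccvg_Csum (a : nat -> nat -> C) (al : nat -> C) K :
  (forall i, Ccvg_to (fun n => a n i) (al i)) ->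
  Ccvg_to (fun n => Csum (a n) K) (Csum al K).
Proof.
intros H; induction K as [|K IH].
- apply (Ccvg_ext (fun n => a n 0%nat)); [intros; symmetry; apply Csum_0|].
  rewrite Csum_0; apply H.
- apply (Ccvg_ext (fun n => Csum (a n) K + a n (S K))); [intros; symmetry; apply Csum_S|].
  rewrite Csum_S; apply Ccvg_plus; auto.
Qed.

Lemma tannery (a : nat -> nat -> C) (al : nat -> C) (g : nat -> R) (M : R) (s : C) :
  (forall n i, (Cmod (a n i) <= g i)%R) -> bsum g M ->
  (forall i, Ccvg_to (fun n => a n i) (al i)) ->
  is_Cseries al s -> Ccvg_to (fun n => Csum (a n) n) s.
Proof.
intros Ha Hg Hal Hs.
assert (Hal' : forall i, (Cmod (al i) <= g i)%R).
{ intros i; apply (Ccvg_le _ _ _ (Hal i)); exists 0%nat; intros n _; apply Ha. }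
apply (Ccvg_ext (fun n => (Csum (a n) n - Csum al n) + Csum al n)); [intros; ring|].
replace s with (0 + s) by ring; apply Ccvg_plus; [|exact Hs].
apply Ccvg_to_eps; intros eps He.
destruct (bsum_tail g M Hg (eps / 4)%R ltac:(lra)) as [K HK].
assert (F := proj1 (Ccvg_to_eps _ _) (Ccvg_Csum a al K Hal) (eps / 4)%R ltac:(lra)).
assert (FK : eventually (fun n => (K <= n)%nat)) by (exists K; auto).
assert (F' := eventually_and _ _ F FK); revert F'; apply filter_imp; intros n [H1 L].
assert (D1 := Cmod_Csum_diff (a n) g K n (Ha n) L).
assert (D2 := Cmod_Csum_diff al g K n Hal' L).
specialize (HK n L).
replace (Csum (a n) n - Csum al n - 0) with
  ((Csum (a n) n - Csum (a n) K) + ((Csum (a n) K - Csum al K) + - (Csum al n - Csum al K))) by ring.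
eapply Rle_lt_trans; [apply Cmod_triangle|].
eapply Rle_lt_trans; [apply Rplus_le_compat_l, Cmod_triangle|].
rewrite Cmod_opp; lra.
Qed.

Lemma Csum_triangle (f : nat -> nat -> C) n :
  Csum (fun i => Csum (fun k => f k (i - k)%nat) i) n = Csum (fun k => Csum (f k) (n - k)) n.
Proof.
induction n as [|n IH]; [rewrite !Csum_0; reflexivity|].
rewrite Csum_S, IH, !(Csum_S _ n), Nat.sub_diag, Csum_0, Cplus_assoc; f_equal.
rewrite <- Csum_plus; apply Csum_ext; intros k Hk.
replace (S n - k)%nat with (S (n - k)) by lia; rewrite Csum_S; reflexivity.
Qed.

(* Only the partial sums of the rows are dominated, so a row may converge
   conditionally; with [f k j = u k * v j] this is Mertens' theorem. *)
Lemma is_Cseries_triangle (f : nat -> nat -> C) (F : nat -> C) (g : nat -> R) (M : R) (s : C) :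
  (forall k n, (Cmod (Csum (f k) n) <= g k)%R) -> bsum g M ->
  (forall k, is_Cseries (f k) (F k)) -> is_Cseries F s ->
  is_Cseries (fun i => Csum (fun k => f k (i - k)%nat) i) s.
Proof.
intros Hb Hg HF Hs.
apply (Ccvg_ext (fun n => Csum ((fun n k => Csum (f k) (n - k)) n) n)).
- intros n; symmetry; apply Csum_triangle.
- apply (tannery _ F g M); auto.
  intros k; apply Ccvg_minus_sub, HF.
Qed.

Definition conv (u v : nat -> C) (n : nat) : C := Csum (fun k => u k * v (n - k)%nat) n.

Lemma mertens (u v : nat -> C) (M : R) (U V : C) :
  bsum (fun k => Cmod (u k)) M -> is_Cseries u U -> is_Cseries v V ->
  is_Cseries (conv u v) (U * V).
Proof.
intros HM HU HV; destruct (Ccvg_bounded _ _ HV) as [B [HB Hb]].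
apply (is_Cseries_triangle (fun k j => u k * v j) (fun k => u k * V)
  (fun k => (B * Cmod (u k))%R) (B * M)).
- intros k n; rewrite Csum_scal, Cmod_mult, Rmult_comm.
  apply Rmult_le_compat_r; [apply Cmod_ge_0 | apply Hb].
- apply bsum_scal; [lra | exact HM].
- intros k; apply (Ccvg_ext (fun n => u k * Csum v n)); [intros; symmetry; apply Csum_scal|].
  apply Ccvg_scal, HV.
- apply (Ccvg_ext (fun n => V * Csum u n)).
  + intros n; rewrite <- Csum_scal; apply Csum_ext; intros; ring.
  + rewrite Cmult_comm; apply Ccvg_scal, HU.
Qed.

Lemma bsum_conv (u v : nat -> C) (M M' : R) :
  bsum (fun k => Cmod (u k)) M -> bsum (fun k => Cmod (v k)) M' ->
  bsum (fun k => Cmod (conv u v k)) (M * M').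
Proof.
intros [_ HM] [_ HM']; split; [intros; apply Cmod_ge_0|]; intros n.
assert (HM'0 : (0 <= M')%R).
{ specialize (HM' 0%nat); simpl in HM'; assert (H := Cmod_ge_0 (v 0%nat)); lra. }
assert (E : forall n, sum_f_R0 (fun i => sum_f_R0 (fun k => (Cmod (u k) * Cmod (v (i - k)%nat))%R) i) n
  = sum_f_R0 (fun k => (Cmod (u k) * sum_f_R0 (fun j => Cmod (v j)) (n - k))%R) n).
{ clear; induction n as [|n IH]; [reflexivity|].
  rewrite (tech5 _ n), IH, !(tech5 _ n), Nat.sub_diag, <- Rplus_assoc; f_equal.
  rewrite <- sum_plus; apply sum_eq; intros k Hk.
  replace (S n - k)%nat with (S (n - k)) by lia; simpl; ring. }
apply Rle_trans with (sum_f_R0 (fun i => sum_f_R0 (fun k => (Cmod (u k) * Cmod (v (i - k)%nat))%R) i) n).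
- apply sum_Rle; intros i _; eapply Rle_trans; [apply Cmod_Csum|].
  apply sum_Rle; intros k _; rewrite Cmod_mult; lra.
- rewrite E; apply Rle_trans with (sum_f_R0 (fun k => (Cmod (u k) * M')%R) n).
  + apply sum_Rle; intros k _; apply Rmult_le_compat_l; [apply Cmod_ge_0 | apply HM'].
  + rewrite <- scal_sum, Rmult_comm; apply Rmult_le_compat_r; auto.
Qed.

Lemma is_Cseries_scal (c : C) (u : nat -> C) (s : C) :
  is_Cseries u s -> is_Cseries (fun k => c * u k) (c * s).
Proof.
intros H; apply (Ccvg_ext (fun n => c * Csum u n)); [intros; symmetry; apply Csum_scal|].
apply Ccvg_scal, H.
Qed.

Lemma is_Cseries_ext (u v : nat -> C) (s : C) :
  (forall n, u n = v n) -> is_Cseries u s -> is_Cseries v s.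
Proof. intros E; apply Ccvg_ext; intros n; apply Csum_ext; auto. Qed.

Lemma is_Cseries_plus (u v : nat -> C) (s s' : C) :
  is_Cseries u s -> is_Cseries v s' -> is_Cseries (fun k => u k + v k) (s + s').
Proof.
intros H H'; apply (Ccvg_ext (fun n => Csum u n + Csum v n)); [intros; symmetry; apply Csum_plus|].
apply Ccvg_plus; assumption.
Qed.

Lemma is_Cseries_Csum (f : nat -> nat -> C) (F : nat -> C) K :
  (forall k, (k <= K)%nat -> is_Cseries (f k) (F k)) ->
  is_Cseries (fun n => Csum (fun k => f k n) K) (Csum F K).
Proof.
induction K as [|K IH]; intros H.
- rewrite Csum_0; apply (is_Cseries_ext (f 0%nat)); [intros; symmetry; apply Csum_0 | apply H; lia].
- rewrite Csum_S; apply (is_Cseries_ext (fun n => Csum (fun k => f k n) K + f (S K) n));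
    [intros; symmetry; apply Csum_S|].
  apply is_Cseries_plus; [apply IH; intros|]; apply H; lia.
Qed.

Definition pser (c : nat -> C) (t : C) (M : R) (s : C) : Prop :=
  bsum (fun k => Cmod (c k * t ^ k)) M /\ is_Cseries (fun k => c k * t ^ k) s.

Lemma conv_pow (c d : nat -> C) (t : C) n :
  conv c d n * t ^ n = conv (fun k => c k * t ^ k) (fun k => d k * t ^ k) n.
Proof.
unfold conv; rewrite Cmult_comm, <- Csum_scal; apply Csum_ext; intros k Hk.
replace n with (k + (n - k))%nat at 1 by lia; rewrite Cpow_add_r; ring.
Qed.

Lemma pser_conv (c d : nat -> C) (t : C) (M M' : R) (s s' : C) :
  pser c t M s -> pser d t M' s' -> pser (conv c d) t (M * M') (s * s').
Proof.
intros [H1 H2] [H3 H4]; split.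
- apply (bsum_le _ (fun k => Cmod (conv (fun k => c k * t ^ k) (fun k => d k * t ^ k) k))).
  + intros n; rewrite conv_pow; split; [apply Cmod_ge_0 | lra].
  + apply bsum_conv; assumption.
- apply (is_Cseries_ext (conv (fun k => c k * t ^ k) (fun k => d k * t ^ k)));
    [intros; symmetry; apply conv_pow|].
  apply (mertens _ _ M); assumption.
Qed.

Definition linc (a : C) (n : nat) : C := match n with 0 => 1 | 1 => - a | _ => 0 end.

Lemma pser_linc (a t : C) : pser (linc a) t (1 + Cmod a * Cmod t) (1 - a * t).
Proof.
assert (E : forall n, Csum (fun k => linc a k * t ^ k) (S n) = 1 - a * t).
{ induction n as [|n IH]; rewrite Csum_S; [rewrite Csum_0; simpl; ring|rewrite IH; simpl; ring]. }
assert (E' : forall n, sum_f_R0 (fun k => Cmod (linc a k * t ^ k)) (S n) = (1 + Cmod a * Cmod t)%R).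
{ induction n as [|n IH]; [|rewrite tech5, IH].
  - simpl; rewrite !Cmult_1_r, Cmod_1, Cmod_mult, Cmod_opp; reflexivity.
  - simpl; rewrite Cmult_0_l, Cmod_0; ring. }
split; [split; [intros; apply Cmod_ge_0|]|].
- intros [|n]; [|rewrite E'; lra].
  simpl; rewrite Cmult_1_r, Cmod_1; assert (H := Cmod_ge_0 a); assert (H' := Cmod_ge_0 t).
  assert (0 <= Cmod a * Cmod t)%R by (apply Rmult_le_pos; assumption); lra.
- apply (Ccvg_ext_eventually (fun _ => 1 - a * t)); [|apply Ccvg_const].
  exists 1%nat; intros [|n] Hn; [lia | symmetry; apply E].
Qed.

Lemma pser_one (t : C) : pser (linc 0) t 1 1.
Proof.
assert (H := pser_linc 0 t); rewrite Cmod_0 in H.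
replace (1 + 0 * Cmod t)%R with 1%R in H by ring.
replace (1 - 0 * t) with (1 : C) in H by ring; exact H.
Qed.

Lemma pser_le (c : nat -> C) (t : C) (M M' : R) (s : C) :
  (M <= M')%R -> pser c t M s -> pser c t M' s.
Proof.
intros L [[H1 H2] H3]; split; [split; [exact H1|]|exact H3].
intros n; eapply Rle_trans; [apply H2 | exact L].
Qed.

Lemma Ccvg_quotient (u v : nat -> C) (c : C) :
  (forall n, u n * v n = c) -> Ccvg_to v 1 -> Ccvg_to u c.
Proof.
intros E Hv; rewrite Ccvg_to_eps in Hv |- *; intros eps He.
assert (Hc := Cmod_ge_0 c).
assert (F := eventually_and _ _ (Hv (/ 2)%R ltac:(lra))
  (Hv (eps / (2 * Cmod c + 1))%R ltac:(apply Rdiv_lt_0_compat; lra))).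
revert F; apply filter_imp; intros n [H1 H2].
replace (u n - c) with (- (u n * (v n - 1))) by (rewrite <- (E n); ring).
rewrite Cmod_opp, Cmod_mult.
assert (T := Cmod_triangle (v n) (- (v n - 1))); rewrite Cmod_opp in T.
replace (v n + - (v n - 1)) with (1 : C) in T by ring; rewrite Cmod_1 in T.
assert (Eu : (Cmod (u n) * Cmod (v n) = Cmod c)%R) by (rewrite <- Cmod_mult, E; reflexivity).
assert (Hu := Cmod_ge_0 (u n)); assert (Hd := Cmod_ge_0 (v n - 1)).
assert (Hu2 : (Cmod (u n) <= 2 * Cmod c)%R) by nra.
apply (Rmult_lt_compat_r (2 * Cmod c + 1)) in H2; [|lra].
replace (eps / (2 * Cmod c + 1) * (2 * Cmod c + 1))%R with eps in H2 by (field; lra).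
nra.
Qed.

Lemma Ccvg_lower_bound (u : nat -> C) (l : C) :
  Ccvg_to u l -> l <> 0 -> (forall n, u n <> 0) ->
  exists d : R, (0 < d)%R /\ forall n, (d <= Cmod (u n))%R.
Proof.
intros H Hl Hu; rewrite Ccvg_to_eps in H; apply Cmod_gt_0 in Hl.
destruct (H (Cmod l / 2)%R ltac:(lra)) as [N HN].
assert (HB : exists d : R, (0 < d)%R /\ forall n, (n < N)%nat -> (d <= Cmod (u n))%R).
{ clear HN; induction N as [|N [d [Hd IH]]]; [exists 1%R; split; [lra|lia]|].
  exists (Rmin d (Cmod (u N))); split.
  - apply Rmin_glb_lt; [exact Hd | apply Cmod_gt_0, Hu].
  - intros n Hn; destruct (Nat.eq_dec n N) as [->|]; [apply Rmin_r|].
    eapply Rle_trans; [apply Rmin_l | apply IH; lia]. }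
destruct HB as [d [Hd HB]]; exists (Rmin d (Cmod l / 2)); split; [apply Rmin_glb_lt; lra|].
intros n; destruct (Nat.lt_ge_cases n N) as [L|L].
- eapply Rle_trans; [apply Rmin_l | apply HB, L].
- eapply Rle_trans; [apply Rmin_r|]; specialize (HN n L).
  assert (T := Cmod_triangle (- (u n - l)) (u n)); rewrite Cmod_opp in T.
  replace (- (u n - l) + u n) with l in T by ring; lra.
Qed.

Lemma CSeries_spec (u : nat -> C) (s : C) : is_Cseries u s -> is_Cseries u (CSeries u).
Proof. intros H; unfold CSeries; rewrite (Clim_correct _ _ H); exact H. Qed.

Lemma Csum_two_term (u v : nat -> C) (c d : C) N :
  u 0%nat = v 0%nat -> (forall k, u (S k) + c * u k = v (S k) + d * v k) ->
  Csum u (S N) + c * Csum u N = Csum v (S N) + d * Csum v N.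
Proof.
intros H0 H; rewrite !(Csum_S_l _ N), <- !Cplus_assoc, <- !Csum_scal, <- !Csum_plus, H0.
f_equal; apply Csum_ext; intros; apply H.
Qed.

Fixpoint eul (q : C) (n : nat) : C :=
  match n with
  | O => 1
  | S k => eul q k * (- q ^ k / (1 - q ^ S k))
  end.

Fixpoint qpc (q a : C) (k : nat) : nat -> C :=
  match k with
  | O => linc 0
  | S j => conv (qpc q a j) (linc (a * q ^ j))
  end.

Section Analysis.
Variable q : C.
Hypothesis q_nz : q <> 0.
Hypothesis q_lt : (Cmod q < 1)%R.

Lemma Cmod_pow_le_1 n : (Cmod (q ^ n) <= 1)%R.
Proof.
rewrite Cmod_pow, <- (pow1 n); apply pow_incr; assert (H := Cmod_ge_0 q); lra.
Qed.

Lemma Cmod_one_minus_qS n : (1 - Cmod q <= Cmod (1 - q ^ S n))%R.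
Proof.
assert (T := Cmod_triangle (1 - q ^ S n) (q ^ S n)).
replace (1 - q ^ S n + q ^ S n) with (1 : C) in T by ring; rewrite Cmod_1 in T.
rewrite Cpow_S, Cmod_mult in T.
assert (H := Cmod_pow_le_1 n); assert (H' := Cmod_ge_0 q).
assert (H'' := Cmod_ge_0 (q ^ n)); rewrite Cpow_S; nra.
Qed.

Lemma qS_ne n : 1 - q ^ S n <> 0.
Proof. apply one_minus_nz, Cmod_qq_lt, q_lt. Qed.

Lemma lim_pow_q_scal (M : R) : is_lim_seq (fun n => (Cmod (q ^ n) * M)%R) 0.
Proof.
replace (Finite 0) with (Rbar_mult 0 M) by (simpl; f_equal; ring).
apply is_lim_seq_scal_r.
apply (is_lim_seq_ext (fun n => (Cmod q ^ n)%R)); [intros; symmetry; apply Cmod_pow|].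
apply is_lim_seq_geom; rewrite Rabs_pos_eq; [exact q_lt | apply Cmod_ge_0].
Qed.

Lemma pser_term_shift (c : nat -> C) (y : C) n k :
  (Cmod (c k * (y * q ^ n) ^ k) <= Cmod (c k * y ^ k))%R.
Proof.
rewrite Cpow_mult_l, Cmult_assoc, (Cmod_mult (c k * y ^ k)), <- Cpow_mult_r.
assert (H := Cmod_pow_le_1 (n * k)); assert (H' := Cmod_ge_0 (c k * y ^ k)).
assert (H'' := Cmod_ge_0 (q ^ (n * k))); nra.
Qed.

Lemma pser_shift_cv (c : nat -> C) (y : C) (M : R) n :
  bsum (fun k => Cmod (c k * y ^ k)) M ->
  is_Cseries (fun k => c k * (y * q ^ n) ^ k) (CSeries (fun k => c k * (y * q ^ n) ^ k)).
Proof.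
intros H.
destruct (bsum_cv (fun k => c k * (y * q ^ n) ^ k) _ M (fun k => pser_term_shift c y n k) H)
  as [s [Hs _]].
exact (CSeries_spec _ _ Hs).
Qed.

Lemma pser_shift_lim (c : nat -> C) (y : C) (M : R) :
  bsum (fun k => Cmod (c k * y ^ k)) M ->
  Ccvg_to (fun n => CSeries (fun k => c k * (y * q ^ n) ^ k)) (c 0%nat).
Proof.
intros H; apply (Ccvg_squeeze _ _ (fun n => (Cmod (q ^ n) * M)%R)); [|apply lim_pow_q_scal].
intros n; assert (Hs := pser_shift_cv c y M n H).
apply (Ccvg_le (fun N => Csum (fun k => c k * (y * q ^ n) ^ k) (N + 1) - c 0%nat)).
- apply Ccvg_plus; [apply Ccvg_shift, Hs | apply Ccvg_const].
- exists 0%nat; intros N _; rewrite Nat.add_1_r, Csum_S_l, Cmult_1_r.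
  match goal with |- (Cmod (?a + ?b - ?a) <= _)%R => replace (a + b - a) with b by ring end.
  destruct H as [_ HM]; specialize (HM (S N)).
  apply Rle_trans with (Cmod (q ^ n) * sum_f_R0 (fun k => Cmod (c (S k) * y ^ S k)) N)%R.
  + eapply Rle_trans; [apply Cmod_Csum|].
    rewrite scal_sum; apply sum_Rle; intros k _.
    rewrite Cpow_mult_l, <- (Cpow_mult_r q), Nat.mul_succ_r, Cpow_add_r.
    replace (c (S k) * (y ^ S k * (q ^ (n * k) * q ^ n)))
      with (c (S k) * y ^ S k * (q ^ (n * k) * q ^ n)) by ring.
    rewrite Cmod_mult; apply Rmult_le_compat_l; [apply Cmod_ge_0|].
    rewrite Cmod_mult; rewrite <- (Rmult_1_l (Cmod (q ^ n))) at 2.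
    apply Rmult_le_compat_r; [apply Cmod_ge_0 | apply Cmod_pow_le_1].
  + apply Rmult_le_compat_l; [apply Cmod_ge_0|].
    rewrite decomp_sum in HM by lia; simpl pred in HM.
    assert (H0 := Cmod_ge_0 (c 0%nat * y ^ 0)); lra.
Qed.

Lemma eul_bsum (y : C) : exists M, bsum (fun k => Cmod (eul q k * y ^ k)) M.
Proof.
assert (Hy := Cmod_ge_0 y).
apply (bsum_ratio _ (/ 2)); [intros; apply Cmod_ge_0 | lra|].
assert (F := pow_q_small q q_lt ((1 - Cmod q) / (2 * (Cmod y + 1)))
  ltac:(apply Rdiv_lt_0_compat; lra)).
revert F; apply filter_imp; intros n Hn.
replace (eul q (S n) * y ^ S n) with (- (eul q n * y ^ n * (q ^ n * y / (1 - q ^ S n))))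
  by (cbn [eul]; rewrite (Cpow_S y); field; apply (qS_ne n)).
rewrite Cmod_opp, Cmod_mult, Rmult_comm; apply Rmult_le_compat_r; [apply Cmod_ge_0|].
rewrite Cmod_div by apply qS_ne; rewrite Cmod_mult.
assert (H1 := Cmod_one_minus_qS n); assert (H2 := Cmod_ge_0 (q ^ n)).
apply Rle_div_l; [lra|].
apply (Rmult_lt_compat_r (2 * (Cmod y + 1))) in Hn; [|lra].
replace ((1 - Cmod q) / (2 * (Cmod y + 1)) * (2 * (Cmod y + 1)))%R
  with (1 - Cmod q)%R in Hn by (field; lra).
nra.
Qed.

Lemma qpoch_euler (y : C) : exists M s, pser (eul q) y M s /\ Ccvg_to (qpoch y q) s.
Proof.
destruct (eul_bsum y) as [M HM].
set (E := fun n => CSeries (fun k => eul q k * (y * q ^ n) ^ k)).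
assert (HE : forall n, is_Cseries (fun k => eul q k * (y * q ^ n) ^ k) (E n))
  by (intros n; exact (pser_shift_cv _ _ _ n HM)).
assert (FE : forall n, E n = (1 - y * q ^ n) * E (S n)).
{ intros n; apply (Ccvg_unique (fun N => Csum (fun k => eul q k * (y * q ^ n) ^ k) (N + 1)));
    [apply Ccvg_shift, HE|].
  apply (Ccvg_ext (fun N => Csum (fun k => eul q k * (y * q ^ S n) ^ k) (N + 1)
     + - (y * q ^ n) * Csum (fun k => eul q k * (y * q ^ S n) ^ k) N)).
  - intros N; rewrite Nat.add_1_r, (Csum_two_term _ (fun k => eul q k * (y * q ^ n) ^ k) _ 0);
      [ring | reflexivity|].
    intros k; replace (y * q ^ S n) with (y * q ^ n * q) by (simpl; ring).
    set (w := y * q ^ n); rewrite !(Cpow_mult_l w q).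
    cbn [eul]; rewrite !(Cpow_S w), !(Cpow_S q).
    assert (H := qS_ne k); rewrite (Cpow_S q k) in H; field; exact H.
  - replace ((1 - y * q ^ n) * E (S n)) with (E (S n) + - (y * q ^ n) * E (S n)) by ring.
    apply Ccvg_plus; [apply Ccvg_shift, HE | apply Ccvg_scal, HE]. }
assert (HP : forall n, qpoch y q n * E n = E 0%nat).
{ induction n as [|n IH]; [simpl; ring|]; rewrite <- IH, (FE n); cbn [qpoch]; ring. }
exists M, (E 0%nat); split; [split; [exact HM|]|].
- specialize (HE 0%nat); revert HE; apply is_Cseries_ext; intros k; simpl.
  rewrite Cmult_1_r; reflexivity.
- apply (Ccvg_quotient _ E _ HP); exact (pser_shift_lim _ _ _ HM).
Qed.

Lemma qpoch_cvg (y : C) : Ccvg_to (qpoch y q) (qpoch_inf y q).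
Proof.
destruct (qpoch_euler y) as [M [s [_ H]]]; unfold qpoch_inf; rewrite (Clim_correct _ _ H); exact H.
Qed.

Lemma pser_eul (a t : C) :
  exists M, forall k, pser (fun n => eul q n * (a * q ^ k) ^ n) t M (qpoch_inf (a * t * q ^ k) q).
Proof.
destruct (eul_bsum (a * t)) as [M HM]; exists M; intros k.
destruct (qpoch_euler (a * t * q ^ k)) as [M' [s [[_ H1] H2]]].
unfold qpoch_inf; rewrite (Clim_correct _ _ H2).
assert (E : forall n, eul q n * (a * t * q ^ k) ^ n = eul q n * (a * q ^ k) ^ n * t ^ n).
{ intros n; rewrite !Cpow_mult_l; ring. }
split.
- apply (bsum_le _ (fun n => Cmod (eul q n * (a * t) ^ n))); [|exact HM].
  intros n; rewrite <- E; split; [apply Cmod_ge_0 | apply pser_term_shift].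
- apply (is_Cseries_ext _ _ _ E H1).
Qed.

Lemma qpoch_inf_split (y : C) n : qpoch_inf y q = qpoch y q n * qpoch_inf (y * q ^ n) q.
Proof.
apply (Ccvg_unique (fun m => qpoch y q (m + n))); [apply Ccvg_shift, qpoch_cvg|].
apply (Ccvg_ext (fun m => qpoch y q n * qpoch (y * q ^ n) q m));
  [intros; rewrite Nat.add_comm, qpoch_add; reflexivity | apply Ccvg_scal, qpoch_cvg].
Qed.

Lemma q_binomial (b y : C) :
  (Cmod y < 1)%R ->
  exists s, is_Cseries (fun k => qpoch b q k / qpoch q q k * y ^ k) s
    /\ s * qpoch_inf y q = qpoch_inf (b * y) q.
Proof.
intros Hy; set (h := fun k => qpoch b q k / qpoch q q k).
assert (Hh : forall k, h (S k) = h k * ((1 - b * q ^ k) / (1 - q ^ S k))).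
{ intros k; unfold h; cbn [qpoch]; rewrite Cpow_S.
  assert (H1 := qq_nz q q_lt k); assert (H2 := qS_ne k); rewrite Cpow_S in H2.
  field; split; assumption. }
assert (Hy0 := Cmod_ge_0 y); assert (Hb0 := Cmod_ge_0 b).
assert (HM : exists M, bsum (fun k => Cmod (h k * y ^ k)) M).
{ set (rho := ((1 + Cmod y) / 2)%R).
  apply (bsum_ratio _ rho); [intros; apply Cmod_ge_0 | unfold rho; lra|].
  assert (F := pow_q_small q q_lt ((1 - Cmod y) / (4 * (Cmod b + 1)))
    ltac:(apply Rdiv_lt_0_compat; lra)).
  revert F; apply filter_imp; intros n Hn.
  apply (Rmult_lt_compat_r (4 * (Cmod b + 1))) in Hn; [|lra].
  replace ((1 - Cmod y) / (4 * (Cmod b + 1)) * (4 * (Cmod b + 1)))%R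
    with (1 - Cmod y)%R in Hn by (field; lra).
  rewrite Hh; replace (h n * ((1 - b * q ^ n) / (1 - q ^ S n)) * y ^ S n)
    with (h n * y ^ n * ((1 - b * q ^ n) * y / (1 - q ^ S n)))
    by (rewrite (Cpow_S y); field; apply (qS_ne n)).
  rewrite Cmod_mult, Rmult_comm; apply Rmult_le_compat_r; [apply Cmod_ge_0|].
  rewrite Cmod_div by apply qS_ne; rewrite Cmod_mult.
  assert (H2 := Cmod_ge_0 (q ^ n)).
  assert (T1 := Cmod_triangle 1 (- (b * q ^ n))); rewrite Cmod_1, Cmod_opp, Cmod_mult in T1.
  change (1 + - (b * q ^ n)) with (1 - b * q ^ n) in T1.
  assert (T2 := Cmod_triangle (1 - q ^ S n) (q ^ S n)).
  replace (1 - q ^ S n + q ^ S n) with (1 : C) in T2 by ring; rewrite Cmod_1 in T2.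
  assert (T3 : (Cmod (q ^ S n) <= Cmod (q ^ n))%R).
  { rewrite Cpow_S, Cmod_mult; assert (H' := Cmod_ge_0 q); nra. }
  apply Rle_div_l; [apply Cmod_gt_0, qS_ne|].
  set (del := ((1 - Cmod y) / 4)%R).
  assert (D1 : (Cmod b * Cmod (q ^ n) <= del)%R) by (unfold del; nra).
  assert (D2 : (Cmod (q ^ n) <= del)%R) by (unfold del; nra).
  apply Rle_trans with ((1 + del) * Cmod y)%R; [nra|].
  apply Rle_trans with (rho * (1 - del))%R; [unfold rho, del; nra | unfold rho; nra]. }
destruct HM as [M HM].
set (H := fun n => CSeries (fun k => h k * (y * q ^ n) ^ k)).
assert (HH : forall n, is_Cseries (fun k => h k * (y * q ^ n) ^ k) (H n))
  by (intros n; exact (pser_shift_cv _ _ _ n HM)).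
assert (FE : forall n, (1 - y * q ^ n) * H n = (1 - b * y * q ^ n) * H (S n)).
{ intros n; apply (Ccvg_unique (fun N => Csum (fun k => h k * (y * q ^ n) ^ k) (N + 1)
     + - (y * q ^ n) * Csum (fun k => h k * (y * q ^ n) ^ k) N)).
  - replace ((1 - y * q ^ n) * H n) with (H n + - (y * q ^ n) * H n) by ring.
    apply Ccvg_plus; [apply Ccvg_shift, HH | apply Ccvg_scal, HH].
  - apply (Ccvg_ext (fun N => Csum (fun k => h k * (y * q ^ S n) ^ k) (N + 1)
     + - (b * y * q ^ n) * Csum (fun k => h k * (y * q ^ S n) ^ k) N)).
    + intros N; rewrite Nat.add_1_r; apply Csum_two_term; [reflexivity|].
      intros m; replace (y * q ^ S n) with (y * q ^ n * q) by (simpl; ring).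
      replace (b * y * q ^ n) with (b * (y * q ^ n)) by ring.
      set (w := y * q ^ n); rewrite Hh, !(Cpow_mult_l w q), !Cpow_S.
      assert (Hq := qS_ne m); rewrite (Cpow_S q) in Hq; field; exact Hq.
    + replace ((1 - b * y * q ^ n) * H (S n)) with (H (S n) + - (b * y * q ^ n) * H (S n)) by ring.
      apply Ccvg_plus; [apply Ccvg_shift, HH | apply Ccvg_scal, HH]. }
assert (HP : forall n, qpoch y q n * H 0%nat = qpoch (b * y) q n * H n).
{ induction n as [|n IH]; [simpl; ring|]; cbn [qpoch].
  transitivity (qpoch y q n * H 0%nat * (1 - y * q ^ n)); [ring|]; rewrite IH.
  transitivity (qpoch (b * y) q n * ((1 - y * q ^ n) * H n)); [ring|]; rewrite FE; ring. }
exists (H 0%nat); split.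
- specialize (HH 0%nat); revert HH; apply is_Cseries_ext; intros k; simpl.
  rewrite Cmult_1_r; reflexivity.
- apply (Ccvg_unique (fun n => qpoch (b * y) q n * H n)).
  + apply (Ccvg_ext (fun n => H 0%nat * qpoch y q n)); [intros; rewrite <- HP; ring|].
    apply Ccvg_scal, qpoch_cvg.
  + replace (qpoch_inf (b * y) q) with (qpoch_inf (b * y) q * h 0%nat)
      by (unfold h; simpl; field; exact C1_nz).
    apply Ccvg_mult; [apply qpoch_cvg | exact (pser_shift_lim _ _ _ HM)].
Qed.

Lemma qpoch_inf_nz (y : C) : (forall n, qpoch y q n <> 0) -> qpoch_inf y q <> 0.
Proof.
intros Hy.
assert (Hs : forall w : C, (Cmod w < 1)%R -> qpoch_inf w q <> 0).
{ intros w Hw; destruct (q_binomial 0 w Hw) as [s [_ E]].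
  intros E0; rewrite E0, Cmult_0_l, Cmult_0_r in E; apply C1_nz; rewrite E.
  apply (Ccvg_unique (qpoch 0 q)); [|apply qpoch_cvg].
  apply (Ccvg_ext (fun _ => 1)); [|apply Ccvg_const].
  induction n as [|n IH]; simpl; [reflexivity | rewrite <- IH; ring]. }
assert (H0 := Cmod_ge_0 y).
destruct (pow_q_small q q_lt (/ (Cmod y + 1)) ltac:(apply Rinv_0_lt_compat; lra)) as [N HN].
specialize (HN N (Nat.le_refl N)).
rewrite (qpoch_inf_split y N); apply Cmult_neq_0; [apply Hy | apply Hs].
rewrite Cmod_mult; apply (Rmult_lt_compat_l (Cmod y + 1)) in HN; [|lra].
rewrite Rinv_r in HN by lra; assert (H1 := Cmod_ge_0 (q ^ N)); nra.
Qed.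

Lemma qpoch_upper (y : C) : exists B : R, (0 < B)%R /\ forall n, (Cmod (qpoch y q n) <= B)%R.
Proof. exact (Ccvg_bounded _ _ (qpoch_cvg y)). Qed.

Lemma qpoch_inv_upper (y : C) :
  (forall n, qpoch y q n <> 0) ->
  exists B : R, (0 < B)%R /\ forall n, (Cmod (/ qpoch y q n) <= B)%R.
Proof.
intros Hy; destruct (Ccvg_lower_bound _ _ (qpoch_cvg y) (qpoch_inf_nz y Hy) Hy) as [d [Hd H]].
exists (/ d)%R; split; [apply Rinv_0_lt_compat, Hd|].
intros n; rewrite Cmod_inv by apply Hy; apply Rinv_le_contravar; auto.
Qed.

Lemma pser_qpc (a t : C) k :
  pser (qpc q a k) t (exp (Cmod a * Cmod t / (1 - Cmod q))) (qpoch (a * t) q k).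
Proof.
assert (Hq := Cmod_ge_0 q).
assert (Hat : (0 <= Cmod a * Cmod t)%R) by (apply Rmult_le_pos; apply Cmod_ge_0).
assert (He : forall x y : R, (x <= y)%R -> (exp x <= exp y)%R).
{ intros x y [L|L]; [left; apply exp_increasing, L | right; f_equal; exact L]. }
apply (pser_le _ _ (exp (Cmod a * Cmod t * ((1 - Cmod q ^ k) / (1 - Cmod q))))).
- apply He; unfold Rdiv at 2; apply Rmult_le_compat_l; [exact Hat|].
  unfold Rdiv; rewrite <- (Rmult_1_l (/ (1 - Cmod q))) at 2.
  apply Rmult_le_compat_r; [left; apply Rinv_0_lt_compat; lra|].
  assert (H := pow_le _ k Hq); lra.
- induction k as [|k IH].
  + simpl pow; replace ((1 - 1) / (1 - Cmod q))%R with 0%R by (field; lra).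
    rewrite Rmult_0_r, exp_0; apply pser_one.
  + assert (H := pser_conv _ _ _ _ _ _ _ IH (pser_linc (a * q ^ k) t)).
    replace (a * q ^ k * t) with (a * t * q ^ k) in H by ring.
    revert H; apply pser_le.
    replace (Cmod a * Cmod t * ((1 - Cmod q ^ S k) / (1 - Cmod q)))%R
      with (Cmod a * Cmod t * ((1 - Cmod q ^ k) / (1 - Cmod q)) + Cmod (a * q ^ k) * Cmod t)%R
      by (rewrite Cmod_mult, Cmod_pow; simpl; field; lra).
    rewrite exp_plus; apply Rmult_le_compat_l; [left; apply exp_pos|].
    apply exp_ineq1_le.
Qed.

Lemma power_series_unique (c : nat -> C) (w : C) :
  w <> 0 ->
  eventually (fun m => is_Cseries (fun n => c n * (w * q ^ m) ^ n) 0) ->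
  forall n, c n = 0.
Proof.
intros Hw [m0 Hm0].
set (b := fun n => c n * (w * q ^ m0) ^ n).
assert (Hb : forall j, is_Cseries (fun n => b n * (q ^ j) ^ n) 0).
{ intros j; assert (H := Hm0 (m0 + j)%nat ltac:(lia)); revert H; apply is_Cseries_ext; intros n.
  unfold b; rewrite Cpow_add_r, Cmult_assoc, Cpow_mult_l; ring. }
assert (Hbd : exists B : R, (0 < B)%R /\ forall n, (Cmod (b n) <= B)%R).
{ destruct (Ccvg_bounded _ _ (Hb 0%nat)) as [B [HB H]]; exists (B + B)%R; split; [lra|].
  intros n; replace (b n) with (b n * (q ^ 0) ^ n) by (simpl; rewrite Cpow_1_l; ring).
  destruct n as [|n]; [specialize (H 0%nat); rewrite Csum_0 in H; lra|].
  assert (H1 := H n); assert (H2 := H (S n)); rewrite Csum_S in H2.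
  match goal with |- (Cmod ?x <= _)%R =>
    assert (T := Cmod_triangle (Csum (fun n => b n * (q ^ 0) ^ n) n + x)
      (- Csum (fun n => b n * (q ^ 0) ^ n) n)) end.
  rewrite Cmod_opp in T.
  match type of T with (Cmod ?x <= _)%R =>
    replace x with (b (S n) * (q ^ 0) ^ S n) in T by ring end; lra. }
destruct Hbd as [B [HB Hbd]].
assert (Hq := Cmod_ge_0 q).
assert (Hb0 : forall n, b n = 0).
{ intros n; induction n as [n IH] using (well_founded_induction Wf_nat.lt_wf).
  destruct (Ceq_dec (b n) 0) as [|Hn]; [assumption|exfalso]; apply Cmod_gt_0 in Hn.
  set (K := (B / (1 - Cmod q))%R).
  assert (HK : (0 < K)%R) by (apply Rdiv_lt_0_compat; lra).
  destruct (pow_q_small q q_lt (Cmod (b n) / K) ltac:(apply Rdiv_lt_0_compat; lra)) as [J HJ].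
  specialize (HJ (S J) ltac:(lia)).
  set (y := q ^ S J) in *.
  assert (Hy0 : (0 < Cmod y)%R) by (apply Cmod_gt_0, Cpow_nz, q_nz).
  assert (Hyq : (Cmod y <= Cmod q)%R).
  { unfold y; rewrite Cpow_S, Cmod_mult; assert (H := Cmod_pow_le_1 J).
    assert (H' := Cmod_ge_0 (q ^ J)); nra. }
  assert (E : (Cmod (- (b n * y ^ n)) <= Cmod y ^ S n * K)%R).
  { apply (Ccvg_le (fun N => Csum (fun k => b k * y ^ k) (N + S n) + - (b n * y ^ n))).
    - rewrite <- (Cplus_0_l (- (b n * y ^ n))) at 1.
      apply Ccvg_plus; [apply Ccvg_shift, Hb | apply Ccvg_const].
    - exists 0%nat; intros N _.
      assert (E : Csum (fun k => b k * y ^ k) n = b n * y ^ n).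
      { destruct n as [|n']; [apply Csum_0|]; rewrite Csum_S.
        rewrite Csum_zero; [ring|]; intros k Hk; rewrite IH by lia; ring. }
      rewrite <- E; change (?x + - ?z) with (x - z).
      eapply Rle_trans; [apply (Cmod_Csum_diff _ (fun k => (B * Cmod y ^ k)%R)); [|lia]|].
      + intros k; rewrite Cmod_mult, Cmod_pow; apply Rmult_le_compat_r; [|apply Hbd].
        apply pow_le; lra.
      + replace (N + S n)%nat with (S (n + N)) by lia; clear E.
        assert (G : forall M, (sum_f_R0 (fun k => (B * Cmod y ^ k)%R) (S (n + M))
           - sum_f_R0 (fun k => (B * Cmod y ^ k)%R) n
           = Cmod y ^ S n * (B * sum_f_R0 (fun k => Cmod y ^ k) M))%R).
        { induction M as [|M IHM]; [rewrite Nat.add_0_r; simpl; ring|].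
          rewrite Nat.add_succ_r, tech5, (tech5 _ M).
          match goal with |- (?a + ?bb - ?cc = _)%R => replace (a + bb - cc)%R with (a - cc + bb)%R by ring end.
          rewrite IHM; replace (S (S (n + M))) with (S n + S M)%nat by lia.
          rewrite pow_add; ring. }
        rewrite G; apply Rmult_le_compat_l; [apply pow_le; lra|].
        unfold K, Rdiv; apply Rmult_le_compat_l; [lra|].
        eapply Rle_trans; [apply (proj2 (bsum_geom (Cmod y) ltac:(lra)))|].
        apply Rinv_le_contravar; lra. }
  rewrite Cmod_opp, Cmod_mult, Cmod_pow in E.
  assert (Hyn : (0 < Cmod y ^ n)%R) by (apply pow_lt, Hy0).
  apply (Rmult_lt_compat_r K) in HJ; [|exact HK].
  replace (Cmod (b n) / K * K)%R with (Cmod (b n)) in HJ by (field; lra).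
  simpl in E; nra. }
intros n; specialize (Hb0 n); unfold b in Hb0.
apply Cmult_cancel_l with ((w * q ^ m0) ^ n).
- apply Cpow_nz, Cmult_neq_0; [exact Hw | apply Cpow_nz, q_nz].
- rewrite Cmult_0_r, Cmult_comm; exact Hb0.
Qed.
End Analysis.

(** * The generating function *)

Lemma is_Cseries_delay (u : nat -> C) (s : C) k :
  (forall n, (n < k)%nat -> u n = 0) -> is_Cseries (fun m => u (m + k)%nat) s -> is_Cseries u s.
Proof.
intros H0 H; apply (Ccvg_unshift _ _ k); revert H; apply Ccvg_ext; intros n.
induction n as [|n IH].
- rewrite Csum_0; simpl; destruct k as [|k]; [rewrite Csum_0; reflexivity|].
  rewrite Csum_S, Csum_zero; [ring | intros j Hj; apply H0; lia].
- simpl; rewrite !Csum_S, IH; reflexivity.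
Qed.

Lemma is_Cseries_finite (u : nat -> C) N :
  (forall k, (N < k)%nat -> u k = 0) -> is_Cseries u (Csum u N).
Proof.
intros H; apply (Ccvg_ext_eventually (fun _ => Csum u N)); [|apply Ccvg_const].
exists N; intros n Hn; symmetry; apply Csum_extend; assumption.
Qed.

Lemma qpoch_reverse_full (q : C) (k : nat) :
  q <> 0 ->
  exists E : C, E <> 0 /\ E * E * q ^ k = (q ^ k) ^ k /\
  forall x : C, x <> 0 -> qpoch x q k = qpoch (q / (q ^ k * x)) q k * (- x) ^ k * E.
Proof.
intros q_nz; induction k as [|k [E [HE [HE2 H]]]].
- exists 1; split; [exact C1_nz|]; split; [simpl; ring|]; intros; simpl; ring.
- assert (Hk := Cpow_nz q k q_nz); exists (E * q ^ k); repeat split.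
  + apply Cmult_neq_0; assumption.
  + rewrite !Cpow_S, Cpow_mult_l, <- HE2; ring.
  + intros x Hx; rewrite (qpoch_S x), H by exact Hx.
    rewrite qpoch_S_l.
    replace (q / (q ^ S k * x) * q) with (q / (q ^ k * x))
      by (rewrite Cpow_S; field; auto).
    rewrite !Cpow_S; field; auto.
Qed.

Lemma small_qpoch_nz (q x : C) n : (Cmod q < 1)%R -> (Cmod x < 1)%R -> qpoch x q n <> 0.
Proof.
intros Hq Hx; apply qpoch_nz; intros k _; apply one_minus_nz; rewrite Cmod_mult.
assert (H := Cmod_pow_le_1 q Hq k); assert (H' := Cmod_ge_0 x); assert (H'' := Cmod_ge_0 (q ^ k)); nra.
Qed.

Section Generating.
Variable q : C.
Hypothesis q_nz : q <> 0.
Hypothesis q_lt : (Cmod q < 1)%R.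

Lemma vwp_binomial (b y : C) :
  (Cmod y < 1)%R ->
  is_Cseries (fun m => qpoch b q m * (1 - b * (q ^ m * q ^ m)) / qpoch q q m * y ^ m)
    ((1 - b) * (1 - b * q * y * y) * qpoch_inf (b * q * q * y) q / qpoch_inf y q).
Proof.
intros Hy.
assert (Hy2 : (Cmod (q * q * y) < 1)%R).
{ rewrite !Cmod_mult; assert (H := Cmod_ge_0 q); assert (H' := Cmod_ge_0 y); nra. }
destruct (q_binomial q q_lt b y Hy) as [s1 [H1 E1]].
destruct (q_binomial q q_lt b (q * q * y) Hy2) as [s2 [H2 E2]].
assert (Hn1 := qpoch_inf_nz q q_lt y (fun n => small_qpoch_nz q y n q_lt Hy)).
assert (Hn2 := qpoch_inf_nz q q_lt (q * q * y) (fun n => small_qpoch_nz q _ n q_lt Hy2)).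
assert (Sp : forall x : C, qpoch_inf x q = (1 - x) * (1 - x * q) * qpoch_inf (q * q * x) q).
{ intros x; rewrite (qpoch_inf_split q q_lt x 2).
  replace (x * q ^ 2) with (q * q * x) by (simpl; ring); simpl; ring. }
assert (Es1 : s1 = qpoch_inf (b * y) q / qpoch_inf y q) by (rewrite <- E1; field; exact Hn1).
assert (Es2 : s2 = qpoch_inf (b * (q * q * y)) q / qpoch_inf (q * q * y) q)
  by (rewrite <- E2; field; exact Hn2).
replace ((1 - b) * (1 - b * q * y * y) * qpoch_inf (b * q * q * y) q / qpoch_inf y q)
  with (s1 + - b * s2).
- apply (is_Cseries_ext (fun k => qpoch b q k / qpoch q q k * y ^ k
     + - b * (qpoch b q k / qpoch q q k * (q * q * y) ^ k))).
  + intros n; rewrite !Cpow_mult_l; field; apply qq_nz, q_lt.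
  + apply is_Cseries_plus; [exact H1 | apply is_Cseries_scal, H2].
- rewrite Es1, Es2; rewrite (Sp y) in Hn1 |- *; rewrite (Sp (b * y)).
  rewrite !Cmult_neq_0_iff in Hn1; destruct Hn1 as [[? ?] _].
  replace (q * q * (b * y)) with (b * q * q * y) by ring.
  replace (b * (q * q * y)) with (b * q * q * y) by ring.
  field; repeat split; auto.
Qed.

Lemma bailey_row (a T : C) k :
  T <> 0 -> (Cmod T < Cmod (q ^ k))%R ->
  is_Cseries (fun n => qpoch a q n * (1 - a * (q ^ n * q ^ n)) / qpoch q q n * T ^ n
      * (qpoch (/ q ^ n) q k * qpoch (a * q ^ n) q k))
    (qpoch a q (k + k) * (1 - a * (q ^ k * q ^ k)) * (1 - a * q * T * T)
     * qpoch_inf (a * q * q * T * q ^ k) q / (qpoch_inf T q * qpoch (q / T) q k)).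
Proof.
intros HT HTk.
assert (Hk := Cpow_nz q k q_nz).
assert (Hk1 := Cmod_pow_le_1 q q_lt k).
assert (Hqk : (0 < Cmod (q ^ k))%R) by (apply Cmod_gt_0, Hk).
set (y := T / q ^ k); set (b := a * (q ^ k * q ^ k)).
assert (Hy : (Cmod y < 1)%R) by (unfold y; rewrite Cmod_div by exact Hk; apply Rlt_div_l; lra).
assert (Hy0 : y <> 0).
{ intros E; apply HT; transitivity (y * q ^ k); [unfold y; field; exact Hk | rewrite E; ring]. }
assert (HTi := qpoch_inf_nz q q_lt T (fun n => small_qpoch_nz q T n q_lt ltac:(lra))).
destruct (qpoch_reverse_full q k q_nz) as [E [HE [HE2 HR]]].
assert (Hqk2 : (- q) ^ k <> 0).
{ apply Cpow_nz; intros X; apply q_nz; replace q with (- - q) by ring; rewrite X; ring. }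
assert (HyT := HR y Hy0).
replace (q / (q ^ k * y)) with (q / T) in HyT by (unfold y; field; auto).
assert (HyN := small_qpoch_nz q y k q_lt Hy).
rewrite HyT in HyN; rewrite !Cmult_neq_0_iff in HyN; destruct HyN as [[HqT Hyk] _].
apply (is_Cseries_delay _ _ k).
{ intros n Hn; rewrite qVn_poch_eq_0 by assumption; ring. }
apply (is_Cseries_ext (fun m => qpoch a q (k + k) * T ^ k / ((- q) ^ k * E) *
  (qpoch b q m * (1 - b * (q ^ m * q ^ m)) / qpoch q q m * y ^ m))).
- intros m.
  assert (Hm := Cpow_nz q m q_nz).
  assert (Hmk : (q ^ m) ^ k <> 0) by (apply Cpow_nz, Hm).
  assert (E1 : qpoch a q (m + k) * qpoch (a * q ^ (m + k)) q k = qpoch a q (k + k) * qpoch b q m).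
  { rewrite <- qpoch_add; unfold b; rewrite <- Cpow_add_r, <- qpoch_add; f_equal; lia. }
  assert (E2 : qpoch q q (m + k) = qpoch q q m * (qpoch (/ q ^ (m + k)) q k * ((- q) ^ k * (q ^ m) ^ k) * E)).
  { rewrite qpoch_add, (HR (q * q ^ m)) by (apply Cmult_neq_0; auto).
    rewrite Cpow_add_r; replace (q / (q ^ k * (q * q ^ m))) with (/ (q ^ m * q ^ k))
      by (field; auto).
    rewrite <- Cpow_mult_l; do 4 f_equal; ring. }
  assert (E3 : T ^ (m + k) = T ^ k * (y ^ m * (q ^ m) ^ k)).
  { rewrite <- Cpow_mult_r, Nat.mul_comm, Cpow_mult_r, <- Cpow_mult_l.
    replace (y * q ^ k) with T by (unfold y; field; auto).
    rewrite <- Cpow_add_r; f_equal; lia. }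
  assert (Hqmk := qq_nz q q_lt (m + k)); rewrite E2 in Hqmk |- *; rewrite E3.
  rewrite !Cmult_neq_0_iff in Hqmk; destruct Hqmk as [? [[? _] _]].
  replace (1 - b * (q ^ m * q ^ m)) with (1 - a * (q ^ (m + k) * q ^ (m + k)))
    by (unfold b; rewrite Cpow_add_r; ring).
  match goal with |- _ = ?x * ?w / ?d * ?tt * (?p1 * ?p2) =>
    transitivity ((x * p2) * w / d * tt * p1); [|unfold Cdiv; ring] end.
  rewrite E1; field; repeat split; auto.
- assert (HV := vwp_binomial b y Hy).
  apply (is_Cseries_scal (qpoch a q (k + k) * T ^ k / ((- q) ^ k * E))) in HV.
  match type of HV with Ccvg_to _ ?l => match goal with |- Ccvg_to _ ?r =>
    replace r with l; [exact HV|] end end.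
  rewrite (qpoch_inf_split q q_lt y k), HyT.
  replace (y * q ^ k) with T by (unfold y; field; auto).
  replace (b * q * q * y) with (a * q * q * T * q ^ k) by (unfold b, y; field; auto).
  replace (b * q * y * y) with (a * q * T * T) by (unfold b, y; field; auto).
  fold b.
  assert (EE : (- q) ^ k * (- y) ^ k * (E * E) = T ^ k).
  { apply Cmult_cancel_l with (q ^ k); [exact Hk|].
    transitivity ((- q) ^ k * (- y) ^ k * (E * E * q ^ k)); [ring|].
    rewrite HE2, <- !Cpow_mult_l; f_equal; unfold y; field; auto. }
  rewrite <- EE; field; repeat split; auto.
Qed.
End Generating.

Section Jacobi.
Variables q p A B : C.
Hypothesis q_nz : q <> 0.
Hypothesis q_lt : (Cmod q < 1)%R.
Hypothesis pp : p * p = q.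
Hypothesis A_nz : A <> 0.
Hypothesis B_nz : B <> 0.
Hypothesis hAB : forall n, qpoch (A * B) q n <> 0.
Hypothesis hBBp : forall n, qpoch (B * B * p) q n <> 0.
Hypothesis hAAp : forall n, qpoch (A * A * p) q n <> 0.
Hypothesis hmAB : forall n, qpoch (- (A * B)) q n <> 0.
Hypothesis hmABp : forall n, qpoch (- (A * B * p)) q n <> 0.

Definition jacobi_weight (n : nat) : C :=
  qpoch (A * A * B * B) q n * qpoch (A * B * q) q n
  / (qpoch (B * B * p) q n * qpoch (A * B) q n)
  * (A ^ n / (qpoch q q n * qpoch (- (A * B)) q n * qpoch (- (A * B * p)) q n)).

(* In the notation of the header, [jacobi_coef], [kernel_coef] and [numer_coef]
   are the coefficients of [L], [D] and [N]; [row_coef] collects the factors of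
   the [k]-th term of [N] that depend on [t]. *)
Definition jacobi_coef (z : C) (n : nat) : C :=
  jacobi_weight n * askey_wilson_z n z A (A * p) (- B) (- (B * p)) q.

Definition kernel_coef (z : C) : nat -> C :=
  let e c := fun n => eul q n * (c * q ^ 0) ^ n in
  conv (conv (e (- (A * A * B * B * p * q))) (e (- (A * A * p))))
       (conv (e (A * z)) (e (A * / z))).

Definition vwp_coef (k : nat) : nat -> C :=
  match k with
  | O => linc 0
  | S j => conv (linc (- (A * A * B * B * p) * (q ^ k * q ^ k)))
                (qpc q (- (A * A * B * B * p) * q) j)
  end.

Definition row_coef (z : C) (k : nat) : nat -> C :=
  let e c := fun n => eul q n * (c * q ^ k) ^ n in
  conv (conv (conv (linc (A * A)) (linc (- (A * A))))
             (conv (vwp_coef k) (qpc q (- (A * A * q)) k)))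
       (conv (conv (e (- (A * A * A * B * p * q))) (e (- (A * B * p))))
             (conv (e (A * A * B * q * z)) (e (A * A * B * q * / z)))).

Definition row_factor (z : C) (k : nat) : C :=
  qpoch (B / A) q k * qpoch (A * B * q) q k
  * (qpoch (- (B * p) * z) q k * qpoch (- (B * p) * / z) q k)
  / (qpoch q q k * qpoch (B * B * p) q k) * (- (A * A)) ^ k.

Definition numer_coef (z : C) (i : nat) : C :=
  Csum (fun k => row_factor z k * row_coef z k (i - k)) i.

Definition vwp_value (t : C) (k : nat) : C :=
  match k with
  | O => 1
  | S j => (1 - - (A * A * B * B * p) * (q ^ k * q ^ k) * t)
           * qpoch (- (A * A * B * B * p) * q * t) q j
  end.

Definition row_value (z t : C) (k : nat) : C :=
  (1 - A * A * t) * (1 - - (A * A) * t)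
  * (vwp_value t k * qpoch (- (A * A * q) * t) q k)
  * (qpoch_inf (- (A * A * A * B * p * q) * t * q ^ k) q
     * qpoch_inf (- (A * B * p) * t * q ^ k) q
     * (qpoch_inf (A * A * B * q * z * t * q ^ k) q
        * qpoch_inf (A * A * B * q * / z * t * q ^ k) q)).

Lemma p_nz : p <> 0.
Proof. intros E; apply q_nz; rewrite <- pp, E; ring. Qed.

Lemma kernel_pser (z t : C) :
  exists M, pser (kernel_coef z) t M
    (qpoch_inf (- (A * A * B * B * p * q) * t) q * qpoch_inf (- (A * A * p) * t) q
     * (qpoch_inf (A * z * t) q * qpoch_inf (A * / z * t) q)).
Proof.
destruct (pser_eul q q_lt (- (A * A * B * B * p * q)) t) as [M1 H1].
destruct (pser_eul q q_lt (- (A * A * p)) t) as [M2 H2].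
destruct (pser_eul q q_lt (A * z) t) as [M3 H3].
destruct (pser_eul q q_lt (A * / z) t) as [M4 H4].
exists (M1 * M2 * (M3 * M4))%R.
specialize (H1 0%nat); specialize (H2 0%nat); specialize (H3 0%nat); specialize (H4 0%nat).
assert (E : forall x : C, x * q ^ 0 = x) by (intros; simpl; ring).
rewrite (E (_ * t)) in H1; rewrite (E (_ * t)) in H2; rewrite (E (_ * t)) in H3; rewrite (E (_ * t)) in H4.
unfold kernel_coef; cbv zeta.
apply pser_conv; apply pser_conv; assumption.
Qed.

Lemma pser_M_nonneg (c : nat -> C) (t : C) (M : R) (s : C) : pser c t M s -> (0 <= M)%R.
Proof. intros [[H1 H2] _]; specialize (H1 0%nat); specialize (H2 0%nat); simpl in *; lra. Qed.

Lemma vwp_pser (t : C) : exists M, forall k, pser (vwp_coef k) t M (vwp_value t k).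
Proof.
set (a := - (A * A * B * B * p)).
set (X := (Cmod (a * q) * Cmod t / (1 - Cmod q))%R).
assert (HX : (1 <= exp X)%R).
{ rewrite <- exp_0; destruct (Rle_lt_or_eq_dec 0 X) as [H|H].
  - apply Rdiv_le_0_compat; [apply Rmult_le_pos; apply Cmod_ge_0 | lra].
  - left; apply exp_increasing, H.
  - rewrite <- H; lra. }
assert (Hat : (0 <= Cmod a * Cmod t)%R) by (apply Rmult_le_pos; apply Cmod_ge_0).
exists ((1 + Cmod a * Cmod t) * exp X)%R; intros [|j].
- apply (pser_le _ _ 1); [nra | apply pser_one].
- unfold vwp_coef, vwp_value; fold a.
  refine (pser_le _ _ _ _ _ _ (pser_conv _ _ _ _ _ _ _ (pser_linc _ t) (pser_qpc q q_lt (a * q) t j))).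
  fold X; apply Rmult_le_compat_r; [lra|].
  apply Rplus_le_compat_l, Rmult_le_compat_r; [apply Cmod_ge_0|].
  rewrite !Cmod_mult; assert (H := Cmod_pow_le_1 q q_lt (S j)).
  assert (H' := Cmod_ge_0 (q ^ S j)); assert (H'' := Cmod_ge_0 a).
  rewrite <- (Rmult_1_r (Cmod a)) at 2; apply Rmult_le_compat_l; [exact H''|nra].
Qed.

Lemma row_pser (z t : C) : exists M, forall k, pser (row_coef z k) t M (row_value z t k).
Proof.
destruct (vwp_pser t) as [M0 H0].
destruct (pser_eul q q_lt (- (A * A * A * B * p * q)) t) as [M1 H1].
destruct (pser_eul q q_lt (- (A * B * p)) t) as [M2 H2].
destruct (pser_eul q q_lt (A * A * B * q * z) t) as [M3 H3].
destruct (pser_eul q q_lt (A * A * B * q * / z) t) as [M4 H4].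
eexists; intros k; unfold row_coef, row_value; cbv zeta.
apply pser_conv; [|apply pser_conv; [apply pser_conv; [apply H1 | apply H2]
                                    |apply pser_conv; [apply H3 | apply H4]]].
apply pser_conv; [apply pser_conv; apply pser_linc|].
apply pser_conv; [apply H0 | apply (pser_qpc q q_lt)].
Qed.

Lemma Cmod_mult_le (x y : C) (a b : R) :
  (Cmod x <= a)%R -> (Cmod y <= b)%R -> (Cmod (x * y) <= a * b)%R.
Proof.
intros H H'; rewrite Cmod_mult; apply Rmult_le_compat; auto; apply Cmod_ge_0.
Qed.

Lemma row_factor_bound (z : C) :
  exists K : R, (0 <= K)%R /\ forall k, (Cmod (row_factor z k) <= K * Cmod (A * A) ^ k)%R.
Proof.
destruct (qpoch_upper q q_lt (B / A)) as [K1 [P1 H1]].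
destruct (qpoch_upper q q_lt (A * B * q)) as [K2 [P2 H2]].
destruct (qpoch_upper q q_lt (- (B * p) * z)) as [K3 [P3 H3]].
destruct (qpoch_upper q q_lt (- (B * p) * / z)) as [K4 [P4 H4]].
destruct (qpoch_inv_upper q q_lt q (qq_nz q q_lt)) as [K5 [P5 H5]].
destruct (qpoch_inv_upper q q_lt (B * B * p) hBBp) as [K6 [P6 H6]].
exists (K1 * K2 * (K3 * K4) * (K5 * K6))%R; split.
- left; repeat apply Rmult_lt_0_compat; assumption.
- intros k; unfold row_factor.
  replace (/ (qpoch q q k * qpoch (B * B * p) q k)) with (/ qpoch q q k * / qpoch (B * B * p) q k)
    by (field; split; auto using qq_nz).
  unfold Cdiv; rewrite Cmod_mult, Cmod_pow, Cmod_opp.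
  apply Rmult_le_compat_r; [apply pow_le, Cmod_ge_0|].
  replace (/ (qpoch q q k * qpoch (B * B * p) q k)) with (/ qpoch q q k * / qpoch (B * B * p) q k)
    by (field; split; auto using qq_nz).
  repeat apply Cmod_mult_le; auto.
Qed.

Lemma numer_series (z t : C) :
  (Cmod (A * A * t) < 1)%R ->
  exists s, is_Cseries (fun k => row_factor z k * t ^ k * row_value z t k) s
    /\ is_Cseries (fun i => numer_coef z i * t ^ i) s.
Proof.
intros Ht; destruct (row_pser z t) as [M HM]; destruct (row_factor_bound z) as [K [HK Hb]].
assert (HM0 := pser_M_nonneg _ _ _ _ (HM 0%nat)).
set (g := fun k => (K * M * Cmod (A * A * t) ^ k)%R).
assert (Hg : bsum g (K * M * / (1 - Cmod (A * A * t)))).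
{ apply bsum_scal; [apply Rmult_le_pos; assumption | apply bsum_geom].
  split; [apply Cmod_ge_0 | exact Ht]. }
assert (Hrow : forall k n, (Cmod (Csum (fun j => row_factor z k * t ^ k * (row_coef z k j * t ^ j))%C n) <= g k)%R).
{ intros k n; rewrite Csum_scal; unfold g.
  replace (K * M * Cmod (A * A * t) ^ k)%R with (K * Cmod (A * A) ^ k * Cmod t ^ k * M)%R
    by (rewrite (Cmod_mult (A * A)), Rpow_mult_distr; ring).
  apply Cmod_mult_le.
  - apply Cmod_mult_le; [apply Hb | rewrite Cmod_pow; lra].
  - eapply Rle_trans; [apply Cmod_Csum | apply (HM k)]. }
assert (Hcv : forall k, is_Cseries (fun j => row_factor z k * t ^ k * (row_coef z k j * t ^ j))
  (row_factor z k * t ^ k * row_value z t k)).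
{ intros k; apply is_Cseries_scal, HM. }
assert (HF : forall k, (Cmod (row_factor z k * t ^ k * row_value z t k) <= g k)%R).
{ intros k; apply (Ccvg_le _ _ _ (Hcv k)); exists 0%nat; intros; apply Hrow. }
destruct (bsum_cv _ g _ HF Hg) as [s [Hs _]]; exists s; split; [exact Hs|].
apply (is_Cseries_ext (fun i => Csum (fun k =>
  (fun k j => row_factor z k * t ^ k * (row_coef z k j * t ^ j)) k (i - k)%nat) i)).
- intros i; unfold numer_coef; rewrite (Cmult_comm (Csum _ _)), <- Csum_scal.
  apply Csum_ext; intros k Hk.
  replace (t ^ i) with (t ^ k * t ^ (i - k)) by (rewrite <- Cpow_add_r; f_equal; lia); ring.
- apply (is_Cseries_triangle _ _ g _ s Hrow Hg Hcv Hs).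
Qed.

Let w8 (z t : C) := W87_term (- (A * A * B * B * p) * t) (- (A * A * q) * t) (B / A) (A * B * q)
   (- (B * p) * z) (- (B * p) * / z) q (- (A * A) * t).

Definition prefactor (z t : C) : C :=
  (1 - A * A * t) * (1 - - (A * A) * t)
  * (qpoch_inf (- (A * A * A * B * p * q) * t) q * qpoch_inf (- (A * B * p) * t) q
     * (qpoch_inf (A * A * B * q * z * t) q * qpoch_inf (A * A * B * q * / z * t) q)).

Lemma row_eq_W87 (z t : C) (k : nat) :
  z <> 0 -> t <> 0 -> 1 - - (A * A * B * B * p) * t <> 0 ->
  qpoch (- (A * A * A * B * p * q) * t) q k <> 0 ->
  qpoch (- (A * B * p) * t) q k <> 0 ->
  qpoch (A * A * B * q * z * t) q k <> 0 ->
  qpoch (A * A * B * q * / z * t) q k <> 0 ->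
  row_factor z k * t ^ k * row_value z t k = prefactor z t * w8 z t k.
Proof.
intros Hz Ht H0 H1 H2 H3 H4.
assert (Hp := p_nz).
unfold w8, W87_term, qpochs, prefactor, row_value, row_factor; cbn [fold_right].
rewrite (qpoch_inf_split q q_lt (- (A * A * A * B * p * q) * t) k).
rewrite (qpoch_inf_split q q_lt (- (A * B * p) * t) k).
rewrite (qpoch_inf_split q q_lt (A * A * B * q * z * t) k).
rewrite (qpoch_inf_split q q_lt (A * A * B * q * / z * t) k).
replace (q * (- (A * A * B * B * p) * t) / (- (A * A * q) * t)) with (B * B * p)
  by (field; auto).
replace (q * (- (A * A * B * B * p) * t) / (B / A)) with (- (A * A * A * B * p * q) * t)
  by (field; auto).
replace (q * (- (A * A * B * B * p) * t) / (A * B * q)) with (- (A * B * p) * t)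
  by (field; auto).
replace (q * (- (A * A * B * B * p) * t) / (- (B * p) * z)) with (A * A * B * q * / z * t)
  by (field; auto).
replace (q * (- (A * A * B * B * p) * t) / (- (B * p) * / z)) with (A * A * B * q * z * t)
  by (field; auto).
assert (EV : vwp_value t k = (1 - - (A * A * B * B * p) * t * q ^ (2 * k)) / (1 - - (A * A * B * B * p) * t)
   * qpoch (- (A * A * B * B * p) * t) q k).
{ destruct k as [|j]; [simpl; field; exact H0|].
  unfold vwp_value; rewrite qpoch_S_l.
  replace (2 * S j)%nat with (S j + S j)%nat by lia; rewrite Cpow_add_r.
  replace (- (A * A * B * B * p) * t * q) with (- (A * A * B * B * p) * q * t) by ring.
  field; exact H0. }
rewrite EV, !Cpow_mult_l.
assert (Hq := qq_nz q q_lt k); assert (HB := hBBp k).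
field; repeat split; auto.
Qed.

Lemma hmABq n : qpoch (- (A * B * q)) q n <> 0.
Proof.
assert (H := hmAB (S n)); rewrite qpoch_S_l in H; apply Cmult_neq_0_iff in H.
replace (- (A * B * q)) with (- (A * B) * q) by ring; tauto.
Qed.

Lemma one_minus_AABB_nz : 1 - A * A * B * B <> 0.
Proof.
assert (H := hAB 1); assert (H' := hmAB 1); simpl in H, H'.
replace (1 - A * A * B * B) with (1 * (1 - A * B * 1) * (1 * (1 - - (A * B) * 1))) by ring.
apply Cmult_neq_0; assumption.
Qed.

Definition basis_term (z : C) (k : nat) : C :=
  qpoch (- (B * p) * z) q k * qpoch (- (B * p) * / z) q k
  / (qpoch q q k * qpoch (B * B * p) q k * qpoch (- (A * B * q)) q k
     * qpoch (- (A * B * p)) q k) * q ^ k.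

Lemma jacobi_coef_basis (z : C) (n : nat) :
  z <> 0 ->
  jacobi_coef z n = / (1 - A * A * B * B)
    * (qpoch (A * A * B * B) q n * (1 - A * A * B * B * (q ^ n * q ^ n)) / qpoch q q n
       * (A / - (B * p)) ^ n)
    * Csum (fun k => qpoch (/ q ^ n) q k * qpoch (A * A * B * B * q ^ n) q k * basis_term z k) n.
Proof.
intros Hz; assert (Hp := p_nz).
assert (Hopp : forall x : C, x <> 0 -> - x <> 0).
{ intros x Hx E; apply Hx; replace x with (- - x) by ring; rewrite E; ring. }
assert (Hd : - (B * p) <> 0) by (apply Hopp, Cmult_neq_0; assumption).
unfold jacobi_coef; rewrite askey_wilson_reverse; auto using Cmult_neq_0.
- unfold askey_wilson_z, qpochs; cbn [fold_right].
  replace (- (B * p) * - B) with (B * B * p) by ring.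
  replace (- (B * p) * (A * p)) with (- (A * B * q)) by (rewrite <- pp; ring).
  replace (- (B * p) * A) with (- (A * B * p)) by ring.
  replace (q ^ n / q * (B * B * p * (A * p) * A)) with (A * A * B * B * q ^ n)
    by (transitivity (q ^ n / q * (p * p) * (A * A * B * B));
        [rewrite pp; field; exact q_nz | unfold Cdiv; ring]).
  rewrite (Csum_ext _ (fun k => qpoch (/ q ^ n) q k * qpoch (A * A * B * B * q ^ n) q k * basis_term z k)).
  2:{ intros k Hk; unfold basis_term, Cdiv; rewrite !Cmult_1_r, !Cmult_assoc; reflexivity. }
  generalize (Csum (fun k => qpoch (/ q ^ n) q k * qpoch (A * A * B * B * q ^ n) q k * basis_term z k) n).
  intros X.
  assert (E1 := qpoch_shift (A * B) q n); assert (E2 := qpoch_shift (- (A * B)) q n).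
  assert (H1 := hAB (S n)); rewrite qpoch_S_l in H1; apply Cmult_neq_0_iff in H1; destruct H1 as [H1 H1'].
  assert (H2 := hmAB (S n)); rewrite qpoch_S_l in H2; apply Cmult_neq_0_iff in H2; destruct H2 as [H2 H2'].
  assert (E1' : qpoch (A * B * q) q n = qpoch (A * B) q n * (1 - A * B * q ^ n) / (1 - A * B))
    by (rewrite E1; field; exact H1).
  assert (E2' : qpoch (- (A * B) * q) q n = qpoch (- (A * B)) q n * (1 - - (A * B) * q ^ n) / (1 - - (A * B)))
    by (rewrite E2; field; exact H2).
  unfold jacobi_weight; rewrite E1'.
  replace (- (A * B * q)) with (- (A * B) * q) by ring; rewrite E2'.
  rewrite Cpow_div by exact Hd.
  assert (K1 := hAB n); assert (K2 := hmAB n); assert (K3 := hmABp n); assert (K4 := hBBp n).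
  assert (K5 := qq_nz q q_lt n); assert (K6 := Cpow_nz _ n Hd); assert (K7 := one_minus_AABB_nz).
  generalize dependent ((- (B * p)) ^ n); intros.
  assert (1 + A * B <> 0) by (replace (1 + A * B) with (1 - - (A * B)) by ring; exact H2).
  generalize dependent (qpoch (- (A * B)) q n); intros.
  generalize dependent (qpoch (- (A * B * p)) q n); intros.
  field; repeat split; auto.
- replace (A * (A * p)) with (A * A * p) by ring; auto.
- replace (A * - B) with (- (A * B)) by ring; auto.
- replace (A * - (B * p)) with (- (A * B * p)) by ring; auto.
- replace (A * p * - B) with (- (A * B * p)) by ring; auto.
- replace (A * p * - (B * p)) with (- (A * B * q)) by (rewrite <- pp; ring); apply hmABq.
- replace (- B * - (B * p)) with (B * B * p) by ring; auto.
Qed.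

Lemma opp_nz (x : C) : x <> 0 -> - x <> 0.
Proof. intros Hx E; apply Hx; replace x with (- - x) by ring; rewrite E; ring. Qed.

Lemma d_nz : - (B * p) <> 0.
Proof. apply opp_nz, Cmult_neq_0; [exact B_nz | exact p_nz]. Qed.

Lemma Cinv_nz (x : C) : x <> 0 -> / x <> 0.
Proof.
intros Hx E; apply C1_nz; transitivity (x * / x); [field; exact Hx | rewrite E; ring].
Qed.

Lemma special_basis_term_0 N k :
  (N < k)%nat -> basis_term (/ - (B * p) / q ^ N) k = 0.
Proof.
intros L; unfold basis_term.
replace (- (B * p) * (/ - (B * p) / q ^ N)) with (/ q ^ N)
  by (field; auto using Cpow_nz, p_nz).
rewrite qVn_poch_eq_0 by assumption; unfold Cdiv; ring.
Qed.

Lemma special_series N (t T : C) :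
  t <> 0 -> T = A * t / - (B * p) -> (Cmod T < Cmod (q ^ N))%R ->
  let z := / - (B * p) / q ^ N in let a := A * A * B * B in
  is_Cseries (fun n => jacobi_coef z n * t ^ n)
   (Csum (fun k => / (1 - a) * basis_term z k *
     (qpoch a q (k + k) * (1 - a * (q ^ k * q ^ k)) * (1 - a * q * T * T)
     * qpoch_inf (a * q * q * T * q ^ k) q / (qpoch_inf T q * qpoch (q / T) q k))) N).
Proof.
intros Ht HT HTN z a.
assert (Hd := d_nz). assert (HN := Cpow_nz q N q_nz).
assert (Hz : z <> 0) by (unfold z, Cdiv; apply Cmult_neq_0; apply Cinv_nz; assumption).
assert (HT0 : T <> 0).
{ rewrite HT; unfold Cdiv; repeat apply Cmult_neq_0; auto using Cinv_nz. }
apply (is_Cseries_ext (fun n => Csum (fun k => / (1 - a) * basis_term z k *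
  (qpoch a q n * (1 - a * (q ^ n * q ^ n)) / qpoch q q n * T ^ n
      * (qpoch (/ q ^ n) q k * qpoch (a * q ^ n) q k))) N)).
- intros n; rewrite jacobi_coef_basis by exact Hz; fold a.
  rewrite <- (Csum_extend _ n (n + N)); [|lia|].
  2:{ intros j Hj; rewrite qVn_poch_eq_0 by assumption; ring. }
  rewrite <- (Csum_extend _ N (n + N)); [|lia|].
  2:{ intros j Hj; unfold z; rewrite special_basis_term_0 by exact Hj; ring. }
  rewrite HT, (Cmult_comm A t).
  replace (t * A / - (B * p)) with (t * (A / - (B * p))) by (unfold Cdiv; ring).
  rewrite (Cpow_mult_l t), (Cmult_comm (_ * Csum _ _)), !Cmult_assoc, <- Csum_scal.
  apply Csum_ext; intros k Hk; unfold Cdiv; ring.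
- apply is_Cseries_Csum; intros k Hk; apply is_Cseries_scal.
  apply bailey_row; auto.
  eapply Rlt_le_trans; [exact HTN|].
  replace N with (k + (N - k))%nat by lia; rewrite Cpow_add_r, Cmod_mult.
  assert (H := Cmod_pow_le_1 q q_lt (N - k)); assert (H' := Cmod_ge_0 (q ^ k)); nra.
Qed.

Lemma qpoch_double (x : C) k :
  qpoch (x * x * q) q (k + k)
  = qpoch (x * p) q k * qpoch (- (x * p)) q k * (qpoch (x * q) q k * qpoch (- (x * q)) q k).
Proof.
induction k as [|k IH]; [simpl; ring|].
replace (S k + S k)%nat with (S (S (k + k))) by lia.
cbn [qpoch]; rewrite IH, Cpow_S, Cpow_add_r, <- pp; ring.
Qed.

Definition kernel_value (z t : C) : C :=
  qpoch_inf (- (A * A * B * B * p * q) * t) q * qpoch_inf (- (A * A * p) * t) q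
     * (qpoch_inf (A * z * t) q * qpoch_inf (A * / z * t) q).

Lemma special_identity N (t T : C) :
  let z := / - (B * p) / q ^ N in
  t <> 0 -> T = A * t / - (B * p) -> (Cmod T < Cmod (q ^ N))%R ->
  (Cmod (A * A * B * B * p * t) < 1)%R ->
  (Cmod (A * A * A * B * p * q * t) < 1)%R ->
  (Cmod (A * B * p * t) < 1)%R ->
  (Cmod (A * A * B * q * z * t) < 1)%R ->
  (Cmod (A * A * B * q * / z * t) < 1)%R ->
  forall s, is_Cseries (fun k => row_factor z k * t ^ k * row_value z t k) s ->
  exists L, is_Cseries (fun n => jacobi_coef z n * t ^ n) L /\ kernel_value z t * L = s.
Proof.
intros z Ht HT HTN C1 C2 C3 C4 C5 s Hs.
assert (Hp := p_nz). assert (Hd := d_nz). assert (HN := Cpow_nz q N q_nz).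
assert (Hz : z <> 0) by (unfold z, Cdiv; apply Cmult_neq_0; apply Cinv_nz; assumption).
assert (HT0 : T <> 0).
{ rewrite HT; unfold Cdiv; repeat apply Cmult_neq_0; auto using Cinv_nz. }
assert (Hsmall : forall x y : C, (Cmod x < 1)%R -> (y = x \/ y = - x) -> forall n, qpoch y q n <> 0).
{ intros x y Hx Hy n; apply small_qpoch_nz; [exact q_lt|].
  destruct Hy as [-> | ->]; rewrite ?Cmod_opp; exact Hx. }
set (a := - (A * A * B * B * p) * t).
assert (Ha : forall n, qpoch a q n <> 0)
  by (apply (Hsmall _ _ C1); right; unfold a; ring).
assert (H1a : 1 - a <> 0).
{ assert (H := Ha 1%nat); simpl in H; intros E; apply H.
  replace (a * 1) with a by ring; rewrite E; ring. }
assert (Haq : forall n, qpoch (q * a) q n <> 0).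
{ intros n; assert (H := Ha (S n)); rewrite qpoch_S_l in H; apply Cmult_neq_0_iff in H.
  rewrite Cmult_comm; tauto. }
assert (D2 : forall n, qpoch (- (A * A * A * B * p * q) * t) q n <> 0)
  by (apply (Hsmall _ _ C2); right; ring).
assert (D3 : forall n, qpoch (- (A * B * p) * t) q n <> 0)
  by (apply (Hsmall _ _ C3); right; ring).
assert (D4 : forall n, qpoch (A * A * B * q * z * t) q n <> 0)
  by (apply (Hsmall _ _ C4); left; ring).
assert (D5 : forall n, qpoch (A * A * B * q * / z * t) q n <> 0)
  by (apply (Hsmall _ _ C5); left; ring).
eexists; split; [apply special_series; eassumption|]; fold z.
set (w := W87_term a (- (A * A * q) * t) (B / A) (A * B * q)
   (- (B * p) * / z) (/ q ^ N) q (- (A * A) * t)).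
assert (Edz : - (B * p) * z = / q ^ N) by (unfold z; field; auto).
assert (Es : s = prefactor z t * Csum w N).
{ apply (Ccvg_unique (Csum (fun k => row_factor z k * t ^ k * row_value z t k))); [exact Hs|].
  apply (is_Cseries_ext (fun k => prefactor z t * w k)).
  - intros k; rewrite row_eq_W87; auto; f_equal; unfold w8, w, a; rewrite <- Edz.
    unfold W87_term, qpochs; cbn [fold_right]; f_equal; f_equal; f_equal; ring.
  - apply is_Cseries_scal, is_Cseries_finite; intros k Hk; unfold w, W87_term, qpochs.
    cbn [fold_right]; rewrite (qVn_poch_eq_0 q q_nz N k) by exact Hk; unfold Cdiv; ring. }
assert (HTsmall : (Cmod T < 1)%R).
{ eapply Rlt_le_trans; [exact HTN | apply Cmod_pow_le_1, q_lt]. }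
assert (HTi := qpoch_inf_nz q q_lt T (fun n => small_qpoch_nz q T n q_lt HTsmall)).
assert (HTN' : forall k, (k <= N)%nat -> qpoch (q / T) q k <> 0).
{ intros k Hk; apply (qpoch_nz_le _ _ N); [|exact Hk].
  destruct (qpoch_reverse_full q N q_nz) as [E [HE [_ HR]]].
  assert (Hy : T / q ^ N <> 0) by (unfold Cdiv; apply Cmult_neq_0; auto using Cinv_nz).
  assert (H := HR _ Hy); replace (q / (q ^ N * (T / q ^ N))) with (q / T) in H by (field; auto).
  assert (Hn : qpoch (T / q ^ N) q N <> 0).
  { apply small_qpoch_nz; [exact q_lt|].
    rewrite Cmod_div by exact HN; apply Rlt_div_l; [apply Cmod_gt_0, HN | lra]. }
  rewrite H, !Cmult_neq_0_iff in Hn; tauto. }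
assert (EdT : A * t = - (B * p) * T) by (rewrite HT; field; auto).
assert (EW := watson q q_nz (qq_nz q q_lt) a (- (A * A * q) * t) (B / A) (A * B * q)
  (- (B * p) * / z) N).
assert (Hz' : / z <> 0) by (apply Cinv_nz, Hz).
assert (Eiz : / z = - (B * p) * q ^ N) by (unfold z; field; auto).
assert (Ha0 : a <> 0) by (unfold a; repeat apply Cmult_neq_0; auto; apply opp_nz; repeat apply Cmult_neq_0; auto).
replace (q * a / (- (A * A * q) * t)) with (B * B * p) in EW by (unfold a; field; auto).
replace (q * a / (B / A)) with (- (A * A * A * B * p * q) * t) in EW by (unfold a; field; auto).
replace (q * a / (A * B * q)) with (- (A * B * p) * t) in EW by (unfold a; field; auto).
replace (q * a / (- (B * p) * / z)) with (A * A * B * q * z * t) in EW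
  by (unfold a; field; auto).
replace (A * B * q * (- (B * p) * / z) / q ^ N / a) with (q / T) in EW
  by (rewrite Eiz, HT; unfold a; field; auto).
replace (q * a / (A * B * q * (- (B * p) * / z))) with (T / q ^ N) in EW
  by (rewrite Eiz, HT; unfold a; field; auto 10).
replace (q * a / (- (A * A * q) * t * (B / A))) with (A * B * p) in EW
  by (unfold a; field; auto).
replace (A * B * p * (q * a / (A * B * q * (- (B * p) * / z) * / q ^ N))) with (- (A * A) * t) in EW
  by (rewrite Eiz; unfold a; field; auto).
fold w in EW; rewrite Es, EW; auto; clear EW; cycle 1.
{ repeat apply Cmult_neq_0; auto; apply opp_nz; repeat apply Cmult_neq_0; auto. }
{ unfold Cdiv; auto using Cmult_neq_0, Cinv_nz. }
{ auto using Cmult_neq_0. }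
{ auto using Cmult_neq_0. }
rewrite (Csum_ext _ (fun k => (1 - A * A * t) * (1 - - (A * A) * t)
  * qpoch_inf (- (A * A * A * B * p * q) * t) q / qpoch_inf T q *
  (qpoch (/ q ^ N) q k * qpoch (A * B * q) q k * qpoch (- (B * p) * / z) q k *
       qpoch (A * B * p) q k / (qpoch q q k * qpoch (B * B * p) q k *
        qpoch (- (A * A * A * B * p * q) * t) q k * qpoch (q / T) q k) * q ^ k))).
- rewrite Csum_scal.
  match goal with |- context [Csum ?f N] => generalize (Csum f N) end; intros Phi.
  unfold kernel_value, prefactor.
  replace (A * z * t) with (T / q ^ N) by (rewrite HT; unfold z; field; repeat split; auto).
  replace (A * / z * t) with (- (A * B * p) * t * q ^ N) by (rewrite Eiz; ring).
  replace (A * A * B * q * / z * t) with (- (A * A * B * B * p * q) * t * q ^ N)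
    by (rewrite Eiz; ring).
  rewrite (qpoch_inf_split q q_lt (- (A * A * B * B * p * q) * t) N).
  rewrite (qpoch_inf_split q q_lt (- (A * B * p) * t) N).
  rewrite (qpoch_inf_split q q_lt (T / q ^ N) N).
  rewrite (qpoch_inf_split q q_lt (A * A * B * q * z * t) N).
  replace (T / q ^ N * q ^ N) with T by (field; repeat split; auto).
  replace (A * A * B * q * z * t * q ^ N) with (- (A * A * p) * t)
    by (replace (A * A * B * q) with (A * A * B * (p * p)) by (rewrite pp; ring);
        unfold z; field; repeat split; auto).
  replace (q * a) with (- (A * A * B * B * p * q) * t) by (unfold a; ring).
  specialize (D3 N); specialize (D4 N).
  field; repeat split; auto.
- intros k Hk; unfold basis_term; rewrite Edz.
  replace (A * A * B * B * q * q * T) with (- (A * A * A * B * p * q) * t)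
    by (rewrite HT, <- pp; field; repeat split; auto).
  replace (A * A * B * B * q * T * T) with (A * A * (A * A) * t * t)
    by (rewrite HT, <- pp; field; repeat split; auto).
  rewrite (qpoch_inf_split q q_lt (- (A * A * A * B * p * q) * t) k).
  assert (E2 : qpoch (A * A * B * B) q (k + k) * (1 - A * A * B * B * (q ^ k * q ^ k))
    = (1 - A * A * B * B) * (qpoch (A * B * p) q k * qpoch (- (A * B * p)) q k
       * (qpoch (A * B * q) q k * qpoch (- (A * B * q)) q k))).
  { rewrite <- qpoch_double, <- Cpow_add_r, qpoch_shift; f_equal; f_equal; ring. }
  rewrite E2.
  specialize (D2 k); specialize (HTN' k Hk).
  assert (K1 := hmABq k). assert (K2 := hmABp k). assert (K3 := hBBp k).
  assert (K4 := qq_nz q q_lt k). assert (K5 := one_minus_AABB_nz).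
  field; repeat split; auto.
Qed.

Lemma eventually_small (x : C) (r : R) :
  (0 < r)%R -> eventually (fun m => (Cmod (x * (1 * q ^ m)) < r)%R).
Proof.
intros Hr; assert (Hx := Cmod_ge_0 x).
assert (F := pow_q_small q q_lt (r / (Cmod x + 1)) ltac:(apply Rdiv_lt_0_compat; lra)).
revert F; apply filter_imp; intros m Hm; rewrite Cmult_1_l, Cmod_mult.
apply (Rmult_lt_compat_r (Cmod x + 1)) in Hm; [|lra].
replace (r / (Cmod x + 1) * (Cmod x + 1))%R with r in Hm by (field; lra).
assert (H := Cmod_ge_0 (q ^ m)); nra.
Qed.

Lemma kernel_conv (z : C) (n : nat) :
  z <> 0 -> conv (kernel_coef z) (jacobi_coef z) n = numer_coef z n.
Proof.
intros Hz; revert z Hz.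
apply (laurent_unique q q_nz q_lt (fun z => conv (kernel_coef z) (jacobi_coef z) n)
  (fun z => numer_coef z n) (/ - (B * p))).
- apply Cinv_nz, d_nz.
- unfold kernel_coef, jacobi_coef, askey_wilson_z, qpochs, conv; cbn [fold_right].
  cbv beta zeta; laurent_tac.
- unfold numer_coef, row_factor, row_coef, conv; cbv beta zeta; laurent_tac.
- exists 0%nat; intros N _; revert n.
  set (z := / - (B * p) / q ^ N).
  assert (E : forall n, conv (kernel_coef z) (jacobi_coef z) n - numer_coef z n = 0).
  + apply (power_series_unique q q_nz q_lt _ 1 C1_nz).
    assert (HqN : (0 < Cmod (q ^ N))%R) by (apply Cmod_gt_0, Cpow_nz, q_nz).
    assert (F := fun x => eventually_small x 1 Rlt_0_1).
    assert (F' := eventually_and _ _ (eventually_small (A / - (B * p)) _ HqN)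
      (eventually_and _ _ (eventually_and _ _ (F (A * A)) (F (A * A * B * B * p)))
      (eventually_and _ _ (eventually_and _ _ (F (A * A * A * B * p * q)) (F (A * B * p)))
       (eventually_and _ _ (F (A * A * B * q * z)) (F (A * A * B * q * / z)))))).
    revert F'; apply filter_imp.
    intros m [H0 [[H1 H2] [[H3 H4] [H5 H6]]]].
    set (t := 1 * q ^ m) in *.
    assert (Ht : t <> 0) by (unfold t; apply Cmult_neq_0; [exact C1_nz | apply Cpow_nz, q_nz]).
    destruct (numer_series z t H1) as [s [Hs1 Hs2]].
    destruct (special_identity N t (A * t / - (B * p)) Ht eq_refl) with (s := s)
      as [L [HL EL]]; fold z; auto.
    { replace (A * t / - (B * p)) with (A / - (B * p) * t) by (unfold Cdiv; ring); exact H0. }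
    fold z in HL, EL.
    destruct (kernel_pser z t) as [M [HM1 HM2]].
    assert (HC := mertens _ _ M _ _ HM1 HM2 HL).
    fold (kernel_value z t) in HC; rewrite EL in HC.
    apply (is_Cseries_ext (fun n => conv (fun k => kernel_coef z k * t ^ k)
       (fun n => jacobi_coef z n * t ^ n) n + (- (1)) * (numer_coef z n * t ^ n))).
    { intros n; rewrite <- conv_pow; ring. }
    replace (0 : C) with (s + (- (1)) * s) by ring.
    apply is_Cseries_plus; [exact HC | apply is_Cseries_scal, Hs2].
  + intros n; specialize (E n).
    transitivity (conv (kernel_coef z) (jacobi_coef z) n - numer_coef z n + numer_coef z n);
      [ring | rewrite E; ring].
Qed.

Lemma generating_identity (z t : C) :
  z <> 0 -> t <> 0 -> (Cmod (A * A * t) < 1)%R ->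
  1 - - (A * A * B * B * p) * t <> 0 ->
  (forall k, qpoch (- (A * A * A * B * p * q) * t) q k <> 0) ->
  (forall k, qpoch (- (A * B * p) * t) q k <> 0) ->
  (forall k, qpoch (A * A * B * q * z * t) q k <> 0) ->
  (forall k, qpoch (A * A * B * q * / z * t) q k <> 0) ->
  exists W, is_Cseries (w8 z t) W /\
    forall L, is_Cseries (fun n => jacobi_coef z n * t ^ n) L ->
      kernel_value z t * L = prefactor z t * W.
Proof.
intros Hz Ht HAt H0 H1 H2 H3 H4.
destruct (numer_series z t HAt) as [s [Hs1 Hs2]].
assert (HP : prefactor z t <> 0).
{ unfold prefactor; repeat apply Cmult_neq_0; try (apply qpoch_inf_nz; assumption).
  - apply one_minus_nz, HAt.
  - apply one_minus_nz; rewrite Cmod_mult, Cmod_opp, <- Cmod_mult; exact HAt. }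
exists (s / prefactor z t); split.
- apply (is_Cseries_ext (fun k => / prefactor z t * (row_factor z k * t ^ k * row_value z t k))).
  + intros k; rewrite row_eq_W87 by auto; field; exact HP.
  + unfold Cdiv; rewrite Cmult_comm; apply is_Cseries_scal, Hs1.
- intros L HL; destruct (kernel_pser z t) as [M [HM1 HM2]].
  assert (HC := mertens _ _ M _ _ HM1 HM2 HL); fold (kernel_value z t) in HC.
  transitivity s; [|field; exact HP].
  refine (Ccvg_unique _ _ _ HC _).
  revert Hs2; apply is_Cseries_ext; intros n; rewrite <- conv_pow, kernel_conv by exact Hz.
  reflexivity.
Qed.

Lemma jacobi_series_cv (z t : C) :
  z <> 0 -> (Cmod (A * t * z) < 1)%R -> (Cmod (A * t * / z) < 1)%R ->
  exists L, is_Cseries (fun n => jacobi_coef z n * t ^ n) L.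
Proof.
intros Hz Ht1 Ht2; assert (Hp := p_nz).
set (u := fun k => qpoch (A * z) q k * qpoch (A * p * z) q k
   / (qpoch q q k * qpoch (A * A * p) q k) * (/ z) ^ k).
set (v := fun k => qpoch (- B * / z) q k * qpoch (- (B * p) * / z) q k
   / (qpoch q q k * qpoch (B * B * p) q k) * z ^ k).
assert (Hquot : forall x y w : C, (forall n, qpoch w q n <> 0) ->
  exists K : R, (0 < K)%R /\ forall k, (Cmod (qpoch x q k * qpoch y q k / (qpoch q q k * qpoch w q k)) <= K)%R).
{ intros x y w Hw.
  destruct (qpoch_upper q q_lt x) as [K1 [P1 H1]]. destruct (qpoch_upper q q_lt y) as [K2 [P2 H2]].
  destruct (qpoch_inv_upper q q_lt q (qq_nz q q_lt)) as [K3 [P3 H3]].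
  destruct (qpoch_inv_upper q q_lt w Hw) as [K4 [P4 H4]].
  exists (K1 * K2 * (K3 * K4))%R; split; [repeat apply Rmult_lt_0_compat; assumption|].
  intros k; replace (qpoch x q k * qpoch y q k / (qpoch q q k * qpoch w q k))
    with (qpoch x q k * qpoch y q k * (/ qpoch q q k * / qpoch w q k))
    by (field; split; auto using qq_nz).
  repeat apply Cmod_mult_le; auto. }
assert (Hgeo : forall (c : nat -> C) (K : R) (r y : C), (0 < K)%R -> (forall k, (Cmod (c k) <= K)%R) ->
  (Cmod (y * r) < 1)%R -> bsum (fun k => Cmod (c k * r ^ k * y ^ k)) (K * / (1 - Cmod (y * r)))).
{ intros c K r y HK Hc Hr.
  apply (bsum_le _ (fun k => (K * Cmod (y * r) ^ k)%R)).
  - intros k; split; [apply Cmod_ge_0|].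
    rewrite <- Cmult_assoc, <- Cpow_mult_l, (Cmult_comm r y), Cmod_mult, Cmod_pow.
    apply Rmult_le_compat_r; [apply pow_le, Cmod_ge_0 | apply Hc].
  - apply bsum_scal; [lra | apply bsum_geom; split; [apply Cmod_ge_0 | exact Hr]]. }
destruct (Hquot (A * z) (A * p * z) (A * A * p) hAAp) as [Ku [PKu HKu]].
destruct (Hquot (- B * / z) (- (B * p) * / z) (B * B * p) hBBp) as [Kv [PKv HKv]].
assert (Hu := Hgeo _ Ku (/ z) (A * t) PKu HKu Ht2).
assert (Hv := Hgeo _ Kv z (A * t) PKv HKv Ht1).
assert (Huv := bsum_conv (fun k => u k * (A * t) ^ k) (fun k => v k * (A * t) ^ k) _ _ Hu Hv).
set (om := fun n => qpoch (A * A * B * B) q n * qpoch (A * B * q) q n * qpoch (A * A * p) q n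
  * (/ qpoch (A * B) q n * / qpoch (- (A * B)) q n * / qpoch (- (A * B * p)) q n)).
assert (Hom : exists K : R, (0 < K)%R /\ forall n, (Cmod (om n) <= K)%R).
{ destruct (qpoch_upper q q_lt (A * A * B * B)) as [K1 [P1 H1]].
  destruct (qpoch_upper q q_lt (A * B * q)) as [K2 [P2 H2]].
  destruct (qpoch_upper q q_lt (A * A * p)) as [K3 [P3 H3]].
  destruct (qpoch_inv_upper q q_lt _ hAB) as [K4 [P4 H4]].
  destruct (qpoch_inv_upper q q_lt _ hmAB) as [K5 [P5 H5]].
  destruct (qpoch_inv_upper q q_lt _ hmABp) as [K6 [P6 H6]].
  exists (K1 * K2 * K3 * (K4 * K5 * K6))%R; split; [repeat apply Rmult_lt_0_compat; assumption|].
  intros n; unfold om; repeat apply Cmod_mult_le; auto. }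
destruct Hom as [K [HK Hom]].
assert (E : forall n, jacobi_coef z n * t ^ n
  = om n * conv (fun k => u k * (A * t) ^ k) (fun k => v k * (A * t) ^ k) n).
{ intros n; rewrite <- (conv_pow u v (A * t)).
  assert (E1 : A * (A * p) = A * A * p) by ring. assert (E2 : A * - B = - (A * B)) by ring.
  assert (E3 : A * - (B * p) = - (A * B * p)) by ring.
  assert (E4 : A * p * - B = - (A * B * p)) by ring. assert (E5 : - B * - (B * p) = B * B * p) by ring.
  unfold jacobi_coef, jacobi_weight; rewrite (askey_wilson_conv q q_nz q_lt), E1, E5;
    rewrite ?E1, ?E2, ?E3, ?E4, ?E5; auto using opp_nz, Cmult_neq_0.
  fold (conv u v n).
  unfold om, qpochs; cbn [fold_right]; rewrite Cpow_mult_l.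
  assert (K1 := hAB n). assert (K2 := hmAB n). assert (K3 := hmABp n). assert (K4 := hBBp n).
  assert (K5 := qq_nz q q_lt n).
  change (Csum (fun k => qpoch (A * z) q k * qpoch (A * p * z) q k
   / (qpoch q q k * qpoch (A * A * p) q k) * (/ z) ^ k * (qpoch (- B * / z) q (n - k) * qpoch (- (B * p) * / z) q (n - k)
   / (qpoch q q (n - k) * qpoch (B * B * p) q (n - k)) * z ^ (n - k))) n) with (conv u v n).
  generalize (conv u v n); intros.
  generalize dependent (qpoch (- (A * B)) q n); intros.
  generalize dependent (qpoch (- (A * B * p)) q n); intros.
  field; repeat split; auto. }
destruct (bsum_cv (fun n => jacobi_coef z n * t ^ n) _ _
  (fun n => eq_ind_r (fun x => (Cmod x <= _)%R)
     (Cmod_mult_le _ _ _ _ (Hom n) (Rle_refl _)) (E n))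
  (bsum_scal _ K _ (Rlt_le _ _ HK) Huv)) as [L [HL _]]; exists L; exact HL.
Qed.
End Jacobi.

Lemma Cexp_add (s s' : C) : Cexp (s + s') = Cexp s * Cexp s'.
Proof.
unfold Cexp, Cmult, Re, Im; simpl; rewrite exp_plus, cos_plus, sin_plus.
apply injective_projections; simpl; ring.
Qed.

Lemma Cexp_0 : Cexp 0 = 1.
Proof. unfold Cexp; simpl; rewrite exp_0, cos_0, sin_0; unfold RtoC; f_equal; ring. Qed.

Lemma Cexp_nz (s : C) : Cexp s <> 0.
Proof.
intros E; apply C1_nz; rewrite <- Cexp_0; replace (0 : C) with (s + - s) by ring.
rewrite Cexp_add, E; ring.
Qed.

Lemma qpow_add (l s s' : C) : qpow l (s + s') = qpow l s * qpow l s'.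
Proof. unfold qpow; rewrite <- Cexp_add; f_equal; ring. Qed.

Lemma qpow_INR (l s : C) n : qpow l (s * INR n) = qpow l s ^ n.
Proof.
induction n as [|n IH].
- simpl; unfold qpow; replace (s * 0 * l) with (0 : C) by ring; apply Cexp_0.
- rewrite S_INR, RtoC_plus, Cpow_S, <- IH, <- qpow_add; f_equal; ring.
Qed.

Lemma qpoch_inf_invertible_base (a q : C) :
  a <> 0 -> qpoch_inf_invertible a q -> (Cmod q <= 1)%R.
Proof.
intros Ha [l [Hl H]]; apply Rnot_lt_le; intros Hq; apply Hl.
apply Cmult_cancel_l with a; [exact Ha|]; rewrite Cmult_0_r.
apply (Ccvg_unique (fun n => a * qpoch a q n)); [apply Ccvg_scal, H|].
assert (Hd : Ccvg_to (fun n => qpoch a q (n + 1) + (- (1)) * qpoch a q n) 0).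
{ replace (0 : C) with (l + (- (1)) * l) by ring.
  apply Ccvg_plus; [apply Ccvg_shift, H | apply Ccvg_scal, H]. }
rewrite Ccvg_to_eps in Hd |- *; intros eps He; specialize (Hd eps He); revert Hd.
apply filter_imp; intros n; rewrite Nat.add_1_r; cbn [qpoch]; intros Hn.
eapply Rle_lt_trans; [|exact Hn].
replace (qpoch a q n * (1 - a * q ^ n) + - (1) * qpoch a q n - 0)
  with (- (a * qpoch a q n * q ^ n)) by ring.
replace (a * qpoch a q n - 0) with (a * qpoch a q n) by ring.
rewrite Cmod_opp, (Cmod_mult _ (q ^ n)), Cmod_pow.
rewrite <- (Rmult_1_r (Cmod (a * qpoch a q n))) at 1.
apply Rmult_le_compat_l; [apply Cmod_ge_0 | apply pow_R1_Rle; lra].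
Qed.

Lemma qpoch_inf_invertible_nz (a q : C) : qpoch_inf_invertible a q -> qpoch_inf a q <> 0.
Proof. intros [l [Hl H]]; unfold qpoch_inf; rewrite (Clim_correct _ _ H); exact Hl. Qed.

Theorem theorem3p2 (q logq x z alpha beta t : C)
  (hq0 : q <> 0) (hq1 : Cmod q <> 1%R)
  (hl : Cexp logq = q)
  (hz : z <> 0) (hx : x = (z + / z) / 2)
  (halpha : alpha <> 0) (hbeta : beta <> 0) (ht : t <> 0)
  (hconv : (Cmod (qpow logq (alpha + 1 / 2) * t) < 1)%R)
  (* the denominators occurring in the two sides do not vanish *)
  (hcoef : forall n : nat,
     qpochs [qpow logq (beta + 1); qpow logq ((alpha + beta + 1) / 2)] q n <> 0)
  (hjacobi : forall n : nat,
     qpochs [qpow logq (alpha + 1); - qpow logq ((alpha + beta + 1) / 2);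
             - qpow logq ((alpha + beta + 2) / 2)] q n <> 0)
  (hden : List.Forall (fun a => qpoch_inf_invertible a q)
     [qpow logq (2 * alpha + 2) * t ^ 2;
      - qpow logq (alpha + beta + 5 / 2) * t;
      - qpow logq (alpha + 1) * t;
      qpow logq (alpha / 2 + 1 / 4) * t * z;
      qpow logq (alpha / 2 + 1 / 4) * t * / z])
  (hW : W87_wd
     (- qpow logq (alpha + beta + 3 / 2) * t)
     (- qpow logq (alpha + 3 / 2) * t)
     (qpow logq ((beta - alpha) / 2))
     (qpow logq ((alpha + beta + 3) / 2))
     (- qpow logq (beta / 2 + 3 / 4) * z)
     (- qpow logq (beta / 2 + 3 / 4) * / z)
     q) :
  let lhs_term (n : nat) : C :=
    qpochs [qpow logq (alpha + beta + 1); qpow logq ((alpha + beta + 3) / 2)] q n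
    / qpochs [qpow logq (beta + 1); qpow logq ((alpha + beta + 1) / 2)] q n
    * t ^ n * cont_q_jacobi q logq n alpha beta x in
  (* the series on the right converges *)
  ex_Cseries (W87_term
     (- qpow logq (alpha + beta + 3 / 2) * t)
     (- qpow logq (alpha + 3 / 2) * t)
     (qpow logq ((beta - alpha) / 2))
     (qpow logq ((alpha + beta + 3) / 2))
     (- qpow logq (beta / 2 + 3 / 4) * z)
     (- qpow logq (beta / 2 + 3 / 4) * / z)
     q (- qpow logq (alpha + 1 / 2) * t)) /\
  (* the series on the left converges in its natural disc *)
  ((Cmod (qpow logq (alpha / 2 + 1 / 4) * t * z) < 1)%R ->
   (Cmod (qpow logq (alpha / 2 + 1 / 4) * t * / z) < 1)%R ->
   ex_Cseries lhs_term) /\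
  (* the identity *)
  (ex_Cseries lhs_term ->
   CSeries lhs_term
   = qpochs_inf
       [- qpow logq ((3 * alpha + beta + 5) / 2) * t;
        qpow logq (2 * alpha + 1) * t ^ 2;
        - qpow logq ((alpha + beta + 2) / 2) * t;
        qpow logq (alpha + beta / 2 + 7 / 4) * t * z;
        qpow logq (alpha + beta / 2 + 7 / 4) * t * / z] q
     / qpochs_inf
       [qpow logq (2 * alpha + 2) * t ^ 2;
        - qpow logq (alpha + beta + 5 / 2) * t;
        - qpow logq (alpha + 1) * t;
        qpow logq (alpha / 2 + 1 / 4) * t * z;
        qpow logq (alpha / 2 + 1 / 4) * t * / z] q
     * W87
         (- qpow logq (alpha + beta + 3 / 2) * t)
         (- qpow logq (alpha + 3 / 2) * t)
         (qpow logq ((beta - alpha) / 2))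
         (qpow logq ((alpha + beta + 3) / 2))
         (- qpow logq (beta / 2 + 3 / 4) * z)
         (- qpow logq (beta / 2 + 3 / 4) * / z)
         q (- qpow logq (alpha + 1 / 2) * t)).
Proof.
set (A := qpow logq (alpha / 2 + 1 / 4)) in *.
set (B := qpow logq (beta / 2 + 1 / 4)) in *.
set (p := qpow logq (1 / 2)).
assert (A_nz : A <> 0) by apply Cexp_nz.
assert (B_nz : B <> 0) by apply Cexp_nz.
assert (p_nz : p <> 0) by apply Cexp_nz.
assert (Hq1 : qpow logq 1 = q) by (unfold qpow; rewrite Cmult_1_l; exact hl).
assert (N2 : RtoC 2 <> 0) by (intros E; apply RtoC_inj in E; lra).
assert (N4 : RtoC 4 <> 0) by (intros E; apply RtoC_inj in E; lra).
assert (pp : p * p = q) by (unfold p; rewrite <- qpow_add, <- Hq1; f_equal; field; auto).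
assert (e1 : qpow logq (beta + 1) = B * B * p)
  by (unfold A, B, p; rewrite <- ?Hq1, <- !qpow_add; f_equal; field; auto).
assert (e2 : qpow logq ((alpha + beta + 1) / 2) = A * B)
  by (unfold A, B, p; rewrite <- ?Hq1, <- !qpow_add; f_equal; field; auto).
assert (e3 : qpow logq (alpha + 1) = A * A * p)
  by (unfold A, B, p; rewrite <- ?Hq1, <- !qpow_add; f_equal; field; auto).
assert (e4 : qpow logq ((alpha + beta + 2) / 2) = A * B * p)
  by (unfold A, B, p; rewrite <- ?Hq1, <- !qpow_add; f_equal; field; auto).
assert (e5 : qpow logq (2 * alpha + 1) = A * A * (A * A))
  by (unfold A, B, p; rewrite <- ?Hq1, <- !qpow_add; f_equal; field; auto).
assert (e6 : qpow logq (2 * alpha + 2) = A * A * (A * A) * q)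
  by (rewrite <- e5, <- Hq1, <- qpow_add; f_equal; ring).
assert (e7 : qpow logq (alpha + beta + 3 / 2) = A * A * B * B * p)
  by (unfold A, B, p; rewrite <- ?Hq1, <- !qpow_add; f_equal; field; auto).
assert (e8 : qpow logq (alpha + beta + 5 / 2) = A * A * B * B * p * q)
  by (rewrite <- e7, <- Hq1, <- qpow_add; f_equal; field; auto).
assert (e9 : qpow logq (alpha / 2 + 3 / 4) = A * p)
  by (unfold A, B, p; rewrite <- ?Hq1, <- !qpow_add; f_equal; field; auto).
assert (e10 : qpow logq (beta / 2 + 3 / 4) = B * p)
  by (unfold A, B, p; rewrite <- ?Hq1, <- !qpow_add; f_equal; field; auto).
assert (e11 : qpow logq (alpha + 1 / 2) = A * A)
  by (unfold A, B, p; rewrite <- ?Hq1, <- !qpow_add; f_equal; field; auto).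
assert (e12 : qpow logq (alpha + 3 / 2) = A * A * q)
  by (rewrite <- e11, <- Hq1, <- qpow_add; f_equal; field; auto).
assert (e13 : qpow logq ((alpha + beta + 3) / 2) = A * B * q)
  by (rewrite <- e2, <- Hq1, <- qpow_add; f_equal; field; auto).
assert (e14 : qpow logq ((beta - alpha) / 2) = B / A).
{ transitivity (qpow logq ((beta - alpha) / 2) * A / A); [field; exact A_nz|]; f_equal.
  unfold A, B; rewrite <- qpow_add; f_equal; field; auto. }
assert (e15 : qpow logq (alpha + beta + 1) = A * A * B * B)
  by (unfold A, B, p; rewrite <- ?Hq1, <- !qpow_add; f_equal; field; auto).
assert (e16 : qpow logq ((3 * alpha + beta + 5) / 2) = A * A * A * B * p * q)
  by (unfold A, B, p; rewrite <- ?Hq1, <- !qpow_add; f_equal; field; auto).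
assert (e17 : qpow logq (alpha + beta / 2 + 7 / 4) = A * A * B * q)
  by (unfold A, B, p; rewrite <- ?Hq1, <- !qpow_add; f_equal; field; auto).
rewrite e1, e2 in hcoef; rewrite e2, e3, e4 in hjacobi; rewrite e11 in hconv.
rewrite e3, e6, e8 in hden; rewrite e7, e10, e12, e13, e14 in hW.
rewrite e1, e2, e3, e4, e5, e6, e7, e8, e10, e11, e12, e13, e14, e15, e16, e17.
intros lhs_term.
inversion_clear hden as [|? ? I1 hd]; inversion_clear hd as [|? ? I2 hd'].
inversion_clear hd' as [|? ? I3 hd]; inversion_clear hd as [|? ? I4 hd'].
inversion_clear hd' as [|? ? I5 _].
assert (q_lt : (Cmod q < 1)%R).
{ assert (H := qpoch_inf_invertible_base _ _ (Cmult_neq_0 _ _ (opp_nz _ (Cmult_neq_0 _ _ (Cmult_neq_0 _ _ A_nz A_nz) p_nz)) ht) I3).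
  lra. }
apply qpoch_inf_invertible_nz in I1, I2, I3, I4, I5.
unfold qpochs in hcoef, hjacobi; cbn [fold_right] in hcoef, hjacobi.
assert (hBBp : forall n, qpoch (B * B * p) q n <> 0)
  by (intros n; specialize (hcoef n); rewrite !Cmult_neq_0_iff in hcoef; tauto).
assert (hAB : forall n, qpoch (A * B) q n <> 0)
  by (intros n; specialize (hcoef n); rewrite !Cmult_neq_0_iff in hcoef; tauto).
assert (hAAp : forall n, qpoch (A * A * p) q n <> 0)
  by (intros n; specialize (hjacobi n); rewrite !Cmult_neq_0_iff in hjacobi; tauto).
assert (hmAB : forall n, qpoch (- (A * B)) q n <> 0)
  by (intros n; specialize (hjacobi n); rewrite !Cmult_neq_0_iff in hjacobi; tauto).
assert (hmABp : forall n, qpoch (- (A * B * p)) q n <> 0)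
  by (intros n; specialize (hjacobi n); rewrite !Cmult_neq_0_iff in hjacobi; tauto).
clear hcoef hjacobi.
destruct hW as [w0 hW]; unfold qpochs in hW; cbn [fold_right] in hW.
replace (q * (- (A * A * B * B * p) * t) / (B / A)) with (- (A * A * A * B * p * q) * t) in hW
  by (field; auto).
replace (q * (- (A * A * B * B * p) * t) / (A * B * q)) with (- (A * B * p) * t) in hW
  by (field; auto).
replace (q * (- (A * A * B * B * p) * t) / (- (B * p) * z)) with (A * A * B * q * / z * t) in hW
  by (field; auto).
replace (q * (- (A * A * B * B * p) * t) / (- (B * p) * / z)) with (A * A * B * q * z * t) in hW
  by (field; auto).
assert (w2 : forall k, qpoch (- (A * A * A * B * p * q) * t) q k <> 0)
  by (intros n; specialize (hW n); rewrite !Cmult_neq_0_iff in hW; tauto).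
assert (w3 : forall k, qpoch (- (A * B * p) * t) q k <> 0)
  by (intros n; specialize (hW n); rewrite !Cmult_neq_0_iff in hW; tauto).
assert (w4 : forall k, qpoch (A * A * B * q * z * t) q k <> 0)
  by (intros n; specialize (hW n); rewrite !Cmult_neq_0_iff in hW; tauto).
assert (w5 : forall k, qpoch (A * A * B * q * / z * t) q k <> 0)
  by (intros n; specialize (hW n); rewrite !Cmult_neq_0_iff in hW; tauto).
clear hW.
assert (El : forall n, jacobi_coef q p A B z n * t ^ n = lhs_term n).
{ intros n; unfold lhs_term, cont_q_jacobi, jacobi_coef, jacobi_weight.
  rewrite e2, e4, e9, e10, qpow_INR; fold A B.
  rewrite (askey_wilson_at n x z _ _ _ _ _ hz hx); unfold qpochs; cbn [fold_right].
  assert (K1 := hAB n). assert (K2 := hmAB n). assert (K3 := hmABp n). assert (K4 := hBBp n).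
  assert (K5 := qq_nz q q_lt n).
  generalize (askey_wilson_z n z A (A * p) (- B) (- (B * p)) q); intros.
  generalize dependent (qpoch (- (A * B)) q n); intros.
  generalize dependent (qpoch (- (A * B * p)) q n); intros.
  field; repeat split; auto. }
destruct (generating_identity q p A B hq0 q_lt pp A_nz B_nz hAB hBBp hAAp hmAB hmABp
  z t hz ht hconv w0 w2 w3 w4 w5) as [W [HW HL]].
split; [exists W; exact HW|]; split.
- intros Hz1 Hz2.
  destruct (jacobi_series_cv q p A B hq0 q_lt pp A_nz B_nz hAB hBBp hAAp hmAB hmABp z t hz Hz1 Hz2)
    as [L HLs].
  exists L; exact (is_Cseries_ext _ _ _ El HLs).
- intros Hex; destruct (Hex : exists L : C, Ccvg_to (Csum lhs_term) L) as [L HLs]; unfold W87.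
  rewrite (CSeries_correct _ _ HW), (CSeries_correct _ _ HLs).
  assert (HLs' : Ccvg_to (Csum (fun n => jacobi_coef q p A B z n * t ^ n)) L)
    by (revert HLs; apply is_Cseries_ext; intros; symmetry; apply El).
  specialize (HL L HLs').
  unfold kernel_value, prefactor in HL; unfold qpochs_inf; cbn [fold_right].
  replace (A * A * B * q * t * z) with (A * A * B * q * z * t) by ring.
  replace (A * A * B * q * t * / z) with (A * A * B * q * / z * t) by ring.
  replace (A * t * z) with (A * z * t) in * by ring.
  replace (A * t * / z) with (A * / z * t) in * by ring.
  rewrite (qpoch_inf_split q q_lt (A * A * (A * A) * t ^ 2) 1).
  replace (A * A * (A * A) * t ^ 2 * q ^ 1) with (A * A * (A * A) * q * t ^ 2) by (simpl; ring).
  match type of HL with ?K * L = ?R =>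
    assert (HK : K <> 0) by (repeat apply Cmult_neq_0; assumption);
    transitivity (K * L / K); [field; repeat split; assumption|]; rewrite HL end.
  simpl qpoch; field; repeat split; assumption.
Qed.
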